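(* There exists a unique way of choosing the signs of the equivariant weights $\mathsf{w}_\pi$, for all solid partitions $\pi$ of size $|\pi|\leqslant 6$, such that $$\sum_{\pi} L_\pi(d_1,d_2,d_3,d_4)\,\mathsf{w}_\pi\,q^{|\pi|}\equiv M(-q)^{\frac{(d_1\lambda_1+d_2\lambda_2+d_3\lambda_3+d_4\lambda_4)(-\lambda_1\lambda_2\lambda_3-\lambda_1\lambda_2\lambda_4-\lambda_1\lambda_3\lambda_4-\lambda_2\lambda_3\lambda_4)}{\lambda_1\lambda_2\lambda_3\lambda_4}}\pmod{q^7}$$ in $K(d_1,d_2,d_3,d_4)[\![q]\!]$, where $K=\frac{\mathbb{Q}(\lambda_1,\lambda_2,\lambda_3,\lambda_4)}{(\lambda_1+\lambda_2+\lambda_3+\lambda_4)}$, the sum is over solid partitions, and $M(q)=\prod_{n\geqslant1}(1-q^n)^{-n}$ is the MacMahon function.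
   Context: A solid partition $\pi=\{\pi_{ijk}\}_{i,j,k\geqslant1}$ is a sequence of non-negative integers with $\pi_{ijk}\geqslant\pi_{i+1,j,k}$, $\pi_{ijk}\geqslant\pi_{i,j+1,k}$, $\pi_{ijk}\geqslant\pi_{i,j,k+1}$ for all $i,j,k\geqslant1$ and finite size $|\pi|:=\sum\pi_{ijk}<\infty$. Put $$Z_\pi=\sum_{i,j,k\geqslant1}\sum_{l=1}^{\pi_{ijk}}t_1^{i-1}t_2^{j-1}t_3^{k-1}t_4^{l-1},$$ and let $\overline{(\cdot)}$ be the involution on Laurent polynomials with $t_i\mapsto t_i^{-1}$. Define $$\mathsf{V}_\pi:=Z_\pi+\frac{\overline{Z}_\pi}{t_1t_2t_3t_4}-\frac{Z_\pi\overline{Z}_\pi(1-t_1)(1-t_2)(1-t_3)(1-t_4)}{t_1t_2t_3t_4}.$$ $K=\mathbb{Q}(\lambda_1,\lambda_2,\lambda_3,\lambda_4)/(\lambda_1+\lambda_2+\lambda_3+\lambda_4)$ denotes the field $\mathbb{Q}(\lambda_1,\lambda_2,\lambda_3)$ with $\lambda_4:=-(\lambda_1+\lambda_2+\lambda_3)$. After specializing $t_1t_2t_3t_4=1$ (i.e. identifying $t^w$ and $t^{w'}$ when $w-w'\in\mathbb{Z}(1,1,1,1)$), write $\mathsf{V}_\pi=\sum_w c_w t^w$, $w\in\mathbb{Z}^4/\mathbb{Z}(1,1,1,1)$, and set $e_T(-\mathsf{V}_\pi):=\prod_w(w_1\lambda_1+w_2\lambda_2+w_3\lambda_3+w_4\lambda_4)^{-c_w}\in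 K$; the coefficient $c_0$ of the trivial weight is $\leqslant0$, with the conventions $0^0=1$ and $e_T(-\mathsf V_\pi)=0$ if $c_0<0$. The element $(-1)^{|\pi|}e_T(-\mathsf{V}_\pi)$ is a square in $K$, and $$\mathsf{w}_\pi:=\pm\sqrt{(-1)^{|\pi|}e_T(-\mathsf{V}_\pi)}\in K$$ is defined up to sign. Finally $$L_\pi(d_1,d_2,d_3,d_4):=\prod_{i,j,k\geqslant1}\prod_{l=1}^{\pi_{ijk}}\big((d_1+i-1)\lambda_1+(d_2+j-1)\lambda_2+(d_3+k-1)\lambda_3+(d_4+l-1)\lambda_4\big).$$ $M(-q)^a:=\exp(a\log M(-q))$. *)

(* Defs.v *)
From mathcomp Require Import all_boot all_order all_algebra finmap.
From mathcomp Require Import freeg mpoly.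

Set Implicit Arguments.
Unset Strict Implicit.
Unset Printing Implicit Defensive.

Import GRing.Theory.
Local Open Scope fset_scope.
Local Open Scope ring_scope.

(* Indices start at 0 rather than 1: [pi (i, j, k)] is pi_{i+1,j+1,k+1}.     *)
Definition box : Type := (nat * nat * nat)%type.
Definition array := {fsfun box -> nat with 0%N}.

Definition is_solid_partition (pi : array) : Prop :=
  forall i j k, [/\ (pi (i.+1, j, k) <= pi (i, j, k))%N,
                    (pi (i, j.+1, k) <= pi (i, j, k))%N
                  & (pi (i, j, k.+1) <= pi (i, j, k))%N].

Definition sp_size (pi : array) : nat := \sum_(b <- finsupp pi) pi b.

Section Enumeration.

Definition solidb (pi : array) : bool :=
  all (fun b => let: (i, j, k) := b in
     [&& (pi (i, j, k) <= pi (i.-1, j, k))%N,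
         (pi (i, j, k) <= pi (i, j.-1, k))%N
       & (pi (i, j, k) <= pi (i, j, k.-1))%N]) (finsupp pi).

Lemma solidP (pi : array) : reflect (is_solid_partition pi) (solidb pi).
Proof.
apply: (iffP allP) => [H i j k | H [[i j] k] _].
  split.
  - case: (finsuppP pi (i.+1, j, k)) => // /H /=; by case/and3P.
  - case: (finsuppP pi (i, j.+1, k)) => // /H /=; by case/and3P.
  - case: (finsuppP pi (i, j, k.+1)) => // /H /=; by case/and3P.
apply/and3P; split.
- by case: i => //= i; case: (H i j k).
- by case: j => //= j; case: (H i j k).
- by case: k => //= k; case: (H i j k).
Qed.

Definition cube (n : nat) : {fset box} :=
  [fset b in [seq (ij, k) | ij <- [seq (i, j) | i <- iota 0 n, j <- iota 0 n],
                            k <- iota 0 n]].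

(* A solid partition of size n is supported in the cube of side n and has     *)
(* entries at most n, so it occurs among these finitely many candidates.      *)
Definition solid_partitions (n : nat) : seq array :=
  [seq pi <- undup
     [seq [fsfun b : cube n => f b : nat | 0%N] | f : {ffun cube n -> 'I_n.+1}]
  | solidb pi & sp_size pi == n].

Lemma solid_partitions_uniq n : uniq (solid_partitions n).
Proof. exact/filter_uniq/undup_uniq. Qed.

Lemma mem_cube n i j k :
  ((i, j, k) \in cube n) = [&& (i < n)%N, (j < n)%N & (k < n)%N].
Proof.
rewrite inE /=; apply/allpairsP/and3P => [[[ij k'] /= [/allpairsP]]|].
  by case=> -[i' j'] /= [+ + ->] + [-> -> ->]; rewrite !mem_iota.
case=> hi hj hk; exists ((i, j), k); split; rewrite ?mem_iota //.
by apply/allpairsP; exists (i, j); rewrite /= !mem_iota.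
Qed.

Lemma le_sp_size (pi : array) (s : seq box) :
  uniq s -> (\sum_(b <- s) pi b <= sp_size pi)%N.
Proof.
move=> us; rewrite /sp_size (bigID (mem (finsupp pi))) /=.
rewrite [X in (_ + X)%N]big1 ?addn0; last by move=> b /fsfun_dflt.
rewrite -big_filter; set t := filter _ _.
have ut : uniq t by exact: filter_uniq.
rewrite [X in (_ <= X)%N](bigID (mem t)) /=.
apply: leq_trans (leq_addr _ _); rewrite -[X in (_ <= X)%N]big_filter.
rewrite (perm_big [seq b <- finsupp pi | b \in t]) //.
apply: uniq_perm => //; first exact/filter_uniq/fset_uniq.
by move=> b; rewrite mem_filter andbC; case: (boolP (b \in t)) => //;
  rewrite ?andbF // mem_filter => /andP[->].
Qed.

Lemma solid_mono (pi : array) i j k i' j' k' : is_solid_partition pi ->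
  (i' <= i)%N -> (j' <= j)%N -> (k' <= k)%N ->
  (pi (i, j, k) <= pi (i', j', k'))%N.
Proof.
move=> S /subnK<- /subnK<- /subnK<-.
apply: (@leq_trans (pi (i', j', (k - k') + k')%N)); last first.
  by elim: (k - k')%N => // m; apply: leq_trans; case: (S i' j' (m + k')%N).
apply: (@leq_trans (pi (i', (j - j') + j', (k - k') + k')%N)); last first.
  by elim: (j - j')%N => // m; apply: leq_trans;
     case: (S i' (m + j')%N ((k - k') + k')%N).
by elim: (i - i')%N => // m; apply: leq_trans;
   case: (S (m + i')%N ((j - j') + j')%N ((k - k') + k')%N).
Qed.

Lemma supp_cube (pi : array) b : is_solid_partition pi -> b \in finsupp pi ->
  b \in cube (sp_size pi).
Proof.
case: b => [[i j] k] S; rewrite mem_finsupp -lt0n => p0.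
have line (f : nat -> box) m : injective f ->
    (forall l, (l <= m)%N -> (0 < pi (f l))%N) -> (m < sp_size pi)%N.
  move=> injf Hf.
  have u : uniq [seq f l | l <- iota 0 m.+1].
    by rewrite map_inj_uniq ?iota_uniq.
  apply: leq_trans (le_sp_size pi u).
  rewrite big_map -[X in (X <= _)%N](size_iota 0) -sum1_size.
  rewrite big_seq [X in (_ <= X)%N]big_seq; apply: leq_sum => l.
  by rewrite mem_iota add0n ltnS; exact: Hf.
rewrite mem_cube; apply/and3P; split.
- apply: (line (fun l => (l, j, k))) => [? ? []//|l hl].
  exact: leq_trans p0 (solid_mono S hl _ _).
- apply: (line (fun l => (i, l, k))) => [? ? []//|l hl].
  exact: leq_trans p0 (solid_mono S _ hl _).
- apply: (line (fun l => (i, j, l))) => [? ? []//|l hl].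
  exact: leq_trans p0 (solid_mono S _ _ hl).
Qed.

Lemma mem_solid_partitions n (pi : array) :
  reflect (is_solid_partition pi /\ sp_size pi = n) (pi \in solid_partitions n).
Proof.
rewrite mem_filter; apply: (iffP idP) => [/andP[/andP[/solidP ? /eqP ?]]//|].
case=> S <-; rewrite eqxx andbT; apply/andP; split; first exact/solidP.
rewrite mem_undup; apply/imageP.
have bnd b : (pi b < (sp_size pi).+1)%N.
  rewrite ltnS; apply: leq_trans (le_sp_size pi (s := [:: b]) _) => //.
  by rewrite big_seq1.
exists [ffun b : cube (sp_size pi) => Ordinal (bnd (val b))] => //.
apply/fsfunP => b; rewrite fsfun_ffun; case: insubP => [u _ <-|].
  by rewrite /= ffunE.
by apply: contraNeq => nz; apply: supp_cube; rewrite // mem_finsupp.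
Qed.

End Enumeration.

(* t^w is t_1^{w_1} t_2^{w_2} t_3^{w_3} t_4^{w_4}, with w_a = w 0 (a - 1).     *)
Definition weight : Type := 'rV[int]_4.
Definition laurent : Type := {freeg weight / int}.

Section Laurent.

Definition lmono (w : weight) : laurent := << w >>.

Definition lmul (f g : laurent) : laurent :=
  \sum_(u <- dom f) \sum_(v <- dom g) << coeff u f * coeff v g *g u + v >>.

Definition lbar (f : laurent) : laurent :=
  \sum_(u <- dom f) << coeff u f *g - u >>.

(* (i, j, k, l), for the l-th layer of the (i, j, k)-th entry.                *)
Definition box_weight (b : box) (l : nat) : weight :=
  let: (i, j, k) := b in \row_(a < 4) [:: i%:Z; j%:Z; k%:Z; l%:Z]`_a.

Definition Zpart (pi : array) : laurent :=
  \sum_(b <- finsupp pi) \sum_(l < pi b) lmono (box_weight b l).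

Definition all_ones : weight := const_mx 1.

Definition one_minus_t (a : 'I_4) : laurent := lmono 0 - lmono (delta_mx 0 a).

Definition Vpart (pi : array) : laurent :=
  Zpart pi + lmul (lbar (Zpart pi)) (lmono (- all_ones))
  - lmul (lmul (lmul (Zpart pi) (lbar (Zpart pi)))
               (\big[lmul/lmono 0]_(a < 4) one_minus_t a))
         (lmono (- all_ones)).

(* The class of w in Z^4 / Z(1,1,1,1) is encoded by its unique representative *)
(* with w_4 = 0.                                                              *)
Definition wclass (w : weight) : weight := w - const_mx (w 0 ord_max).

(* Specialization to t_1 t_2 t_3 t_4 = 1.                                     *)
Definition cy_specialize (f : laurent) : laurent :=
  \sum_(w <- dom f) << coeff w f *g wclass w >>.

End Laurent.

Definition K : fieldType := {fraction {mpoly rat[3]}}.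

Definition lam (a : 'I_4) : K :=
  match insub (nat_of_ord a) : option 'I_3 with
  | Some i => tofrac ('X_i : {mpoly rat[3]})
  | None => - \sum_(i < 3) tofrac ('X_i : {mpoly rat[3]})
  end.

Definition wt (w : weight) : K := \sum_(a < 4) (w 0 a)%:~R * lam a.

(* e_T(-f). Since [0 ^ 0 = 1], and [0 ^ c = 0] for every nonzero integer c,   *)
(* the trivial weight contributes according to the stated conventions.        *)
Definition eT_opp (f : laurent) : K :=
  \prod_(w <- dom (cy_specialize f)) wt w ^ (- coeff w (cy_specialize f)).

(* w is +- sqrt((-1)^|pi| e_T(-V_pi)); that a square root exists in K is part *)
(* of the assertion.                                                          *)
Definition is_weight_of (pi : array) (w : K) : Prop :=
  w ^+ 2 = (-1) ^+ sp_size pi * eT_opp (Vpart pi).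

Definition Kd : fieldType := {fraction {mpoly K[4]}}.

Definition toKd (x : K) : Kd := tofrac (x%:MP_[4]).

Definition dvar (a : 'I_4) : Kd := tofrac ('X_a : {mpoly K[4]}).

Definition Lpart (pi : array) : Kd :=
  \prod_(b <- finsupp pi) \prod_(l < pi b)
    \sum_(a < 4) (dvar a + (box_weight b l 0 a)%:~R) * toKd (lam a).

(* Formal power series in q, as coefficient sequences.                        *)
Section PowerSeries.
Variable F : fieldType.

Definition fps : Type := nat -> F.

Definition fps_one : fps := fun n => (n == 0%N)%:R.

Definition fps_sub (f g : fps) : fps := fun n => f n - g n.

Definition fps_scale (c : F) (f : fps) : fps := fun n => c * f n.

Definition fps_mul (f g : fps) : fps :=
  fun n => \sum_(i < n.+1) f i * g (n - i)%N.

Definition fps_pow (f : fps) (m : nat) : fps := iter m (fps_mul f) fps_one.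

Definition fps_X (m : nat) : fps := fun n => (n == m)%:R.

(* sum_m (a m) g^m for g without constant term: only the m <= n contribute to *)
(* the coefficient of q^n.                                                    *)
Definition fps_comp (a : nat -> F) (g : fps) : fps :=
  fun n => \sum_(m < n.+1) a m * fps_pow g m n.

(* 1 / (1 - g), exp g, and log (1 + g), for g without constant term; the m = 0 *)
(* term of the logarithm vanishes because [0^-1 = 0].                         *)
Definition fps_geom (g : fps) : fps := fps_comp (fun _ => 1) g.

Definition fps_exp (g : fps) : fps := fps_comp (fun m => (m`!%:R)^-1) g.

Definition fps_log1p (g : fps) : fps :=
  fps_comp (fun m => (-1) ^+ m.+1 / m%:R) g.

Definition fps_neg_arg (f : fps) : fps := fun n => (-1) ^+ n * f n.

Definition fps_rpow (f : fps) (a : F) : fps :=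
  fps_exp (fps_scale a (fps_log1p (fps_sub f fps_one))).

(* The factors (1 - q^m)^(-m) with m > n do not affect the coefficient of q^n. *)
Definition macmahon : fps := fun n =>
  (\big[fps_mul/fps_one]_(1 <= m < n.+1) fps_pow (fps_geom (fps_X m)) m) n.

Definition fps_eq_mod (N : nat) (f g : fps) : Prop :=
  forall n, (n < N)%N -> f n = g n.

End PowerSeries.

(* sum over all solid partitions pi of L_pi w_pi q^|pi|                       *)
Definition partition_series (w : array -> K) : fps Kd :=
  fun n => \sum_(pi <- solid_partitions n) Lpart pi * toKd (w pi).

(* The sum runs over a in {1,2,3,4}, each term omitting the factor lambda_a.  *)
Definition exponent : Kd :=
  (\sum_(a < 4) dvar a * toKd (lam a))
  * toKd (- \sum_(a < 4) \prod_(b < 4 | b != a) lam b)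
  / toKd (\prod_(a < 4) lam a).

Definition sign_choice (w : array -> K) : Prop :=
  forall pi, is_solid_partition pi -> (sp_size pi <= 6)%N ->
    is_weight_of pi (w pi).

(* Main.v *)
Require Import Defs.
From Stdlib Require Import ZArith QArith Qpower.
From HB Require Import structures.
From mathcomp Require Import all_boot all_order all_algebra finmap.
From mathcomp Require Import freeg mpoly.
From mathcomp Require Import zify ssrZ ring.

(* L_pi depends on the d_a only through D = sum_a d_a lambda_a. Writing V = v + bar v modulo
   t_1 t_2 t_3 t_4 = 1, with v = Z - Z bar Z (1 - 1/t_1) (1 - 1/t_2) (1 - 1/t_3), the weights are
   w_pi = (-1)^(|pi| + #{(a, a, a, d) in pi : a < d}) e_T(-v), the sign being that of Nekrasov and
   Piazzalunga. After this, the coefficient of q^n in the difference of both sides is an explicit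
   sum R_n of products of powers of linear forms in D, lambda_1, lambda_2, lambda_3, homogeneous of
   degree 0.

   R_n = 0: the principal parts of R_n along each linear form other than the lambda_a cancel, so
   that on a line R_n (lambda_1 lambda_2 lambda_3 lambda_4)^n is a polynomial of degree at most 4 n.
   It vanishes where lambda_a + lambda_b = 0, since every term does. By the symmetry under S_4, a
   generic line contains enough zeros as soon as R_n vanishes on one plane H (and hence on the 24
   planes of its orbit); a generic line in H contains enough zeros as soon as R_n vanishes at 4 n - 2
   numerical values of (lambda_1 : lambda_2 : lambda_3), for all D, which is a finite computation.

   Uniqueness: two choices of signs differ by a linear relation with coefficients 0 and 1 between the
   terms L_pi w_pi of each degree, and these are linearly independent. This is checked over F_127, in
   blocks: on the plane where the factor of L_pi attached to a box vanishes, only the partitions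
   which do not contain this box remain. *)

Set Implicit Arguments.
Unset Strict Implicit.
Unset Printing Implicit Defensive.
Import GRing.Theory.
Delimit Scope Z_scope with BZ.

(** * Products of powers of linear forms *)

(** D is transcendental over K, so no nonzero integer linear form vanishes at (D, lambda_1,
    lambda_2, lambda_3). Generic position can therefore be expressed and tested with integer forms
    alone. On a line, divisibility in several variables reduces to the factor theorem for k[X]. The
    bound 4 n is the degree of (lambda_1 lambda_2 lambda_3 lambda_4)^n, since R_n itself has degree
    0; hence 4 n + 1 zeros are required. An orbit of 24 planes and the three planes lambda_a +
    lambda_b = 0 give 27 zeros, and 27 > 4 n holds up to n = 6 and fails for n = 7: this is what
    lets a single plane H suffice. For uniqueness, the coefficients 0 and 1 remain distinct in
    F_127, so a relation over K can be reduced modulo 127 without losing information. The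
    computations are boolean checks. Their correctness lemmas rest on tests inside the checks and
    not on properties of gcds, of trial division, of the order used for sorting, or of the chosen
    points and directions. *)

Section LinearForms.
Local Open Scope Z_scope.

(* [(d, a, b, c)] stands for the linear form d D + a lambda_1 + b lambda_2 + c lambda_3. *)
Definition form : Type := (Z * Z * Z * Z)%type.

(* Forms involving D come first. *)
Definition fcmp (f g : form) : comparison :=
  let: (d1, a1, b1, c1) := f in let: (d2, a2, b2, c2) := g in
  match Z.compare d2 d1 with Eq =>
    match Z.compare a1 a2 with Eq =>
      match Z.compare b1 b2 with Eq => Z.compare c1 c2 | r => r end
    | r => r end
  | r => r end.
Definition fle f g := match fcmp f g with Gt => false | _ => true end.
Definition feq f g := match fcmp f g with Eq => true | _ => false end.

Definition fscale (s : Z) (f : form) : form :=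
  let: (d, a, b, c) := f in (s * d, s * a, s * b, s * c).
Definition fsub (f g : form) : form :=
  let: (d1, a1, b1, c1) := f in let: (d2, a2, b2, c2) := g in
  (d1 - d2, a1 - a2, b1 - b2, c1 - c2).
Definition isD (f : form) := let: (d, _, _, _) := f in ~~ (d =? 0).
Definition fdot (f g : form) : Z :=
  let: (d1, a1, b1, c1) := f in let: (d2, a2, b2, c2) := g in
  d1 * d2 + a1 * a2 + b1 * b2 + c1 * c2.
Definition cross (f g : form) : form :=
  let: (_, a2, b2, c2) := f in let: (_, a3, b3, c3) := g in
  (0, b2 * c3 - c2 * b3, c2 * a3 - a2 * c3, a2 * b3 - b2 * a3).

Definition content (f : form) : Z :=
  let: (d, a, b, c) := f in
  let g := match d with
    | Zpos xH => 1 | 0 => Z.gcd a (Z.gcd b c)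
    | _ => Z.gcd d (Z.gcd a (Z.gcd b c)) end in
  let lead := match d with 0 => match a with 0 => match b with
    | 0 => c | _ => b end | _ => a end | _ => d end in
  match lead with Zneg _ => - g | _ => g end.

(* The test makes [fv_norm] hold without any property of [content]. *)
Definition fnorm (f : form) : Z * form :=
  let s := content f in
  let h := match s with 1 => f | _ =>
    let: (d, a, b, c) := f in (d / s, a / s, b / s, c / s) end in
  if feq (fscale s h) f then (s, h) else (1, f).

Section Collect.
Variables (C : Type) (add : C -> C -> C) (isz : C -> bool).
Definition kle (x y : form * C) := fle x.1 y.1.
(** Merging neighbours removes all repetitions only from a sorted list, but the lemmas on values
    hold for any list, so [fcmp] is never shown to be an order. *)
Fixpoint comb (x : form) (e : C) (s : seq (form * C)) : seq (form * C) :=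
  match s with
  | [::] => if isz e then [::] else [:: (x, e)]
  | (y, e') :: s' =>
      if feq x y then comb x (add e e') s'
      else if isz e then comb y e' s' else (x, e) :: comb y e' s'
  end.
Definition collect (s : seq (form * C)) :=
  match sort kle s with [::] => [::] | (x, e) :: s' => comb x e s' end.
End Collect.

Definition zcollect := collect Z.add (Z.eqb 0).
Definition qisz (q : Q) := 0 =? Qnum q.
Definition qadd (x y : Q) := Qred (Qplus x y).
Definition qmul (x y : Q) := Qred (Qmult x y).
Definition qpow (s e : Z) : Q := Qpower (inject_Z s) e.
Definition qcollect := collect qadd qisz.

(* [(c, l)] stands for c times the product of the forms in [l] raised to the given exponents. *)
Definition term : Type := (Q * seq (form * Z))%type.

Definition tnorm (t : term) : term :=
  let l := [seq (let: (c, h) := fnorm x.1 in (qpow c x.2, (h, x.2))) | x <- t.2] in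
  (foldr (fun x q => qmul x.1 q) t.1 l, unzip2 l).

Definition expo (l : form) (s : seq (form * Z)) : Z :=
  foldr (fun fe a => if feq l fe.1 then fe.2 + a else a) 0 s.
Definition totexp (s : seq (form * Z)) : Z := foldr (fun fe a => fe.2 + a) 0 s.

Fixpoint keyeq (s t : seq (form * Z)) : bool :=
  match s, t with
  | [::], [::] => true
  | (f, e) :: s', (g, e') :: t' => feq f g && ((e =? e') && keyeq s' t')
  | _, _ => false end.

Definition formsof (ts : seq term) : seq form :=
  unzip1 (zcollect (flatten [seq [seq (fe.1, 1) | fe <- t.2] | t <- ts])).
(** The last form is - lambda_4. *)
Definition lamf : seq form := [:: (0, 1, 0, 0); (0, 0, 1, 0); (0, 0, 0, 1); (0, 1, 1, 1)].
(* On these planes all terms vanish. *)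
Definition anchors : seq form := [:: (0, 1, 1, 0); (0, 1, 0, 1); (0, 0, 1, 1)].
Definition islam (f : form) := has (feq f) lamf.
Definition maxden (ts : seq term) : seq (form * Z) :=
  collect Z.max (fun e => e <=? 0)
    (flatten [seq [seq (fe.1, - fe.2) | fe <- t.2 & fe.2 <? 0] | t <- ts]).
Definition poledens (ts : seq term) : seq (form * Z) :=
  [seq fe <- maxden ts | ~~ islam fe.1].
Definition poles (ts : seq term) : seq form := unzip1 (poledens ts).

End LinearForms.

Local Open Scope ring_scope.

Lemma feqP (f g : form) : reflect (f = g) (feq f g).
Proof.
case: f g => [[[d a] b] c] [[[d' a'] b'] c']; rewrite /feq /fcmp.
apply: (iffP idP) => [|[-> -> -> ->]]; last by rewrite !Z.compare_refl.
case E1: Z.compare => //; case E2: Z.compare => //.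
case E3: Z.compare => //; case E4: Z.compare => // _.
by move/Z.compare_eq: E1 => ->; move/Z.compare_eq: E2 => ->;
  move/Z.compare_eq: E3 => ->; move/Z.compare_eq: E4 => ->.
Qed.

Definition qeqb (x y : Q) : bool :=
  Z.eqb (Qnum x) (Qnum y) && Z.eqb (Zpos (Qden x)) (Zpos (Qden y)).
Lemma qeqP : Equality.axiom qeqb.
Proof.
move=> [n d] [n' d']; apply: (iffP andP) => [[h1 h2]|[-> ->]]; last first.
  by rewrite /= Z.eqb_refl Pos.eqb_refl.
have -> : n = n' by apply/Z.eqb_eq.
by have [->] : Zpos d = Zpos d' by apply/Z.eqb_eq.
Qed.
HB.instance Definition _ := hasDecEq.Build Q qeqP.

Definition zi (R : pzRingType) (z : Z) : R := (int_of_Z z)%:~R.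
Arguments zi {R}.

Section Zi.
Variable R : pzRingType.
Implicit Types x y : Z.
Lemma zi0 : zi Z0 = 0 :> R. Proof. by []. Qed.
Lemma zi1 : zi (Zpos xH) = 1 :> R. Proof. by []. Qed.
Lemma ziD x y : zi (x + y)%BZ = zi x + zi y :> R.
Proof. by rewrite /zi -intrD -rmorphD. Qed.
Lemma ziN x : zi (- x)%BZ = - zi x :> R.
Proof. by rewrite /zi -mulrNz -(rmorphN int_of_Z). Qed.
Lemma ziB x y : zi (x - y)%BZ = zi x - zi y :> R.
Proof. by rewrite -Z.add_opp_r ziD ziN. Qed.
Lemma ziM x y : zi (x * y)%BZ = zi x * zi y :> R.
Proof. by rewrite /zi -intrM -rmorphM. Qed.
End Zi.

Lemma zi_rmorph (R S : pzRingType) (f : {rmorphism R -> S}) x : f (zi x) = zi x.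
Proof. exact: rmorph_int. Qed.

Local Arguments Z.eqb : simpl never.
Local Arguments Z.add : simpl never.
Local Arguments Z.mul : simpl never.
Local Arguments Z.sub : simpl never.
Local Arguments Z.opp : simpl never.

Definition pt (k : Type) : Type := (k * k * k * k)%type.

Definition char0 (k : pzRingType) := forall z, zi z = 0 :> k -> z = Z0.

HB.lock Definition qv (k : fieldType) (q : Q) : k := zi (Qnum q) / zi (Zpos (Qden q)).

Section Values.
Variable k : fieldType.
Implicit Types (z : pt k) (f g : form) (s : seq (form * Z)) (t : term).

Definition fv z f : k :=
  let: (zd, za, zb, zc) := z in let: (d, a, b, c) := f in
  zi d * zd + zi a * za + zi b * zb + zi c * zc.
(** [V] is arbitrary and not only evaluation at a point: for the square roots it will be an
    evaluation with 0 replaced by 1, a function that detects the zero form, and the constant -1. *)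
Definition fprod (V : form -> k) s : k := \prod_(fe <- s) V fe.1 ^ int_of_Z fe.2.
Definition lv z s : k := \prod_(fe <- s) fv z fe.1 ^ int_of_Z fe.2.
Definition tv z t : k := qv k t.1 * lv z t.2.
Definition sv z (ts : seq term) : k := \sum_(t <- ts) tv z t.

Lemma fv_scale z x f : fv z (fscale x f) = zi x * fv z f.
Proof.
by case: z f => [[[zd za] zb] zc] [[[d a] b] c] /=; rewrite !ziM; ring.
Qed.

Lemma fv_sub z f g : fv z (fsub f g) = fv z f - fv z g.
Proof.
case: z f g => [[[zd za] zb] zc] [[[d a] b] c] [[[d' a'] b'] c'] /=.
by rewrite !ziB; ring.
Qed.

Lemma fv_norm z f : fv z f = zi (fnorm f).1 * fv z (fnorm f).2.
Proof.
rewrite /fnorm; case: feqP => [e|_] /=; last by rewrite zi1 mul1r.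
by rewrite -{1}e fv_scale.
Qed.

Lemma lv_nil z : lv z [::] = 1. Proof. exact: big_nil. Qed.
Lemma lv_cons z fe s : lv z (fe :: s) = fv z fe.1 ^ int_of_Z fe.2 * lv z s.
Proof. exact: big_cons. Qed.
Lemma lv_cat z s1 s2 : lv z (s1 ++ s2) = lv z s1 * lv z s2.
Proof. exact: big_cat. Qed.

Definition nonvan z s := forall fe, fe \in s -> fv z fe.1 != 0.

(** The rule x^(e + e') = x^e x^e' fails at x = 0, which explains the nonvanishing hypotheses here
    and in the other lemmas on the value of [zcollect]. *)
Lemma fprod_comb (V : form -> k) x e s : V x != 0 -> (forall fe, fe \in s -> V fe.1 != 0) ->
  fprod V (comb Z.add (Z.eqb 0) x e s) = V x ^ int_of_Z e * fprod V s.
Proof.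
rewrite /fprod; elim: s x e => [|[y e'] s IH] x e x0 ns /=.
  case: (Z.eqb_spec 0 e) => [<-|_]; first by rewrite !big_nil expr0z mulr1.
  by rewrite big_cons.
have y0 : V y != 0 := ns (y, e') (mem_head _ _).
have {}ns fe : fe \in s -> V fe.1 != 0 by move=> h; apply: ns; rewrite inE h orbT.
case: feqP => [<-|_].
  by rewrite IH // big_cons /= rmorphD expfzDr // mulrA.
case: (Z.eqb_spec 0 e) => [<-|_]; first by rewrite IH // big_cons expr0z mul1r.
by rewrite big_cons IH // big_cons.
Qed.

Lemma fprod_collect (V : form -> k) s : (forall fe, fe \in s -> V fe.1 != 0) ->
  fprod V (zcollect s) = fprod V s.
Proof.
move=> ns; have pe : perm_eq (sort (@kle Z) s) s by rewrite perm_sort.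
have <- : fprod V (sort (@kle Z) s) = fprod V s by apply: perm_big.
rewrite /zcollect /collect.
have {}ns fe : fe \in sort (@kle Z) s -> V fe.1 != 0 by rewrite mem_sort; apply: ns.
case: (sort _ _) ns => [|[x e] s'] ns //.
rewrite fprod_comb ?[RHS]/fprod ?big_cons //; first exact: (ns (x, e) (mem_head _ _)).
by move=> fe h; apply: ns; rewrite inE h orbT.
Qed.

Lemma lv_collect z s : nonvan z s -> lv z (zcollect s) = lv z s.
Proof. exact: fprod_collect. Qed.

Lemma mem_comb (C : eqType) add isz x (e : C) (r : seq (form * C)) fe :
  fe \in comb add isz x e r -> fe.1 \in x :: unzip1 r.
Proof.
elim: r x e => [|[y e'] s IH] x e /=.
  by case: (isz e); rewrite ?inE // => /eqP ->.
case: feqP => [<-|_].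
  by move/IH; rewrite !inE => /orP[/eqP->|->]; rewrite ?eqxx ?orbT.
case: (isz e); first by move/IH=> h; rewrite inE h orbT.
by rewrite inE => /orP[/eqP->|/IH h]; rewrite inE ?eqxx // h orbT.
Qed.

Lemma mem_collect (C : eqType) add isz (s : seq (form * C)) fe :
  fe \in collect add isz s -> fe.1 \in unzip1 s.
Proof.
rewrite /collect.
have eq_s : unzip1 (sort (@kle C) s) =i unzip1 s.
  by apply: perm_mem; apply: perm_map; rewrite perm_sort.
rewrite -eq_s; case: (sort _ _) => [|[x e] s'] //.
exact: mem_comb.
Qed.

Lemma collect_nonvan z s : nonvan z s -> nonvan z (zcollect s).
Proof.
move=> ns fe /mem_collect /mapP[fe' /ns h ->]; exact: h.
Qed.

Lemma lv_expo z l s : fv z l != 0 ->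
  lv z s = fv z l ^ int_of_Z (expo l s) * lv z [seq fe <- s | ~~ feq l fe.1].
Proof.
move=> l0; elim: s => [|[f e] s IH] /=; first by rewrite expr0z lv_nil mulr1.
rewrite lv_cons IH /=; case: feqP => [<-|_] /=.
  by rewrite rmorphD expfzDr // mulrA.
by rewrite lv_cons mulrCA.
Qed.

Lemma totexp_scale z c s : c != 0 ->
  lv (c * z.1.1.1, c * z.1.1.2, c * z.1.2, c * z.2) s =
  c ^ int_of_Z (totexp s) * lv z s.
Proof.
move=> c0; elim: s => [|[f e] s IH] /=; first by rewrite !lv_nil expr0z mulr1.
rewrite !lv_cons IH rmorphD expfzDr //.
have -> : fv (c * z.1.1.1, c * z.1.1.2, c * z.1.2, c * z.2) f = c * fv z f.
  by case: z f {IH} => [[[zd za] zb] zc] [[[d a] b] c'] /=; ring.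
by rewrite expfzMl /=; ring.
Qed.

Section Char0.
Hypothesis ch0 : char0 k.

Lemma zi_neq0 x : (zi x != 0 :> k) = ~~ (x =? 0)%BZ.
Proof.
case: Z.eqb_spec => [->|h]; first by rewrite zi0 eqxx.
by apply/negP => /eqP /ch0.
Qed.

Lemma qden_neq0 p : zi (Zpos p) != 0 :> k.
Proof. by rewrite zi_neq0. Qed.

Lemma qv_eq (x y : Q) : Qeq x y -> qv k x = qv k y.
Proof.
rewrite /Qeq => e; rewrite !qv.unlock.
by apply/eqP; rewrite eqr_div ?qden_neq0 // -!ziM e.
Qed.

Lemma qvM x y : qv k (qmul x y) = qv k x * qv k y.
Proof.
rewrite (qv_eq (Qred_correct _)) !qv.unlock /= Pos2Z.inj_mul !ziM.
by rewrite invfM; ring.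
Qed.

Lemma qvD x y : qv k (qadd x y) = qv k x + qv k y.
Proof.
rewrite (qv_eq (Qred_correct _)) !qv.unlock /= Pos2Z.inj_mul ziD !ziM.
by rewrite addf_div ?qden_neq0.
Qed.

Lemma qv0 x : qisz x -> qv k x = 0.
Proof. by rewrite /qisz !qv.unlock => /Z.eqb_eq <-; rewrite zi0 mul0r. Qed.

Lemma qvz x : qv k (inject_Z x) = zi x.
Proof. by rewrite !qv.unlock /= zi1 divr1. Qed.

Lemma qvV x : qv k (Qinv x) = (qv k x)^-1.
Proof.
case: x => [[|n|n] d]; rewrite !qv.unlock /Qinv /=.
- by rewrite zi0 !mul0r invr0.
- by rewrite invf_div.
- by rewrite -!Pos2Z.opp_pos !ziN mulNr -mulrN -invrN invf_div.
Qed.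

Lemma qvpow x e : qv k (qpow x e) = zi x ^ int_of_Z e.
Proof.
have pos p : qv k (Qpower_positive (inject_Z x) p) = zi x ^+ Pos.to_nat p.
  elim/Pos.peano_ind: p => [|p IH]; first by rewrite /= qvz.
  rewrite (@qv_eq _ (Qmult (inject_Z x) (Qpower_positive (inject_Z x) p))).
    by rewrite -(qv_eq (Qred_correct _)) -/(qmul _ _) qvM IH qvz Pos2Nat.inj_succ exprS.
  by rewrite -Pos.add_1_l Qpower_plus_positive.
case: e => [|p|p] /=; first by rewrite expr0z !qv.unlock /= zi1 divr1.
  by rewrite pos.
by rewrite qvV pos /exprz prednK //; apply/ltP; exact: Pos2Nat.is_pos.
Qed.

Lemma tnorm_v z t : tv z (tnorm t) = tv z t.
Proof.
case: t => c s; rewrite /tv /tnorm /=.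
elim: s => [|[f e] s IH] //=.
rewrite lv_cons [in RHS]/=; case E: (fnorm f) => [x h] /=.
rewrite lv_cons /= qvM qvpow.
have -> : fv z f = zi x * fv z h by rewrite (fv_norm z f) E.
by rewrite expfzMl mulrACA IH; ring.
Qed.

End Char0.

End Values.

(** E need not be the fraction field of A as constructed: reduction modulo 127 uses Z[lambda] inside
    K, because Q[lambda] has no morphism to F_127. *)
Record embedding (A E : pzRingType) := Embedding {
  emb :> {rmorphism A -> E};
  emb_inj : injective emb }.

(** * Specialization of rational functions *)

Section Specialization.
Variables (A : idomainType) (E B : fieldType).
Variables (io : embedding A E) (phi : {rmorphism A -> B}).
Let io_inj := @emb_inj _ _ io.

(* [f] is a quotient of elements of A whose denominator survives in B, and [v] is its image. *)
Definition spec (f : E) (v : B) : Prop :=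
  exists p q, [/\ phi q != 0, f = io p / io q & v = phi p / phi q].

Lemma io_neq0 q : phi q != 0 -> io q != 0.
Proof.
by apply: contra; rewrite -(rmorph0 io) => /eqP /io_inj ->; rewrite rmorph0.
Qed.

(** This is how identities are transported: if f = 0 in E, then every specialization of f is 0. *)
Lemma spec_uniq f v w : spec f v -> spec f w -> v = w.
Proof.
move=> [p [q [q0 -> ->]]] [p' [q' [q0' e ->]]].
have /io_inj h : io (p * q') = io (p' * q).
  move/eqP: e; rewrite eqr_div ?io_neq0 // => /eqP e.
  by rewrite !rmorphM e.
by apply/eqP; rewrite eqr_div // -!rmorphM h.
Qed.

Lemma spec_io p : spec (io p) (phi p).
Proof. by exists p, 1; rewrite !rmorph1 !divr1 oner_neq0. Qed.

Lemma spec0 : spec 0 0. Proof. by have := spec_io 0; rewrite !rmorph0. Qed.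
Lemma spec1 : spec 1 1. Proof. by have := spec_io 1; rewrite !rmorph1. Qed.

Lemma specD f g v w : spec f v -> spec g w -> spec (f + g) (v + w).
Proof.
move=> [p [q [q0 -> ->]]] [p' [q' [q0' -> ->]]].
exists (p * q' + p' * q), (q * q'); rewrite !rmorphD !rmorphM.
by rewrite mulf_neq0 // !addf_div // io_neq0.
Qed.

Lemma specM f g v w : spec f v -> spec g w -> spec (f * g) (v * w).
Proof.
move=> [p [q [q0 -> ->]]] [p' [q' [q0' -> ->]]].
by exists (p * p'), (q * q'); rewrite !rmorphM mulf_neq0 // !mulf_div.
Qed.

Lemma specN f v : spec f v -> spec (- f) (- v).
Proof.
by move=> [p [q [q0 -> ->]]]; exists (- p), q; rewrite !rmorphN !mulNr.
Qed.

Lemma specV f v : spec f v -> v != 0 -> spec f^-1 v^-1.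
Proof.
move=> [p [q [q0 -> ->]]]; rewrite mulf_eq0 negb_or => /andP [p0 _].
by exists q, p; rewrite !invf_div.
Qed.

Lemma specX f v n : spec f v -> spec (f ^+ n) (v ^+ n).
Proof.
move=> h; elim: n => [|n IH]; first exact: spec1.
by rewrite !exprS; apply: specM.
Qed.

Lemma specXz f v (n : int) : spec f v -> v != 0 \/ 0 <= n -> spec (f ^ n) (v ^ n).
Proof.
move=> h; case: n => n; first by move=> _; apply: specX.
by case=> // v0; rewrite !NegzE -!exprnN; apply: specV; [apply: specX|rewrite expf_neq0].
Qed.

Lemma spec_sum (I : eqType) (r : seq I) (F : I -> E) (G : I -> B) :
  (forall i, i \in r -> spec (F i) (G i)) ->
  spec (\sum_(i <- r) F i) (\sum_(i <- r) G i).
Proof.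
elim: r => [|i r IH] h; rewrite ?big_nil ?big_cons; first exact: spec0.
apply: specD; first by apply: h; rewrite inE eqxx.
by apply: IH => j hj; apply: h; rewrite inE hj orbT.
Qed.

Lemma spec_prod (I : eqType) (r : seq I) (F : I -> E) (G : I -> B) :
  (forall i, i \in r -> spec (F i) (G i)) ->
  spec (\prod_(i <- r) F i) (\prod_(i <- r) G i).
Proof.
elim: r => [|i r IH] h; rewrite ?big_nil ?big_cons; first exact: spec1.
apply: specM; first by apply: h; rewrite inE eqxx.
by apply: IH => j hj; apply: h; rewrite inE hj orbT.
Qed.

Lemma spec_zi x : spec (zi x) (zi x).
Proof. by have := spec_io (zi x); rewrite !zi_rmorph. Qed.

Lemma spec_qv q : zi (Zpos (Qden q)) != 0 :> B -> spec (qv E q) (qv B q).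
Proof. by move=> h; rewrite !qv.unlock; apply: specM (spec_zi _) (specV (spec_zi _) h). Qed.

Definition spec_pt (z : pt E) (w : pt B) :=
  [/\ spec z.1.1.1 w.1.1.1, spec z.1.1.2 w.1.1.2, spec z.1.2 w.1.2 & spec z.2 w.2].

Lemma spec_fv z w f : spec_pt z w -> spec (fv z f) (fv w f).
Proof.
case: z w f => [[[zd za] zb] zc] [[[wd wa] wb] wc] [[[d a] b] c] [/= hd ha hb hc].
by do !apply: specD; apply: specM => //; apply: spec_zi.
Qed.

Lemma spec_lv z w (s : seq (form * Z)) : spec_pt z w ->
  (forall fe, fe \in s -> (fe.2 <? 0)%BZ -> fv w fe.1 != 0) ->
  spec (lv z s) (lv w s).
Proof.
move=> h hs; apply: spec_prod => fe hfe; apply: specXz (spec_fv _ h) _.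
case E1: (fe.2 <? 0)%BZ; [left|right]; first exact: hs.
by case: fe.2 E1.
Qed.

Lemma spec_tv z w (t : term) : spec_pt z w -> zi (Zpos (Qden t.1)) != 0 :> B ->
  (forall fe, fe \in t.2 -> (fe.2 <? 0)%BZ -> fv w fe.1 != 0) ->
  spec (tv z t) (tv w t).
Proof. by move=> h ht hs; apply: specM (spec_qv ht) (spec_lv h hs). Qed.

End Specialization.

(** * Rational functions on a line: regularity and the factor theorem *)

Section Line.
Variable k : fieldType.
Implicit Types (x : k) (f : {fraction {poly k}}).

Lemma tofrac_inj (R : idomainType) : injective (@tofrac R).
Proof. by move=> p q /eqP; rewrite tofrac_eq => /eqP. Qed.

Definition poly_frac : embedding {poly k} {fraction {poly k}} :=
  Embedding (emb := @tofrac {poly k}) (@tofrac_inj _).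
Definition hev x : {rmorphism {poly k} -> k} := horner_eval x.
Definition regular x f := exists v, spec poly_frac (hev x) f v.

Lemma regularD x f g : regular x f -> regular x g -> regular x (f + g).
Proof. by move=> [v hv] [w hw]; exists (v + w); apply: specD. Qed.
Lemma regularM x f g : regular x f -> regular x g -> regular x (f * g).
Proof. by move=> [v hv] [w hw]; exists (v * w); apply: specM. Qed.
Lemma regular_tofrac x p : regular x (tofrac p).
Proof. by exists p.[x]; apply: (spec_io poly_frac). Qed.
Lemma regular_zi x n : regular x (zi n).
Proof. by eexists; apply: spec_zi. Qed.

(** If (X - x) h = p with h regular at x, then clearing the denominator of h, which is nonzero at x,
    shows p(x) = 0, so a factor can be cancelled. Repetitions in [rs] account for multiple poles. *)
Lemma regular_poly (g : {fraction {poly k}}) (rs : seq k) (p : {poly k}) :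
  (forall x, x \in rs -> regular x g) ->
  g * tofrac (\prod_(x <- rs) ('X - x%:P)) = tofrac p ->
  exists q : {poly k}, g = tofrac q /\ (size q <= size p - size rs)%N.
Proof.
elim: rs p => [|x rs IH] p hreg.
  by rewrite big_nil tofrac1 mulr1 => ->; exists p; rewrite subn0.
rewrite big_cons mulrC tofracM -mulrA [tofrac _ * g]mulrC => e.
set h := g * _ in e.
have [v [a [b [b0 ha _]]]] : regular x h.
  by apply: regularM; [apply: hreg; rewrite inE eqxx|apply: regular_tofrac].
have b0' : tofrac b != 0 by apply: (io_neq0 poly_frac b0).
have /tofrac_inj e' : tofrac (('X - x%:P) * a) = tofrac (p * b).
  by rewrite !tofracM -e ha -mulrA divfK.
have root_p : root p x.
  have := congr1 (horner^~ x) e'; rewrite /= !hornerM hornerXsubC subrr mul0r.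
  by move/esym/eqP; rewrite mulf_eq0 (negPf b0) orbF.
case/factor_theorem: root_p => p' ep'.
have X0 : tofrac ('X - x%:P) != 0 by rewrite tofrac_eq0 polyXsubC_eq0.
have e2 : h = tofrac p'.
  by apply: (mulfI X0); rewrite e ep' tofracM mulrC.
have [q [eq sq]] := IH p' (fun y hy => hreg y (mem_behead (s := x :: rs) hy)) e2.
exists q; split=> //; apply: leq_trans sq _ => /=.
case: (eqVneq p' 0) => [->|p0]; first by rewrite size_poly0.
by rewrite ep' size_Mmonic ?monicXsubC // size_XsubC addn2 /= subSS.
Qed.

End Line.

(** * Cancellation of the poles *)

Section PoleCheck.
Local Open Scope Z_scope.

Definition pivot (l : form) : Z * nat :=
  let: (_, a, b, c) := l in
  match a with 0 => match b with 0 => (c, 2%N) | _ => (b, 1%N) end | _ => (a, 0%N) end.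
Definition coord (f : form) (i : nat) : Z :=
  let: (_, a, b, c) := f in match i with 0%N => a | 1%N => b | _ => c end.

(* [(h, e, s, x)]: the factor f^e, where p f = s h + x l with h free of the pivot variable of l,
   whose coefficient in l is p. *)
Definition rfactor : Type := (form * Z * Z * Z)%type.
Definition restrict_factor (l : form) (p : Z) (i : nat) (fe : form * Z) : rfactor :=
  let x := coord fe.1 i in
  let: (s, h) := fnorm (fsub (fscale p fe.1) (fscale x l)) in (h, fe.2, s, x).

(* The data of a term with a pole of order m along l: m, the restriction to l = 0 as a monomial with
   its coefficient, and the factors. *)
Definition pdata : Type := (Z * seq (form * Z) * Q * seq rfactor)%type.
Definition mkpdata (l : form) (t : term) : pdata :=
  let: (p, i) := pivot l in
  let r := [seq restrict_factor l p i fe | fe <- t.2 & ~~ feq l fe.1] in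
  (- expo l t.2, zcollect [seq (y.1.1.1, y.1.1.2) | y <- r],
   qmul (foldr (fun y q => qmul (qpow y.1.2 y.1.1.2) q) t.1 r)
        (qpow p (- foldr (fun y n => y.1.1.2 + n) 0 r)), r).

(** From p f = s h + x l one gets f = (s / p) h (1 + (x / s) l / h). The logarithm of the last
    factor to the power e is e (x / s) l / h - e (x / s)^2 l^2 / (2 h^2) + ...; [plin] and [psq]
    record its coefficients, along 1 / h for the first order and along 1 / h^2 for twice the
    second. *)
Definition slope (y : rfactor) : Q := qmul (inject_Z y.2) (Qinv (inject_Z y.1.2)).
Definition plin (r : seq rfactor) : seq (form * Q) :=
  qcollect [seq (y.1.1.1, qmul (inject_Z y.1.1.2) (slope y)) | y <- r].
Definition psq (r : seq rfactor) : seq (form * Q) :=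
  qcollect [seq (y.1.1.1, qmul (inject_Z (- y.1.1.2)) (qmul (slope y) (slope y))) | y <- r].

Definition qscale (c : Q) (s : seq (form * Q)) := [seq (x.1, qmul c x.2) | x <- s].
Definition qsub (s t : seq (form * Q)) := qcollect (s ++ qscale (Qmake (-1) 1) t).

Definition qform : Type := seq (form * form * Q).
Fixpoint qins (x : form * form * Q) (s : qform) : qform :=
  match s with
  | [::] => [:: x]
  | y :: s' =>
      if feq x.1.1 y.1.1 && feq x.1.2 y.1.2 then (x.1, qadd x.2 y.2) :: s' else y :: qins x s'
  end.
Definition qsquare (s : seq (form * Q)) : qform :=
  [seq (x.1, y.1, qmul x.2 y.2) | x <- s, y <- s].
Definition qdiag (s : seq (form * Q)) : qform := [seq (x.1, x.1, x.2) | x <- s].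
Definition qfscale (c : Q) (s : qform) : qform := [seq (x.1, qmul c x.2) | x <- s].

(** The terms of a group have the same pole order m and, up to constants c, the same restriction to
    l = 0. With relative factors exp (p eps + s eps^2 / 2), the sums to cancel are those of c, c p
    and c (p^2 + s), as many as m. Once the earlier sums vanish, p and s may be diminished by the
    values p0 and s0 of the first term, which removes what the terms have in common. The 1 / h are
    treated as independent unknowns, a sufficient condition; pole orders above 3 are rejected. *)
Definition group_check (g : seq pdata) : bool :=
  match g with
  | [::] => true
  | (m, key, _, r0) :: _ =>
    all (fun y => (m =? y.1.1.1) && keyeq key y.1.1.2) g &&
    qisz (foldr (fun y q => qadd y.1.2 q) (inject_Z 0) g) &&
    match m with
    | 1 => true
    | _ =>
      let p0 := plin r0 in let s0 := psq r0 in
      let ds := [seq (y.1.2, qsub (plin y.2) p0, qsub (psq y.2) s0) | y <- g] in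
      nilp (qcollect (flatten [seq qscale y.1.1 y.1.2 | y <- ds])) &&
      match m with
      | 2 => true
      | 3 => all (fun x => qisz x.2) (foldr (fun y acc =>
               foldr qins acc (qfscale y.1.1 (qsquare y.1.2 ++ qdiag y.2))) [::] ds)
      | _ => false
      end
    end
  end.

Fixpoint insert_group (x : pdata) (gs : seq (seq pdata)) : seq (seq pdata) :=
  match gs with
  | [::] => [:: [:: x]]
  | g :: gs' =>
    match g with
    | [::] => [:: x] :: gs'
    | y :: _ => if (x.1.1.1 =? y.1.1.1) && keyeq x.1.1.2 y.1.1.2 then (x :: g) :: gs'
                else g :: insert_group x gs'
    end
  end.

Definition pole_check (ts : seq term) (l : form) : bool :=
  ~~ ((pivot l).1 =? 0) &&
  all group_check
    (foldr insert_group [::] [seq mkpdata l t | t <- ts & expo l t.2 <? 0]).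

End PoleCheck.

Section LinePoint.
Variable k : fieldType.
Hypothesis ch0 : char0 k.
Local Notation E := {fraction {poly k}}.
Local Notation lspec x := (spec (poly_frac k) (hev x)).
Implicit Types (z v : pt k) (x : k).

Definition line_coord (a b : k) : E := tofrac (a%:P + b *: 'X).
Definition line_pt z v : pt E :=
  (line_coord z.1.1.1 v.1.1.1, line_coord z.1.1.2 v.1.1.2,
   line_coord z.1.2 v.1.2, line_coord z.2 v.2).
Definition shift_pt z v x : pt k :=
  (z.1.1.1 + x * v.1.1.1, z.1.1.2 + x * v.1.1.2, z.1.2 + x * v.1.2, z.2 + x * v.2).

Lemma fv_line z v f : fv (line_pt z v) f = line_coord (fv z f) (fv v f).
Proof.
case: z v f => [[[zd za] zb] zc] [[[vd va] vb] vc] [[[d a] b] c] /=.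
rewrite /line_coord -!(zi_rmorph (@tofrac {poly k})) -!tofracM -!tofracD.
congr tofrac; rewrite -!(zi_rmorph (@polyC k)) !polyCD !polyCM !scalerDl -!mul_polyC !polyCM.
by ring.
Qed.

Lemma fv_shift z v x f : fv (shift_pt z v x) f = fv z f + x * fv v f.
Proof.
case: z v f => [[[zd za] zb] zc] [[[vd va] vb] vc] [[[d a] b] c] /=; ring.
Qed.

Lemma spec_line z v x : spec_pt (poly_frac k) (hev x) (line_pt z v) (shift_pt z v x).
Proof.
have h a b : lspec x (line_coord a b) (a + x * b).
  have := spec_io (poly_frac k) (hev x) (a%:P + b *: 'X).
  by rewrite /hev /= /horner_eval !hornerE [b * x]mulrC.
by split; apply: h.
Qed.

Lemma line_uniq x (f : E) (a b : k) :
  lspec x f a -> lspec x f b -> a = b.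
Proof. exact: spec_uniq. Qed.

Lemma line_neq0 z v x f : fv (shift_pt z v x) f != 0 -> fv (line_pt z v) f != 0.
Proof.
apply: contra => /eqP e; apply/eqP.
apply: (line_uniq (spec_fv f (spec_line z v x))).
by rewrite e; apply: spec0.
Qed.

Lemma charE : char0 E.
Proof.
move=> n; rewrite -(zi_rmorph (@tofrac {poly k})) => /eqP; rewrite tofrac_eq0.
by rewrite -(zi_rmorph (@polyC k)) polyC_eq0 => /eqP /ch0.
Qed.

End LinePoint.

Section QuadraticForms.
Variable E : fieldType.
Hypothesis ch0 : char0 E.

Definition qlin (Y : form -> E) (s : seq (form * Q)) : E :=
  \sum_(x <- s) qv E x.2 * Y x.1.
Definition qquad (Y : form -> E) (s : qform) : E :=
  \sum_(x <- s) qv E x.2 * (Y x.1.1 * Y x.1.2).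

Lemma qlin_nil Y : qlin Y [::] = 0. Proof. exact: big_nil. Qed.
Lemma qlin_cons Y x s : qlin Y (x :: s) = qv E x.2 * Y x.1 + qlin Y s.
Proof. exact: big_cons. Qed.
Lemma qlin_cat Y s t : qlin Y (s ++ t) = qlin Y s + qlin Y t.
Proof. exact: big_cat. Qed.
Lemma qlin_scale Y c s : qlin Y (qscale c s) = qv E c * qlin Y s.
Proof.
rewrite /qlin big_map big_distrr; apply: eq_bigr => x _ /=.
by rewrite qvM // mulrA.
Qed.
Lemma qlin_flatten Y (I : Type) (r : seq I) (F : I -> seq (form * Q)) :
  qlin Y (flatten [seq F i | i <- r]) = \sum_(i <- r) qlin Y (F i).
Proof.
elim: r => [|i r IH] /=; first by rewrite qlin_nil big_nil.
by rewrite qlin_cat big_cons IH.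
Qed.

Lemma qlin_comb Y x e r :
  qlin Y (comb qadd qisz x e r) = qv E e * Y x + qlin Y r.
Proof.
elim: r x e => [|[y e'] r IH] x e /=.
  case Ez: (qisz e); first by rewrite qlin_nil (qv0 _ Ez) mul0r add0r.
  by rewrite qlin_cons.
rewrite qlin_cons; case: feqP => [<-|_].
  by rewrite IH qvD // mulrDl addrA.
case Ez: (qisz e); first by rewrite IH (qv0 _ Ez) mul0r add0r.
by rewrite qlin_cons IH.
Qed.

Lemma qlin_collect Y s : qlin Y (qcollect s) = qlin Y s.
Proof.
have <- : qlin Y (sort (@kle Q) s) = qlin Y s.
  by apply: perm_big; rewrite perm_sort.
rewrite /qcollect /collect; case: (sort _ _) => [|[x e] r] //.
by rewrite qlin_comb qlin_cons.
Qed.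

Lemma qlin_sub Y s t : qlin Y (qsub s t) = qlin Y s - qlin Y t.
Proof.
rewrite /qsub qlin_collect qlin_cat qlin_scale.
have -> : qv E (Qmake (-1) 1) = -1 by rewrite qv.unlock /= divr1.
by rewrite mulN1r.
Qed.

Lemma qquad_cons Y x s :
  qquad Y (x :: s) = qv E x.2 * (Y x.1.1 * Y x.1.2) + qquad Y s.
Proof. exact: big_cons. Qed.

Lemma qquad_ins Y x s : qquad Y (qins x s) = qv E x.2 * (Y x.1.1 * Y x.1.2) + qquad Y s.
Proof.
elim: s => [|y s IH] /=; first by rewrite qquad_cons.
case: andP => [[/feqP e1 /feqP e2]|_]; rewrite !qquad_cons /=.
  by rewrite qvD // e1 e2 mulrDl addrA.
by rewrite IH addrCA.
Qed.

Lemma qquad_foldr_ins Y r s : qquad Y (foldr qins s r) = qquad Y r + qquad Y s.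
Proof.
elim: r => [|x r IH] /=; first by rewrite {2}/qquad big_nil add0r.
by rewrite qquad_ins IH qquad_cons addrA.
Qed.

Lemma qquad_scale Y c s : qquad Y (qfscale c s) = qv E c * qquad Y s.
Proof.
rewrite /qquad big_map big_distrr; apply: eq_bigr => x _ /=.
by rewrite qvM // -mulrA.
Qed.

Lemma qquad_square Y s : qquad Y (qsquare s) = qlin Y s * qlin Y s.
Proof.
rewrite /qquad /qsquare big_allpairs_dep /= {1}/qlin big_distrl.
apply: eq_bigr => x _ /=; rewrite big_distrr; apply: eq_bigr => y _ /=.
by rewrite qvM //; ring.
Qed.

Lemma qquad_diag Y s : qquad Y (qdiag s) = qlin (fun h => Y h * Y h) s.
Proof. by rewrite /qquad /qdiag big_map. Qed.

Lemma qquad_zero Y s : all (fun x => qisz x.2) s -> qquad Y s = 0.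
Proof.
move/allP => h; rewrite /qquad big_seq big1 // => x /h hx.
by rewrite (qv0 _ hx) mul0r.
Qed.

End QuadraticForms.

Lemma keyeqP s t : reflect (s = t) (keyeq s t).
Proof.
elim: s t => [|[f e] s IH] [|[g e'] t] /=; try by constructor.
apply: (iffP and3P) => [[/feqP -> /Z.eqb_spec -> h]|[<- <- <-]].
  by congr (_ :: _); apply/IH.
by split; [exact/feqP|rewrite Z.eqb_refl|apply/IH].
Qed.

(* [reg] stands for the functions without pole at a point where the form [l] vanishes; [P] is a
   point with coordinates in the function field and [Px] its specialization. *)
Section PoleCheckCorrect.
Variables (k E : fieldType) (ch0 : char0 k) (chE : char0 E).
Variables (reg : E -> Prop) (P : pt E) (Px : pt k) (l : form).
Local Notation eps := (fv P l).
Hypothesis lx : fv Px l = 0.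
Hypothesis l0 : eps != 0.
Hypothesis regD : forall a b, reg a -> reg b -> reg (a + b).
Hypothesis regM : forall a b, reg a -> reg b -> reg (a * b).
Hypothesis reg_qv : forall q, reg (qv E q).
Hypothesis reg_fv : forall f, reg (fv P f).
Hypothesis reg_fvV : forall f, fv Px f != 0 -> reg (fv P f)^-1.
Hypothesis fv_neq0 : forall f, fv Px f != 0 -> fv P f != 0.
Hypothesis reg_unit : forall a, reg a -> 1 + eps * a != 0 /\ reg (1 + eps * a)^-1.
Local Notation half := (qv E (Qmake 1 2)).
Let Y (h : form) : E := (fv P h)^-1.

Lemma qv1 : qv E (Qmake 1 1) = 1.
Proof. by rewrite qv.unlock /= divr1. Qed.

Lemma half2 : half + half = 1.
Proof. by rewrite -(qvD chE) -qv1. Qed.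

Lemma regN a : reg a -> reg (- a).
Proof.
move=> ra; have -> : - a = qv E (Qmake (-1) 1) * a.
  by rewrite qv.unlock /= divr1 mulN1r.
exact: regM.
Qed.

Lemma reg0 : reg 0.
Proof. by have := reg_qv (Qmake 0 1); rewrite qv.unlock /= mul0r. Qed.

Lemma reg_sum (I : eqType) (r : seq I) (F : I -> E) :
  (forall i, i \in r -> reg (F i)) -> reg (\sum_(i <- r) F i).
Proof.
by move=> h; rewrite big_seq; apply: (big_ind reg) => //; exact: reg0.
Qed.

(* [u = exp (p eps + s eps^2 / 2)] up to order 3 in [eps]. *)
Definition expand (u p s : E) : Prop :=
  [/\ reg p, reg s & exists2 r, reg r &
    u = 1 + p * eps + (p * p + s) * half * (eps * eps) + eps * eps * eps * r].

Ltac reg := repeat first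
  [ assumption | apply: regD | apply: regM | apply: regN | apply: reg_fv | apply: reg_qv ].

(** p and s / 2 are the coefficients of log u, hence additive. *)
Lemma expand_mul u p s u' p' s' :
  expand u p s -> expand u' p' s' -> expand (u * u') (p + p') (s + s').
Proof.
move=> [rp rs [r rr ->]] [rp' rs' [r' rr' ->]]; split; [by reg..|].
move: reg_fv l0 => /(_ l); move: eps => e re e0.
have h2 := half2; have rh := reg_qv (Qmake 1 2); move: half rh h2 => h rh h2.
exists (r + r' + p * ((p' * p' + s') * h) + p' * ((p * p + s) * h)
  + e * ((p * p + s) * h * ((p' * p' + s') * h) + p * r' + p' * r)
  + e * e * ((p * p + s) * h * r' + (p' * p' + s') * h * r) + e * e * e * (r * r')).
  by reg.
have -> : ((p + p') * (p + p') + (s + s')) * h =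
   (p * p + s) * h + (p' * p' + s') * h + (h + h) * (p * p') by ring.
by rewrite h2; ring.
Qed.

Lemma expand1 : expand 1 0 0.
Proof.
by split; [exact: reg0..|exists 0; [exact: reg0|ring]].
Qed.

Lemma expand_inv u p s : expand u p s -> expand u^-1 (- p) (- s).
Proof.
move=> [rp rs [r rr eu]]; split; [by reg..|].
have [u0 ru] : u != 0 /\ reg u^-1.
  have -> : u = 1 + eps * (p + (p * p + s) * half * eps + eps * eps * r) by rewrite eu; ring.
  by apply: reg_unit; reg.
move: reg_fv l0 eu => /(_ l); move: eps => e re e0.
have h2 := half2; have rh := reg_qv (Qmake 1 2); move: half rh h2 => h rh h2 eu.
pose a := (p * p + s) * h; pose b := (p * p - s) * h.
(* Multiplying 1 + p e + a e^2 + r e^3 by 1 - p e + b e^2 gives 1 + (a + b - p^2) e^2 + e^3 r', and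
   a + b = p^2. *)
pose r' := p * b - a * p + r + e * (a * b - p * r) + e * e * (b * r).
exists (- (u^-1 * r')); first by rewrite /r' /a /b; reg.
apply: (mulfI u0); rewrite divff //.
have -> : (- p * - p + - s) * h = b by rewrite /b; ring.
have -> : u * (1 + - p * e + b * (e * e) + e * e * e * - (u^-1 * r')) =
   u * (1 - p * e + b * (e * e)) - e * e * e * r' * (u * u^-1) by ring.
have pp : a + b - p * p = 0 by rewrite -[p * p]mul1r -h2 /a /b; ring.
rewrite divff // mulr1 eu -/a -[LHS]addr0 -(mul0r (e * e)) -pp /r'.
by ring.
Qed.

Lemma expand_pow u p s (n : int) :
  expand u p s -> expand (u ^ n) (n%:~R * p) (n%:~R * s).
Proof.
move=> h; have hX m : expand (u ^+ m) (m%:R * p) (m%:R * s).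
  elim: m => [|m IH]; first by rewrite !mul0r; apply: expand1.
  by rewrite exprS -[m.+1]add1n natrD !mulrDl !mul1r; apply: expand_mul.
case: n => m; first exact: hX.
rewrite NegzE -exprnN !mulrNz !mulNr; exact: expand_inv.
Qed.

(** Here s = - p^2, so the second order term is 0 and there is no remainder. *)
Lemma expand_factor f b : fv Px f != 0 ->
  expand (1 + qv E b * eps * Y f) (qv E b * Y f) (- (qv E b * Y f * (qv E b * Y f))).
Proof.
move=> f0; have r1 : reg (qv E b * Y f) by apply: regM => //; apply: reg_fvV.
split=> //; first by apply: regN; apply: regM.
by exists 0; [exact: reg0|ring].
Qed.

Definition rval (w : rfactor) : E := (1 + qv E (slope w) * eps * Y w.1.1.1) ^ int_of_Z w.1.1.2.

Definition rok (r : seq rfactor) := forall w, w \in r -> fv Px w.1.1.1 != 0.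

Lemma expand_rval r : rok r ->
  expand (\prod_(w <- r) rval w) (qlin Y (plin r)) (qlin (fun h => Y h * Y h) (psq r)).
Proof.
move=> rk; rewrite !(qlin_collect chE) /qlin !big_map.
elim: r rk => [|w r IH] rk; first by rewrite !big_nil; apply: expand1.
rewrite !big_cons; apply: expand_mul; last first.
  by apply: IH => w' h; apply: rk; rewrite inE h orbT.
have := expand_pow (int_of_Z w.1.1.2) (expand_factor (slope w) (rk w (mem_head _ _))).
rewrite -/(rval w) -/(zi _) /=; move: (rval w) (slope w) => u b.
rewrite !(qvM chE) !qvz ziN; set y := Y _; rewrite mulrA.
congr (expand _ _ _); ring.
Qed.

Definition pval (d : pdata) : E :=
  eps ^ (- int_of_Z d.1.1.1) * lv P d.1.1.2 * qv E d.1.2 * \prod_(w <- d.2) rval w.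

Definition pok (d : pdata) := nonvan Px d.1.1.2 /\ rok d.2.

Lemma restrict_factorP p i fe (w := restrict_factor l p i fe) :
  zi p != 0 :> k -> fv Px fe.1 != 0 ->
  [/\ fv Px w.1.1.1 != 0, w.1.1.2 = fe.2 &
    fv P fe.1 ^ int_of_Z fe.2 = zi w.1.2 ^ int_of_Z fe.2 * zi p ^ (- int_of_Z fe.2) *
      fv P w.1.1.1 ^ int_of_Z fe.2 * rval w].
Proof.
move=> p0 f0; rewrite /w /restrict_factor.
set y := coord fe.1 i; case e: (fnorm _) => [s h] /=.
have eg (K : fieldType) (q : pt K) : zi p * fv q fe.1 - zi y * fv q l = zi s * fv q h.
  have -> : zi p * fv q fe.1 - zi y * fv q l = fv q (fsub (fscale p fe.1) (fscale y l)).
    by rewrite fv_sub !fv_scale.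
  by rewrite fv_norm e.
have ex := eg _ Px; rewrite lx mulr0 subr0 in ex.
have h0 : zi s * fv Px h != 0 by rewrite -ex mulf_neq0.
have [s0 hx0] : zi s != 0 :> k /\ fv Px h != 0.
  by apply/andP; rewrite -negb_or -mulf_eq0.
have hP0 : fv P h != 0 by exact: fv_neq0.
have sE0 : zi s != 0 :> E by rewrite (zi_neq0 chE) -(zi_neq0 ch0).
have pE0 : zi p != 0 :> E by rewrite (zi_neq0 chE) -(zi_neq0 ch0).
split=> //; rewrite /rval /= -exprz_inv -!expfzMl; congr (_ ^ _).
rewrite /slope /= (qvM chE) qvV !qvz /Y.
apply: (mulfI pE0); have /eqP := eg _ P; rewrite subr_eq => /eqP ->.
by field; rewrite pE0 sE0 hP0.
Qed.

Lemma mkpdataP t : ~~ ((pivot l).1 =? 0)%BZ ->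
  (forall fe, fe \in t.2 -> fe.1 != l -> fv Px fe.1 != 0) ->
  pok (mkpdata l t) /\ tv P t = pval (mkpdata l t).
Proof.
case: t => c s /=; case ep: (pivot l) => [p i] p0 hs.
have {}p0 : zi p != 0 :> k by rewrite zi_neq0.
have pE0 : zi p != 0 :> E by rewrite (zi_neq0 chE) -(zi_neq0 ch0).
rewrite /mkpdata ep /tv /= (lv_expo _ l0) /pval /=.
set s' := [seq fe <- s | _].
have {}hs fe : fe \in s' -> fv Px fe.1 != 0.
  rewrite mem_filter => /andP [/feqP h fs]; apply: hs => //.
  by apply/eqP => e; apply: h; rewrite e.
set r := [seq restrict_factor l p i fe | fe <- s'].
have rk : rok r.
  by move=> w /mapP [fe /hs f0 ->]; case: (restrict_factorP i p0 f0).
set key0 := [seq (y.1.1.1, y.1.1.2) | y <- r].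
have nk : nonvan Px key0 by move=> fe /mapP [w /rk h ->].
split; first by split=> //; apply: collect_nonvan.
have nkE : nonvan P key0 by move=> fe /nk; apply: fv_neq0.
rewrite (lv_collect nkE) (qvM chE) (qvpow chE) rmorphN opprK.
have -> : qv E (foldr (fun y q => qmul (qpow y.1.2 y.1.1.2) q) c r) =
    (\prod_(y <- r) zi y.1.2 ^ int_of_Z y.1.1.2) * qv E c.
  elim: (r) => [|w r' IH] /=; first by rewrite big_nil mul1r.
  by rewrite big_cons (qvM chE) (qvpow chE) IH mulrA.
have shuffle (a b c' d e f : E) : c' * (e * (a * b * d * f)) = e * d * (a * c' * b) * f.
  by ring.
suff -> : lv P s' = (\prod_(y <- r) zi y.1.2 ^ int_of_Z y.1.1.2) *
    zi p ^ int_of_Z (- foldr (fun y n => (y.1.1.2 + n)%BZ) 0%BZ r) * lv P key0 *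
    \prod_(y <- r) rval y by exact: shuffle.
rewrite /key0 /r; elim: s' hs {rk nk nkE r key0} => [|fe s' IH] hs /=.
  by rewrite !big_nil lv_nil expr0z !mulr1.
have [] := restrict_factorP i p0 (hs fe (mem_head _ _)).
set w := restrict_factor _ _ _ _ => _ ew ef.
rewrite !lv_cons !big_cons ef IH ?ew => [|fe' h]; last by apply: hs; rewrite inE h orbT.
rewrite /= ?ew !rmorphN rmorphD opprD (expfzDr _ _ pE0).
have shuffle8 (a b d e a' b' d' e' : E) :
  a * b * d * e * (a' * b' * d' * e') = a * a' * (b * b') * (d * d') * (e * e') by ring.
exact: shuffle8.
Qed.

(** The sum of the group is the common monomial times eps^(-m) (C0 + C1 eps + C2 eps^2 / 2 + C3
    eps^3). The check gives C0 = 0, then C1 = 0 if m is at least 2 and C2 = 0 if m = 3, which leaves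
    no negative power of eps. *)
Lemma group_check_regular g : group_check g -> (forall d, d \in g -> pok d) ->
  reg (\sum_(d <- g) pval d).
Proof.
case: g => [|[[[m key] c0] r0] g0]; first by rewrite big_nil => _ _; apply: reg0.
rewrite /group_check; set g := _ :: g0.
case/andP => /andP [/allP same /(qv0 E) c_zero] check ok.
have sum_c : \sum_(d <- g) qv E d.1.2 = 0.
  rewrite -[RHS]c_zero; elim: (g) => [|d g' IH] /=.
    by rewrite big_nil qv.unlock /= mul0r.
  by rewrite big_cons (qvD chE) -IH.
have [key_ok _] : pok (m, key, c0, r0) by apply: ok; rewrite inE eqxx.
have reg_key : reg (lv P key).
  rewrite /lv big_seq; apply: (big_ind reg) => // [|fe /key_ok fe0].
    by rewrite -qv1.
  have regX (a : E) n : reg a -> reg (a ^+ n).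
    by move=> ra; elim: n => [|n IH]; [rewrite expr0 -qv1|rewrite exprS; apply: regM].
  case: (int_of_Z fe.2) => n; first exact/regX.
  by rewrite NegzE -exprz_inv; apply/regX/reg_fvV.
pose p (d : pdata) := qlin Y (plin d.2).
pose s (d : pdata) := qlin (fun h => Y h * Y h) (psq d.2).
have [R reg_R eR] : exists2 R : pdata -> E, (forall d, d \in g -> reg (R d)) &
   forall d, d \in g -> \prod_(w <- d.2) rval w =
    1 + p d * eps + (p d * p d + s d) * half * (eps * eps) + eps * eps * eps * R d.
  pose R d := (\prod_(w <- d.2) rval w -
    (1 + p d * eps + (p d * p d + s d) * half * (eps * eps))) / (eps * eps * eps).
  have e0 : eps * eps * eps != 0 by rewrite !mulf_neq0.
  exists R => d /ok [_ /expand_rval [_ _ [r rr eu]]]; rewrite /R eu.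
    by rewrite [_ + _ * r]addrC addrK [_ * r]mulrC mulfK.
  by rewrite -/(p d) -/(s d) [_ * (_ / _)]mulrC divfK // [_ + _ * r]addrC addrK addrC.
have reg_p d : d \in g -> reg (p d) by move=> /ok [_ /expand_rval []].
have reg_s d : d \in g -> reg (s d) by move=> /ok [_ /expand_rval []].
pose C1 := \sum_(d <- g) qv E d.1.2 * p d.
pose C2 := \sum_(d <- g) qv E d.1.2 * (p d * p d + s d).
pose C3 := \sum_(d <- g) qv E d.1.2 * R d.
have reg1 : reg C1 by apply: reg_sum => d hd; apply: regM => //; apply: reg_p.
have reg2 : reg C2.
  by apply: reg_sum => d hd; apply: regM => //; apply: regD; [apply: regM|]; auto.
have reg3 : reg C3 by apply: reg_sum => d hd; apply: regM => //; apply: reg_R.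
have -> : \sum_(d <- g) pval d = lv P key * (eps ^ (- int_of_Z m) *
    (C1 * eps + C2 * half * (eps * eps) + eps * eps * eps * C3)).
  have -> : C1 * eps + C2 * half * (eps * eps) + eps * eps * eps * C3 =
      \sum_(d <- g) qv E d.1.2 * \prod_(w <- d.2) rval w.
    rewrite -[LHS]add0r -[X in X + _ = _]sum_c /C1 /C2 /C3 !big_distrl big_distrr /= -!big_split /=.
    by apply: eq_big_seq => d hd; rewrite eR //; ring.
  rewrite mulrA big_distrr /=; apply: eq_big_seq => d /same /andP [/Z.eqb_spec em /keyeqP ek].
  by rewrite /pval -em -ek; ring.
apply: regM => //.
pose p0 := plin r0; pose s0 := psq r0.
pose ds := [seq (y.1.2, qsub (plin y.2) p0, qsub (psq y.2) s0) | y <- g].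
have C1z : nilp (qcollect (flatten [seq qscale y.1.1 y.1.2 | y <- ds])) -> C1 = 0.
  move=> /nilP nil; have := qlin_collect chE Y (flatten [seq qscale y.1.1 y.1.2 | y <- ds]).
  rewrite nil qlin_nil qlin_flatten big_map => e.
  have -> : C1 = \sum_(d <- g) qv E d.1.2 * (p d - qlin Y p0) + (\sum_(d <- g) qv E d.1.2) * qlin Y p0.
    by rewrite /C1 big_distrl -big_split /=; apply: eq_bigr => d _; ring.
  rewrite sum_c mul0r addr0 [RHS]e; apply: eq_bigr => d _ /=.
  by rewrite (qlin_scale chE) (qlin_sub chE).
have C2z : C1 = 0 -> all (fun x => qisz x.2) (foldr (fun y acc =>
    foldr qins acc (qfscale y.1.1 (qsquare y.1.2 ++ qdiag y.2))) [::] ds) -> C2 = 0.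
  move=> C10 /(qquad_zero Y).
  have -> : qquad Y (foldr (fun y acc =>
      foldr qins acc (qfscale y.1.1 (qsquare y.1.2 ++ qdiag y.2))) [::] ds) =
    \sum_(d <- g) qv E d.1.2 * ((p d - qlin Y p0) * (p d - qlin Y p0) +
                               (s d - qlin (fun h => Y h * Y h) s0)).
    rewrite /ds; elim: (g) => [|d g' IH] /=; first by rewrite /qquad !big_nil.
    rewrite big_cons (qquad_foldr_ins chE) -IH (qquad_scale chE) /qquad big_cat /=.
    rewrite -!/(qquad _ _) (qquad_square chE) qquad_diag !(qlin_sub chE) //.
  move=> e; rewrite -[LHS]subr0 -[X in _ - X]e /C2.
  (* The passage to p - p0 and s - s0 only adds multiples of the sum of c and of C1, both already
     zero. *)
  have -> : \sum_(d <- g) qv E d.1.2 * ((p d - qlin Y p0) * (p d - qlin Y p0) +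
      (s d - qlin (fun h => Y h * Y h) s0)) =
    C2 + (\sum_(d <- g) qv E d.1.2) * (qlin Y p0 * qlin Y p0 - qlin (fun h => Y h * Y h) s0)
      - C1 * (qlin Y p0 + qlin Y p0).
    move: (qlin Y p0) (qlin _ s0) => a b.
    rewrite /C2 /C1 !big_distrl /= -sumrN -!big_split /=; apply: eq_bigr => d _.
    by move: (p d) (s d) (qv E _) => *; ring.
  by rewrite sum_c C10 !mul0r addr0 subr0 subrr.
have inv1 : eps^-1 * eps = 1 by rewrite mulVf.
have regG (n : nat) : n = 0%N \/ n = 1%N \/ n = 2%N -> reg (eps ^+ n).
  by move=> _; elim: n => [|n IH]; [rewrite expr0 -qv1|rewrite exprS; apply: regM].
have regs : reg (C1 + C2 * half * eps + eps * eps * C3).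
  by reg; apply: reg_qv.
have regs2 : reg (C2 * half + eps * C3) by reg; apply: reg_qv.
move: check; case em: m => [|m'|m'] /=; [by case/andP..| |by case/andP].
case: m' em => [[m'|m'|]|[m'|m'|]|] em //=.
- by case/andP.
- by case/andP.
- case/andP => h1 h2; have C10 := C1z h1; have C20 := C2z C10 h2.
  rewrite C10 C20 !mul0r !add0r -exprz_inv.
  have -> : eps^-1 ^ int_of_Z 3 * (eps * eps * eps * C3) =
    (eps^-1 * eps) * (eps^-1 * eps) * (eps^-1 * eps) * C3.
    by rewrite -[eps^-1 ^ _]/(eps^-1 ^+ 3); ring.
  by rewrite inv1 !mul1r.
- by case/andP.
- by case/andP.
- case/andP => h1 _; have C10 := C1z h1.
  rewrite C10 mul0r add0r -exprz_inv.
  have -> : eps^-1 ^ int_of_Z 2 * (C2 * half * (eps * eps) + eps * eps * eps * C3) =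
    (eps^-1 * eps) * (eps^-1 * eps) * (C2 * half + eps * C3).
    by rewrite -[eps^-1 ^ _]/(eps^-1 ^+ 2); ring.
  by rewrite inv1 !mul1r.
- move=> _; rewrite -exprz_inv.
  have -> : eps^-1 ^ int_of_Z 1 * (C1 * eps + C2 * half * (eps * eps) + eps * eps * eps * C3) =
    (eps^-1 * eps) * (C1 + C2 * half * eps + eps * eps * C3).
    by rewrite -[eps^-1 ^ _]/(eps^-1); ring.
  by rewrite inv1 mul1r.
Qed.

Lemma sum_insert_group d gs :
  \sum_(g <- insert_group d gs) \sum_(d' <- g) pval d' =
  pval d + \sum_(g <- gs) \sum_(d' <- g) pval d'.
Proof.
elim: gs => [|[|y g] gs IH] /=; first by rewrite !big_cons !big_nil addr0.
  by rewrite !big_cons !big_nil !addr0 add0r.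
case: ifP => _; first by rewrite !big_cons !addrA.
rewrite [LHS]big_cons IH addrCA; congr (_ + _).
by rewrite [in RHS]big_cons.
Qed.

Lemma mem_insert_group d gs g d' : g \in insert_group d gs -> d' \in g ->
  d' = d \/ exists2 g', g' \in gs & d' \in g'.
Proof.
elim: gs g => [|[|y g0] gs IH] g /=.
- by rewrite !inE => /eqP -> ; rewrite inE => /eqP ->; left.
- rewrite inE => /orP [/eqP ->|hg hd]; first by rewrite inE => /eqP ->; left.
  by right; exists g; rewrite // inE hg orbT.
case: ifP => _; rewrite inE => /orP [/eqP ->|hg].
- rewrite inE => /orP [/eqP ->|h]; first by left.
  by right; exists (y :: g0); rewrite // inE eqxx.
- by move=> hd; right; exists g; rewrite // inE hg orbT.
- by move=> hd; right; exists (y :: g0); rewrite // inE eqxx.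
- move=> hd; have [->|[g' hg' hd']] := IH _ hg hd; first by left.
  by right; exists g'; rewrite // inE hg' orbT.
Qed.

Lemma pole_check_regular ts : pole_check ts l ->
  (forall t, t \in ts -> forall fe, fe \in t.2 -> fe.1 != l -> fv Px fe.1 != 0) ->
  (forall t, t \in ts -> ~~ (expo l t.2 <? 0)%BZ -> reg (tv P t)) ->
  reg (sv P ts).
Proof.
case/andP => p0 /allP chk hs hreg.
rewrite /sv (bigID (fun t : term => (expo l t.2 <? 0)%BZ)) /=.
apply: regD; last first.
  rewrite big_seq_cond; apply: (big_ind reg); [exact: reg0|exact: regD|].
  by move=> t /andP [ht he]; apply: hreg.
rewrite -big_filter; set us := [seq t <- ts | _] in chk *.
have hus t : t \in us -> pok (mkpdata l t) /\ tv P t = pval (mkpdata l t).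
  by rewrite mem_filter => /andP [_ ht]; apply: mkpdataP (hs t ht).
have -> : \sum_(t <- us) tv P t = \sum_(d <- [seq mkpdata l t | t <- us]) pval d.
  by rewrite big_map; apply: eq_big_seq => t /hus [].
have {hus} hok d : d \in [seq mkpdata l t | t <- us] -> pok d.
  by case/mapP => t /hus [h _] ->.
move: [seq mkpdata l t | t <- us] hok chk => dl hok chk.
have -> : \sum_(d <- dl) pval d =
    \sum_(g <- foldr insert_group [::] dl) \sum_(d <- g) pval d.
  elim: (dl) => [|d dl' IH] /=; first by rewrite !big_nil.
  by rewrite sum_insert_group big_cons IH.
apply: reg_sum => g hg; apply: group_check_regular; first exact: chk.
suff : forall d, d \in g -> d \in dl by move=> h d /h; apply: hok.
move: g hg {chk hok}; elim: dl => [|d dl IH] g //= hg d' hd'.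
have [->|[g' hg' hd'']] := mem_insert_group hg hd'; rewrite inE ?eqxx //.
by rewrite (IH _ hg' _ hd'') orbT.
Qed.

End PoleCheckCorrect.

(** * Vanishing on lines and planes *)

Section DenominatorCheck.
Local Open Scope Z_scope.

Definition lamdens (n : nat) : seq (form * Z) := [seq (f, Z.of_nat n) | f <- lamf].

(* The terms are homogeneous of degree 0, and become polynomials when multiplied by the pole forms
   with their multiplicities and by the n-th power of the product of the lambda's. *)
Definition den_check (n : nat) (ts : seq term) : bool :=
  let ds := poledens ts in let d := ds ++ lamdens n in let fs := unzip1 d in
  all (fun fe => 0 <=? fe.2) ds &&
  all (fun t : term =>
    [&& all (fun fe => 0 <=? fe.2) (zcollect (t.2 ++ d)), totexp t.2 =? 0
      & all (fun fe => (0 <=? fe.2) || has (feq fe.1) fs) t.2]) ts.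

End DenominatorCheck.

Lemma totexp_cat s t : totexp (s ++ t) = (totexp s + totexp t)%BZ.
Proof. by elim: s => [|fe s IH] //=; rewrite IH Z.add_assoc. Qed.

Lemma totexp_perm s t : perm_eq s t -> totexp s = totexp t.
Proof.
have e s' : totexp s' = \sum_(fe <- s') fe.2.
  by elim: s' => [|fe s' IH] /=; rewrite ?big_nil // big_cons -IH.
by move=> p; rewrite !e; apply: perm_big.
Qed.

Lemma totexp_comb x e s : totexp (comb Z.add (Z.eqb 0) x e s) = (e + totexp s)%BZ.
Proof.
elim: s x e => [|[y e'] s IH] x e /=.
  by case: (Z.eqb_spec 0 e) => [<-|_].
case: feqP => _; first by rewrite IH Z.add_assoc.
by case: (Z.eqb_spec 0 e) => [<-|_] /=; rewrite IH.
Qed.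

Lemma totexp_collect s : totexp (zcollect s) = totexp s.
Proof.
have <- : totexp (sort (@kle Z) s) = totexp s by apply: totexp_perm; rewrite perm_sort.
rewrite /zcollect /collect; case: (sort _ _) => [|[x e] r] //.
exact: totexp_comb.
Qed.

Lemma int_of_nonneg e : (0 <=? e)%BZ -> int_of_Z e = Posz (Z.to_nat e).
Proof. by case: e. Qed.

Section LineVanishing.
Variable k : fieldType.
Hypothesis ch0 : char0 k.
Variables (n : nat) (ts : seq term) (z v : pt k).
Local Notation Px := (shift_pt z v).

Definition den_forms := poles ts ++ lamf.
Definition root_on_line (f : form) : k := - fv z f / fv v f.

Hypothesis check_poles : all (pole_check ts) (poles ts).
Hypothesis check_dens : den_check n ts.
Hypothesis v_dens : forall f, f \in den_forms -> fv v f != 0.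
Hypothesis z_dens : forall f, f \in den_forms -> fv z f != 0.
Hypothesis z_forms : forall t fe, t \in ts -> fe \in t.2 -> fv z fe.1 != 0.
Hypothesis sep : forall l t fe, l \in poles ts -> t \in ts -> fe \in t.2 -> fe.1 != l ->
  fv (Px (root_on_line l)) fe.1 != 0.
Variable xs : seq k.
Hypothesis xs_uniq : uniq xs.
Hypothesis xs_size : (4 * n < size xs)%N.
Hypothesis xs_dens : forall x f, x \in xs -> f \in den_forms -> fv (Px x) f != 0.
Hypothesis xs_zero : forall x, x \in xs -> sv (Px x) ts = 0.

Local Notation E := {fraction {poly k}}.
Local Notation P := (line_pt z v).

Lemma root_on_lineP f : fv v f != 0 -> fv (Px (root_on_line f)) f = 0.
Proof. by move=> f0; rewrite fv_shift /root_on_line divfK // subrr. Qed.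

Lemma shift0 : Px 0 = z.
Proof. by case: (z) => [[[a b] c] d]; rewrite /shift_pt /= !mul0r !addr0. Qed.

Lemma mem_poledens_lam f : (f \in unzip1 (poledens ts ++ lamdens n)) = (f \in den_forms).
Proof. by rewrite /den_forms /unzip1 map_cat !mem_cat. Qed.

Lemma neg_den t fe : t \in ts -> fe \in t.2 -> (fe.2 <? 0)%BZ -> fe.1 \in den_forms.
Proof.
case/andP: check_dens => _ /allP chk /chk /and3P [_ _ /allP h] /h.
case/orP; first by rewrite Z.ltb_antisym => ->.
by case/hasP => f hf /feqP -> _; rewrite -mem_poledens_lam.
Qed.

Lemma line_neq0_z f : fv z f != 0 -> fv P f != 0.
Proof. by move=> f0; apply: (@line_neq0 _ z v 0); rewrite shift0. Qed.

Lemma sv_spec x : (forall f, f \in den_forms -> fv (Px x) f != 0) ->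
  spec (poly_frac k) (hev x) (sv P ts) (sv (Px x) ts).
Proof.
move=> h; apply: spec_sum => t ht; apply: (spec_tv (spec_line z v x)).
  exact: qden_neq0.
by move=> fe hfe /(neg_den ht hfe); apply: h.
Qed.

Lemma regular_unit (x : k) (e a : E) : spec (poly_frac k) (hev x) e 0 -> regular x a ->
  1 + e * a != 0 /\ regular x (1 + e * a)^-1.
Proof.
move=> se [w hw]; have su : spec (poly_frac k) (hev x) (1 + e * a) 1.
  by have := specD (spec1 _ _) (specM se hw); rewrite mul0r addr0.
split; last by eexists; apply: specV su (oner_neq0 _).
apply: contra_neq (oner_neq0 k) => e0; rewrite e0 in su.
exact: line_uniq su (spec0 _ _).
Qed.

Lemma sv_regular l : l \in poles ts -> regular (root_on_line l) (sv P ts).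
Proof.
move=> hl; have hlD : l \in den_forms by rewrite mem_cat hl.
set x := root_on_line l; have lx : fv (Px x) l = 0 by apply: root_on_lineP (v_dens hlD).
have l0 : fv P l != 0 by apply: line_neq0_z (z_dens hlD).
have se : spec (poly_frac k) (hev x) (fv P l) 0.
  by have := spec_fv l (spec_line z v x); rewrite lx.
have rfv f : regular x (fv P f) by eexists; apply: spec_fv (spec_line z v x).
have rinv f : fv (Px x) f != 0 -> regular x (fv P f)^-1.
  by move=> f0; eexists; apply: specV (spec_fv f (spec_line z v x)) f0.
have rqv q : regular x (qv E q) by eexists; apply: spec_qv; apply: qden_neq0.
have chE : char0 E := charE ch0.
have regD a b : regular x a -> regular x b -> regular x (a + b) by exact: regularD.
have regM a b : regular x a -> regular x b -> regular x (a * b) by exact: regularM.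
have fv0 f : fv (Px x) f != 0 -> fv P f != 0 by exact: line_neq0.
have runit a : regular x a -> 1 + fv P l * a != 0 /\ regular x (1 + fv P l * a)^-1.
  exact: regular_unit.
have H := @pole_check_regular k E ch0 chE (regular x) P (Px x) l lx l0 regD regM rqv rfv rinv fv0 runit ts.
apply: H; first exact: (allP check_poles).
  by move=> t ht fe hfe fl; apply: (sep hl ht hfe fl).
move=> t ht ex; rewrite /tv (lv_expo _ l0).
have rX (a : E) m : regular x a -> regular x (a ^+ m).
  by move=> ra; elim: m => [|m IH]; [apply: (regular_zi x 1%BZ)|rewrite exprS; apply: regularM].
apply: regularM => //; apply: regularM.
  by rewrite int_of_nonneg ?Z.leb_antisym //; apply: rX.
rewrite /lv big_seq; apply: (big_ind (regular x)); first exact: (regular_zi x 1%BZ).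
  by move=> *; apply: regularM.
move=> fe; rewrite mem_filter => /andP [/feqP fl hfe].
have f0 : fv (Px x) fe.1 != 0 by apply: (sep hl ht hfe); apply/eqP => e; apply: fl; rewrite e.
by case: (int_of_Z fe.2) => m; [|rewrite NegzE -exprz_inv]; apply: rX; auto.
Qed.

Lemma lv_poly (s : seq (form * Z)) : all (fun fe => (0 <=? fe.2)%BZ) s ->
  exists p : {poly k}, lv P s = tofrac p /\ (size p <= (Z.to_nat (totexp s)).+1)%N.
Proof.
elim: s => [|[f e] s IH] /=; first by exists 1; rewrite lv_nil tofrac1 size_poly1.
case/andP => e0 hs; have [p [ep sp]] := IH hs.
exists (((fv z f)%:P + fv v f *: 'X) ^+ Z.to_nat e * p); split.
  rewrite lv_cons ep tofracM tofracXn fv_line; congr (_ * _).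
  by rewrite (int_of_nonneg e0).
have s1 : (size ((fv z f)%:P + fv v f *: 'X)%R <= 2)%N.
  apply: leq_trans (size_polyD _ _) _; rewrite geq_max.
  rewrite (leq_trans (size_polyC_leq1 _)) //.
  by apply: leq_trans (size_scale_leq _ _) _; rewrite size_polyX.
have s2 : (size (((fv z f)%:P + fv v f *: 'X) ^+ Z.to_nat e) <= (Z.to_nat e).+1)%N.
  apply: leq_trans (size_poly_exp_leq _ _) _.
  by rewrite ltnS -[leqRHS]mul1n leq_mul2r; case: (size _) s1 => [|[|[|]]] // _; rewrite orbT.
apply: leq_trans (size_polyMleq _ _) _.
rewrite Z2Nat.inj_add; [|lia|by elim: (s) hs => //= -[g e'] s' IHs /andP [/= ? /IHs ?]; lia].
by rewrite -plusE -subn1 leq_subLR; lia.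
Qed.

Lemma clear_denominators :
  exists p : {poly k}, sv P ts * lv P (poledens ts ++ lamdens n) = tofrac p /\
    (size p <= (Z.to_nat (totexp (poledens ts ++ lamdens n))).+1)%N.
Proof.
set d := _ ++ _.
have nd : nonvan P d.
  move=> fe hfe; apply/line_neq0_z/z_dens.
  by rewrite -mem_poledens_lam; apply: map_f.
have ht t : t \in ts -> exists p : {poly k}, tv P t * lv P d = tofrac p /\
    (size p <= (Z.to_nat (totexp d)).+1)%N.
  move=> ht; case/andP: check_dens => _ /allP chk; have /and3P [h1 /Z.eqb_spec h2 _] := chk t ht.
  have [p [ep sp]] := lv_poly h1.
  exists ((zi (Qnum t.1) / zi (Zpos (Qden t.1))) *: p); split.
    rewrite /tv -mulrA -lv_cat.
    have nt : nonvan P (t.2 ++ d).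
      move=> fe; rewrite mem_cat => /orP [h|]; last exact: nd.
      exact/line_neq0_z/(z_forms ht h).
    rewrite -(lv_collect nt) ep -mul_polyC tofracM; congr (_ * _).
    rewrite qv.unlock; apply: (mulIf (qden_neq0 (charE ch0) (Qden t.1))).
    rewrite divfK ?(qden_neq0 (charE ch0)) // -!(zi_rmorph (@tofrac {poly k})) -tofracM.
    by congr tofrac; rewrite -!(zi_rmorph (@polyC k)) -polyCM divfK ?(qden_neq0 ch0).
  apply: leq_trans (size_scale_leq _ _) _; apply: leq_trans sp _.
  by rewrite totexp_collect totexp_cat h2.
rewrite /sv; elim: (ts) ht => [|t us IH] h.
  by exists 0; rewrite big_nil mul0r tofrac0 size_poly0.
have [p [ep sp]] := h t (mem_head _ _).
have [|q [eq sq]] := IH; first by move=> u hu; apply: h; rewrite inE hu orbT.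
exists (p + q); rewrite big_cons mulrDl ep eq tofracD; split=> //.
by apply: leq_trans (size_polyD _ _) _; rewrite geq_max sp.
Qed.

Definition pole_roots : seq k :=
  flatten [seq nseq (Z.to_nat fe.2) (root_on_line fe.1) | fe <- poledens ts].

Lemma lv_poledens : exists2 c : k, c != 0 &
  lv P (poledens ts) = tofrac (c *: \prod_(x <- pole_roots) ('X - x%:P)) /\
  size pole_roots = Z.to_nat (totexp (poledens ts)).
Proof.
case/andP: check_dens => hpos _; rewrite /pole_roots.
have hv fe : fe \in poledens ts -> fv v fe.1 != 0.
  by move=> h; apply: v_dens; rewrite mem_cat map_f.
elim: (poledens ts) hpos hv => [|[f e] s IH] /=.
  by move=> _ _; exists 1; rewrite ?oner_neq0 // lv_nil big_nil scale1r tofrac1.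
case/andP => e0 hs hv; have [|c c0 [el es]] := IH hs.
  by move=> fe h; apply: hv; rewrite inE h orbT.
have f0 : fv v f != 0 := hv (f, e) (mem_head _ _).
exists (fv v f ^+ Z.to_nat e * c); first by rewrite mulf_neq0 ?expf_neq0.
split.
  rewrite lv_cons el big_cat /= big_nseq iter_mulr_1.
  have -> : fv P f ^ int_of_Z e = tofrac ((fv v f *: ('X - (root_on_line f)%:P)) ^+ Z.to_nat e).
    rewrite fv_line tofracXn (int_of_nonneg e0); congr (_ ^+ _).
    have er : fv v f * root_on_line f = - fv z f by rewrite /root_on_line mulrC divfK.
    by congr tofrac; rewrite scalerBr -[fv v f *: _%:P]mul_polyC -polyCM er polyCN opprK addrC.
  by rewrite -tofracM exprZn -scalerAl -scalerAr scalerA.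
rewrite size_cat size_nseq es Z2Nat.inj_add //; [lia|].
by elim: (s) hs => //= -[g e'] s' IHs /andP [/= ? /IHs ?]; lia.
Qed.

(** Multiplied by the n-th powers of the lambda's, the sum has no pole left on the line, so it is a
    polynomial. Its degree is at most 4 n, because the pole factors that raise the degree of the
    cleared numerator are divided out again. It has more than 4 n zeros [xs], so it is 0, and
    parameter 0 gives back the point z. *)
Theorem line_vanishing : sv z ts = 0.
Proof.
have [p [ep sp]] := clear_denominators.
have [c c0 [el es]] := lv_poledens.
(* [c] collects the leading coefficients of the pole forms along the line, since [regular_poly]
   expects monic factors. *)
pose g := sv P ts * lv P (lamdens n) * tofrac c%:P.
have eg : g * tofrac (\prod_(x <- pole_roots) ('X - x%:P)) = tofrac p.
  rewrite /g -ep lv_cat el -mul_polyC tofracM.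
  by move: (sv P ts) (lv P _) (tofrac _) (tofrac _) => *; ring.
have hlam x f m : regular x (fv P f ^ Posz m).
  have rfv : regular x (fv P f) by eexists; apply: spec_fv (spec_line z v x).
  elim: m => [|m IH]; first exact: (regular_zi x 1%BZ).
  by rewrite -exprnP exprS; apply: regularM.
have hreg x : x \in pole_roots -> regular x g.
  case/flattenP => _ /mapP [fe hfe ->] /nseqP [-> _].
  apply: regularM; last exact: regular_tofrac.
  apply: regularM; first by apply: sv_regular; apply: map_f.
  rewrite /lv big_seq; apply: (big_ind (regular _)) => [|*|fe' /mapP [f _ ->]].
  - exact: (regular_zi _ 1%BZ).
  - exact: regularM.
  - rewrite /=; have -> : int_of_Z (Z.of_nat n) = Posz n.
      by rewrite int_of_nonneg ?Nat2Z.id //; lia.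
    exact: hlam.
have [q [eq sq]] := regular_poly hreg eg.
have q0 : q = 0.
  apply/eqP/negPn/negP => q0.
  have := max_poly_roots q0 _ xs_uniq; rewrite ltnNge => /(_ _)/negP; case.
  - apply/allP => x hx; rewrite rootE; apply/eqP.
    have sg : spec (poly_frac k) (hev x) g 0.
      rewrite -(mul0r (lv (Px x) (lamdens n) * c)) /g -mulrA.
      rewrite -{1}(xs_zero hx); apply: specM; first by apply: sv_spec => f; apply: xs_dens.
      apply: specM; last by have := spec_io (poly_frac k) (hev x) c%:P; rewrite /= /horner_eval hornerC.
      apply: spec_lv (spec_line z v x) _ => fe /mapP [f hf ->] _.
      by apply: xs_dens hx _; rewrite mem_cat hf orbT.
    rewrite eq in sg; apply: line_uniq sg; exact: (spec_io (poly_frac k) (hev x) q).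
  - apply: leq_trans sq _; rewrite es.
    apply: leq_trans (leq_sub2r _ sp) _.
    rewrite totexp_cat.
    have -> : totexp (lamdens n) = (4 * Z.of_nat n)%BZ by rewrite /=; lia.
    apply: leq_trans _ xs_size; rewrite leq_subLR; lia.
have g0 : g = 0 by rewrite eq q0 tofrac0.
have sv0 : sv P ts = 0.
  move/eqP: g0; rewrite /g !mulf_eq0 => /orP [/orP [/eqP //|]|]; last first.
    by rewrite tofrac_eq0 polyC_eq0 (negPf c0).
  rewrite /lv prodf_seq_eq0 => /hasP [fe /mapP [f hf ->]] /=.
  have f0 : fv P f != 0 by apply: line_neq0_z; apply: z_dens; rewrite mem_cat hf orbT.
  by rewrite expfz_eq0 (negPf f0) andbF.
have := sv_spec (x := 0); rewrite shift0 => /(_ z_dens) h.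
apply: line_uniq h _; rewrite sv0; exact: spec0.
Qed.

End LineVanishing.

Section PlaneCheck.
Local Open Scope Z_scope.

(** The number is the determinant of f, l and h; a form involving D is independent of two forms that
    do not. *)
Definition indep (h f l : form) : bool := isD f || ~~ (fdot f (cross l h) =? 0).
Definition indep_check (h : form) (fs ls : seq form) : bool :=
  all (fun l => ~~ isD l && let w := cross l h in
    all (fun f => [|| feq f l, isD f | ~~ (fdot f w =? 0)]) fs) ls.
Definition nonparallel (h f : form) : bool := isD f || ~~ feq (cross f h) (0, 0, 0, 0).

(* Lines through a point that is generic on the plane [h = 0], with direction [v], meet the poles of
   the terms and the planes [zs] in distinct points; the latter are enough to conclude. *)
Definition line_check (n : nat) (ts : seq term) (h v : form) (zs : seq form) : bool :=
  let ds := poles ts ++ lamf in let fs := formsof ts in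
  [&& ~~ isD h, all (fun f => ~~ (fdot v f =? 0)) (ds ++ zs),
      all (nonparallel h) (ds ++ fs), indep_check h fs (poles ts),
      indep_check h (ds ++ zs) zs, uniq zs, ~~ has (fun f => has (feq f) ds) zs
    & (4 * n < size zs)%N].

Definition anchor_check (ts : seq term) : bool :=
  all (fun a => all (fun t : term => has (fun fe => feq a fe.1 && (0 <? fe.2)) t.2) ts) anchors.

(** The plane through r and the lambda_1-axis. As H does not contain this axis, the two planes meet,
    in the lambda's, only in the multiples of r, while D is unrestricted. *)
Definition plane_through (r : form) : form := let: (_, _, b, c) := r in (0, 0, c, - b).

Definition plane_check (n : nat) (ts : seq term) (h v : form) (rs : seq form) : bool :=
  [&& line_check n ts h v (anchors ++ [seq plane_through r | r <- rs]), anchor_check ts,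
      ~~ (coord h 0 =? 0), fdot v h =? 0
    & all (fun r => [&& fdot h r =? 0, ~~ isD r & ~~ (coord r 2 =? 0)]) rs].

(* The transpositions (12), (23), (34) of the lambda's. *)
Definition act (i : nat) (f : form) : form :=
  let: (d, a, b, c) := f in
  match i with 0%N => (d, b, a, c) | 1%N => (d, a, c, b) | _ => (d, a - c, b - c, - c) end.
Fixpoint actw (w : seq nat) (f : form) : form :=
  match w with [::] => f | i :: w' => actw w' (act i f) end.
(** A transposition may spoil the normal form and the order of the factors; after restoring both,
    the invariance of a list of terms becomes a syntactic comparison. *)
Definition act_term (i : nat) (t : term) : term :=
  let: (c, s) := tnorm (t.1, [seq (act i fe.1, fe.2) | fe <- t.2]) in (c, sort (@kle Z) s).
Definition teq (s t : term) := qeqb s.1 t.1 && keyeq s.2 t.2.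
Fixpoint remove_term (t : term) (s : seq term) : option (seq term) :=
  match s with
  | [::] => None
  | x :: s' => if teq t x then Some s' else
      match remove_term t s' with None => None | Some r => Some (x :: r) end
  end.
Fixpoint perm_terms (s t : seq term) : bool :=
  match s with
  | [::] => nilp t
  | x :: s' => match remove_term x t with None => false | Some t' => perm_terms s' t' end
  end.
Definition sym_check (ts : seq term) : bool :=
  all (fun i => perm_terms [seq act_term i t | t <- ts] ts) [:: 0%N; 1%N; 2%N].

(** Coset representatives along S_2 < S_3 < S_4: each of the 2 * 3 * 4 elements is written exactly
    once as a word in the three transpositions. *)
Definition words : seq (seq nat) :=
  [seq w1 ++ w2 | w1 <- [seq u ++ w | u <- [:: [::]; [:: 0%N]],
                                      w <- [:: [::]; [:: 1%N]; [:: 1%N; 0%N]]],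
                  w2 <- [:: [::]; [:: 2%N]; [:: 2%N; 1%N]; [:: 2%N; 1%N; 0%N]]].

(** At a generic point no form vanishes, so any plane [h0] is admissible in [line_check]; it merely
    turns the pairwise independence of forms into nonzero determinants. *)
Definition orbit_check (n : nat) (ts : seq term) (h h0 v0 : form) : bool :=
  line_check n ts h0 v0 (anchors ++ [seq actw w h | w <- words]) && sym_check ts.

End PlaneCheck.

(** * Generic points, points of a plane, and the action of S_4 *)

Section Planes.
Variable k : fieldType.
Hypothesis ch0 : char0 k.
Implicit Types (z p : pt k) (f g h l v r : form).

Definition zpt v : pt k := let: (d, a, b, c) := v in (zi d, zi a, zi b, zi c).

Lemma fv_zpt v f : fv (zpt v) f = zi (fdot v f).
Proof.
case: v f => [[[d a] b] c] [[[d' a'] b'] c'] /=.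
by rewrite !ziD !ziM; ring.
Qed.

Definition generic_on h z : Prop :=
  forall g, fv z g = 0 -> exists a b : Z, b <> 0%BZ /\ fscale b g = fscale a h.

Lemma fdotC f g : fdot f g = fdot g f.
Proof. case: f g => [[[d a] b] c] [[[d' a'] b'] c'] /=; lia. Qed.
Lemma fdot_scaler x f g : fdot (fscale x f) g = (x * fdot f g)%BZ.
Proof. case: f g => [[[d a] b] c] [[[d' a'] b'] c'] /=; lia. Qed.
Lemma fdot_subr f1 f2 g : fdot (fsub f1 f2) g = (fdot f1 g - fdot f2 g)%BZ.
Proof.
case: f1 f2 g => [[[d1 a1] b1] c1] [[[d2 a2] b2] c2] [[[d' a'] b'] c'] /=; lia.
Qed.
Lemma fdot_cross f g : fdot f (cross f g) = 0%BZ /\ fdot g (cross f g) = 0%BZ.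
Proof. by case: f g => [[[d1 a1] b1] c1] [[[d2 a2] b2] c2] /=; lia. Qed.

Lemma isD_scale x f : x <> 0%BZ -> isD (fscale x f) = isD f.
Proof. case: f => [[[d a] b] c] /= hx; lia. Qed.

Lemma generic_neq0 h z f : ~~ isD h -> generic_on h z -> nonparallel h f -> fv z f != 0.
Proof.
move=> hD gz np; apply/eqP => /gz [x [y [y0 e]]]; case/orP: np => [fD|].
  have : isD (fscale x h) by rewrite -e isD_scale.
  by case: h hD {gz e} => [[[d a] b] c] /=; lia.
case/feqP; case: f h e hD {gz} => [[[d1 a1] b1] c1] [[[d2 a2] b2] c2] /= [_ ea eb ec] _.
have : (y * (b1 * c2 - c1 * b2) = 0 /\ y * (c1 * a2 - a1 * c2) = 0 /\
        y * (a1 * b2 - b1 * a2) = 0)%BZ.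
  by rewrite !Z.mul_sub_distr_l !Z.mul_assoc ea eb ec; lia.
case=> [h1 [h2 h3]]; rewrite /cross.
by congr (_, _, _, _); nia.
Qed.

(** If f vanished where the line meets l = 0, then (v.l) f - (v.f) l would vanish at z and thus be
    proportional to h, against the independence of f, l and h. *)
Lemma indep_neq0 h z v f l : generic_on h z -> ~~ isD h -> ~~ isD l -> ~~ (fdot v l =? 0)%BZ ->
  indep h f l -> fv (shift_pt z (zpt v) (root_on_line z (zpt v) l)) f != 0.
Proof.
move=> gz hD lD vl ind; rewrite fv_shift /root_on_line !fv_zpt; apply/eqP => e.
have vl0 : zi (fdot v l) != 0 :> k by rewrite zi_neq0.
have : fv z (fsub (fscale (fdot v l) f) (fscale (fdot v f) l)) = 0.
  rewrite fv_sub !fv_scale -[RHS](mulr0 (zi (fdot v l))) -e.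
  by field.
case/gz => x [y [y0 eg]].
have eq0 w : fdot h w = 0%BZ -> fdot l w = 0%BZ -> fdot f w = 0%BZ.
  move=> hw lw; have := congr1 (fun g => fdot g w) eg.
  rewrite /= !fdot_scaler fdot_subr !fdot_scaler hw lw => e0.
  by move/Z.eqb_spec: vl; nia.
case/orP: ind => [fD|/negP[]]; last first.
  by apply/Z.eqb_spec/eq0; case: (fdot_cross l h).
(* For a form f involving D, the D-axis is a witness: h and l vanish on it and f does not. *)
have := eq0 (1, 0, 0, 0)%BZ;
  case: (f) (h) (l) fD hD lD => [[[d a] b] c] [[[d2 a2] b2] c2] [[[d3 a3] b3] c3] /=.
by lia.
Qed.

Lemma root_uniq h z v (zs : seq form) : generic_on h z -> ~~ isD h ->
  all (fun f => ~~ (fdot v f =? 0)%BZ) zs -> indep_check h zs zs -> uniq zs ->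
  uniq [seq root_on_line z (zpt v) f | f <- zs].
Proof.
move=> gz hD /allP hv /allP ind uz; rewrite map_inj_in_uniq // => f g hf hg e.
have /andP [gD /allP /(_ f hf)] := ind g hg; case/or3P => [/feqP //|fD|nz].
  by have /andP [] := ind f hf; rewrite fD.
have f0 : fv (shift_pt z (zpt v) (root_on_line z (zpt v) g)) f != 0.
  by apply: (indep_neq0 gz) => //; [exact: hv|rewrite /indep nz orbT].
case/eqP: f0; rewrite -e; apply: root_on_lineP.
by rewrite fv_zpt zi_neq0 // hv.
Qed.

(** Every occurrence enters with exponent 1, so no total is 0 and the collection drops no form. *)
Lemma mem_formsof (ts : seq term) t fe : t \in ts -> fe \in t.2 -> fe.1 \in formsof ts.
Proof.
move=> ht hfe; rewrite /formsof; set s := flatten _.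
have hs : fe.1 \in unzip1 s.
  apply: (map_f fst (x := (fe.1, 1%BZ))); apply/flattenP.
  by exists [seq (x.1, 1%BZ) | x <- t.2]; [apply: map_f|apply: (map_f (fun x => (x.1, 1%BZ)))].
have ps x : x \in s -> (0 < x.2)%BZ.
  by case/flattenP => _ /mapP [t' _ ->] /mapP [fe' _ ->].
have pe : perm_eq (sort (@kle Z) s) s by rewrite perm_sort.
have {}hs : fe.1 \in unzip1 (sort (@kle Z) s).
  by rewrite (perm_mem (perm_map _ pe)).
have {}ps x : x \in sort (@kle Z) s -> (0 < x.2)%BZ by rewrite mem_sort; apply: ps.
rewrite /zcollect /collect; case: (sort _ _) hs ps => [|[x e] r] // hs ps.
have e0 : (0 < e)%BZ by apply: (ps (x, e)); rewrite inE eqxx.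
have {}ps y : y \in r -> (0 < y.2)%BZ by move=> h; apply: ps; rewrite inE h orbT.
elim: r x e e0 hs ps => [|[y e'] r IH] x e e0 /=.
  by case: (Z.eqb_spec 0 e) => [h|_] //; lia.
move=> hs ps; have e0' : (0 < e')%BZ by apply: (ps (y, e')); rewrite inE eqxx.
have {}ps u : u \in r -> (0 < u.2)%BZ by move=> h; apply: ps; rewrite inE h orbT.
case: feqP => [exy|_].
  apply: IH => //; first by lia.
  by move: hs; rewrite /= !inE exy orbA orbb.
case: (Z.eqb_spec 0 e) => [h|_]; first by lia.
move: hs; rewrite /= !inE => /orP [->|hs] //.
by rewrite IH ?orbT // inE.
Qed.

Lemma generic_line_vanishing n ts h v (zs : seq form) z :
  all (pole_check ts) (poles ts) -> den_check n ts -> line_check n ts h v zs ->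
  generic_on h z ->
  (forall f, f \in zs -> let p := shift_pt z (zpt v) (root_on_line z (zpt v) f) in
    fv p f = 0 -> (forall g, g \in den_forms ts -> fv p g != 0) -> sv p ts = 0) ->
  sv z ts = 0.
Proof.
move=> chk_p chk_d /and5P [hD /allP hv /allP hnp /allP hsep /and4P [/allP hz uz /hasPn hzd sz]] gz hzs.
have hvz f : f \in zs -> fv (zpt v) f != 0.
  by move=> hf; rewrite fv_zpt zi_neq0 // hv // mem_cat hf orbT.
have hsep' f l (fs ls : seq form) : (forall l, l \in ls ->
    ~~ isD l && all (fun f => [|| feq f l, isD f | ~~ (fdot f (cross l h) =? 0)%BZ]) fs) ->
    l \in ls -> ~~ (fdot v l =? 0)%BZ -> f \in fs -> f != l ->
    fv (shift_pt z (zpt v) (root_on_line z (zpt v) l)) f != 0.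
  move=> ind /ind /andP [lD /allP hl] vl /hl hf fl; apply: (indep_neq0 gz) => //.
  by case/orP: hf fl => // /feqP ->; rewrite eqxx.
have zs_dens f g : f \in zs -> g \in den_forms ts ->
    fv (shift_pt z (zpt v) (root_on_line z (zpt v) f)) g != 0.
  move=> hf hg; apply: (hsep' g f ((poles ts ++ lamf) ++ zs) zs hz hf).
  - by apply: hv; rewrite mem_cat hf orbT.
  - by rewrite mem_cat hg.
  - apply: contraNneq (hzd f hf) => <-; apply/hasP; exists g => //; exact/feqP.
apply: (@line_vanishing k ch0 n ts z (zpt v) chk_p chk_d _ _ _ _
  [seq root_on_line z (zpt v) f | f <- zs]).
- by move=> f hf; rewrite fv_zpt zi_neq0 // hv // mem_cat hf.
- by move=> f hf; apply: (generic_neq0 hD gz); apply: hnp; rewrite mem_cat hf.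
- move=> t fe ht hfe; apply: (generic_neq0 hD gz); apply: hnp.
  by rewrite mem_cat (mem_formsof ht hfe) orbT.
- move=> l t fe hl ht hfe fl; apply: (hsep' fe.1 l (formsof ts) (poles ts) hsep hl) => //.
    by apply: hv; rewrite !mem_cat hl.
  exact: mem_formsof ht hfe.
- apply: root_uniq gz hD _ _ uz; first by apply/allP => f hf; apply: hv; rewrite mem_cat hf orbT.
  apply/allP => l /hz /andP [-> /allP hl]; apply/allP => f hf.
  by apply: hl; rewrite mem_cat hf orbT.
- by rewrite size_map.
- by move=> x f /mapP [g hg ->]; apply: zs_dens.
- move=> x /mapP [f hf ->]; apply: hzs => //; first exact: root_on_lineP (hvz _ hf).
  by move=> g; apply: zs_dens.
Qed.

Lemma anchor_zero (ts : seq term) p a : anchor_check ts -> a \in anchors -> fv p a = 0 ->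
  sv p ts = 0.
Proof.
move=> /allP chk /chk /allP h pa; rewrite /sv big_seq big1 // => t /h /hasP [fe hfe].
case/andP => /feqP ea pos; rewrite /tv [lv _ _](big_rem fe) //= -ea pa.
have -> : (0 : k) ^ int_of_Z fe.2 = 0; last by rewrite mul0r mulr0.
apply/eqP; rewrite expfz_eq0 eqxx andbT.
by apply/eqP => e; move: pos; rewrite -[fe.2]int_of_ZK e.
Qed.

Definition scale_pt (c : k) p : pt k := (c * p.1.1.1, c * p.1.1.2, c * p.1.2, c * p.2).

Lemma sv_scale n (ts : seq term) c p : den_check n ts -> c != 0 ->
  sv (scale_pt c p) ts = sv p ts.
Proof.
case/andP => _ /allP chk c0; rewrite /sv !big_seq; apply: eq_bigr => t /chk.
case/and3P => _ /Z.eqb_spec e _; rewrite /tv /scale_pt totexp_scale //.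
by rewrite e expr0z mul1r.
Qed.

(* The second of the two reductions: from a plane to finitely many points. *)
Lemma plane_vanishing n ts h v (rs : seq form) z :
  all (pole_check ts) (poles ts) -> den_check n ts -> plane_check n ts h v rs ->
  (forall r (d : k), r \in rs -> sv (d, zi (coord r 0), zi (coord r 1), zi (coord r 2)) ts = 0) ->
  generic_on h z -> fv z h = 0 -> sv z ts = 0.
Proof.
move=> chk_p chk_d /and5P [chk_l chk_a h1 /Z.eqb_spec hv /allP hrs] hnum gz zh.
apply: (generic_line_vanishing chk_p chk_d chk_l gz) => f.
rewrite mem_cat => /orP [hf p|]; first by move=> pf _; apply: anchor_zero chk_a hf pf.
case/mapP => r hr -> p pf pdens.
have ph : fv p h = 0.
  by rewrite /p fv_shift zh fv_zpt hv zi0 mulr0 addr0.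
have /and3P [/Z.eqb_spec rh rD r3] := hrs r hr.
have hD : ~~ isD h by case/andP: chk_l.
have l3 : p.2 != 0.
  have := pdens (0, 0, 0, 1)%BZ; rewrite mem_cat orbT => /(_ isT).
  by case: (p) => [[[pd pa] pb] pc]; rewrite /= !mul0r !add0r zi1 mul1r.
have r30 : zi (coord r 2) != 0 :> k by rewrite zi_neq0.
have c0 : (p.2 / zi (coord r 2))^-1 != 0 by rewrite invr_eq0 mulf_neq0 ?invr_eq0.
(* [p] lies on H and on [plane_through r], so its lambda-coordinates are a multiple of those of r.
   Homogeneity of degree 0 permits division by this multiple, at the price of another value of D. *)
rewrite -(sv_scale p chk_d c0) -(hnum r ((p.2 / zi (coord r 2))^-1 * p.1.1.1) hr).
congr (sv _ _); rewrite /scale_pt.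
have h10 : zi (coord h 0) != 0 :> k by rewrite zi_neq0.
have : fv (zpt r) h = 0 by rewrite fv_zpt fdotC rh.
case: (p) (r) (h) ph pf l3 r30 h10 hD rD => [[[pd pa] pb] pc] [[[rd ra] rb] rc] [[[dh ah] bh] ch] /=.
move=> ph pf l3 r30 h10 /negPn /Z.eqb_spec hD0 _; rewrite hD0 in ph * .
rewrite ziN !zi0 !mul0r !add0r in ph pf * => rh0.
have eb : pb = pc / zi rc * zi rb.
  have e : zi rc * pb = zi rb * pc by apply/eqP; rewrite -subr_eq0 -mulNr pf.
  by apply: (mulfI r30); rewrite e; field.
have ea : pa = pc / zi rc * zi ra.
  apply: (mulfI h10); have e1 : zi ah * zi ra = - (zi bh * zi rb + zi ch * zi rc) :> k.
    by apply/eqP; rewrite -addr_eq0 addrA rh0.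
  have e2 : zi ah * pa = - (zi bh * pb + zi ch * pc).
    by apply/eqP; rewrite -addr_eq0 addrA ph.
  have -> : zi ah * (pc / zi rc * zi ra) = pc / zi rc * (zi ah * zi ra) by ring.
  by rewrite e2 eb e1; field.
by congr (_, _, _, _); rewrite ?ea ?eb //; field; rewrite l3 r30.
Qed.

Section Symmetry.

Definition actp (i : nat) p : pt k :=
  let: (d, a, b, c) := p in
  match i with 0%N => (d, b, a, c) | 1%N => (d, a, c, b) | _ => (d, a, b, - (a + b + c)) end.
Fixpoint actpw (w : seq nat) p : pt k :=
  match w with [::] => p | i :: w' => actp i (actpw w' p) end.

Lemma fv_actp i p f : fv (actp i p) f = fv p (act i f).
Proof.
case: p f => [[[pd pa] pb] pc] [[[d a] b] c]; case: i => [|[|i]] /=; [ring..|].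
by rewrite ziN !ziB; ring.
Qed.

Lemma fv_actpw w p f : fv (actpw w p) f = fv p (actw w f).
Proof. by elim: w f => [|i w IH] f //=; rewrite fv_actp IH. Qed.

Lemma actK i : involutive (act i).
Proof.
case: i => [|[|i]] [[[d a] b] c] //=; congr (_, _, _, _); lia.
Qed.

Lemma actw_inj w : injective (actw w).
Proof.
elim: w => [|i w IH] f g //= /IH; exact: (can_inj (actK i)).
Qed.

Lemma actw_scale w x f : actw w (fscale x f) = fscale x (actw w f).
Proof.
elim: w f => [|i w IH] f //=; rewrite -IH; congr actw.
by case: i f => [|[|i]] [[[d a] b] c] //=; congr (_, _, _, _); lia.
Qed.

Lemma sv_actp i ts p : sv (actp i p) ts = sv p [seq act_term i t | t <- ts].
Proof.
rewrite /sv big_map; apply: eq_bigr => t _; rewrite /act_term.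
set u := (t.1, _); have -> : tv (actp i p) t = tv p u.
  by rewrite /tv /lv big_map; congr (_ * _); apply: eq_bigr => fe _; rewrite fv_actp.
rewrite -(tnorm_v ch0); case: (tnorm u) => c s; rewrite /tv /=; congr (_ * _).
by apply: perm_big; rewrite perm_sym perm_sort.
Qed.

Lemma teq_eq s t : teq s t -> s = t.
Proof. by case: s t => [c s] [c' t] /andP [/= /qeqP -> /keyeqP ->]. Qed.

Lemma remove_termP t (s r : seq term) p : remove_term t s = Some r -> sv p s = tv p t + sv p r.
Proof.
elim: s r => [|x s IH] r //=; case: ifP => [/teq_eq <- [<-]|_]; first by rewrite /sv big_cons.
case: remove_term IH => // r' IH [<-].
by rewrite /sv !big_cons -/(sv _ _) (IH r') // addrCA.
Qed.

Lemma perm_terms_sv s t p : perm_terms s t -> sv p s = sv p t.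
Proof.
elim: s t => [|x s IH] t /=; first by move/nilP ->.
case e: remove_term => [t'|] // h.
by rewrite (remove_termP _ e) -(IH _ h); apply: big_cons.
Qed.

Lemma sym_sv ts w p : sym_check ts -> all (fun i => i < 3)%N w -> sv (actpw w p) ts = sv p ts.
Proof.
move=> /allP chk; elim: w => [|i w IH] //= /andP [i3 /IH <-].
rewrite sv_actp; apply: perm_terms_sv; apply: chk.
by case: i i3 => [|[|[|]]].
Qed.

(* The first reduction: from a generic point to the planes in the orbit of [h] under S_4. *)
Lemma orbit_vanishing n ts h v h0 v0 (rs : seq form) z :
  all (pole_check ts) (poles ts) -> den_check n ts -> plane_check n ts h v rs ->
  orbit_check n ts h h0 v0 ->
  (forall r (d : k), r \in rs -> sv (d, zi (coord r 0), zi (coord r 1), zi (coord r 2)) ts = 0) ->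
  (forall g, fv z g = 0 -> g = (0, 0, 0, 0)%BZ) -> sv z ts = 0.
Proof.
move=> chk_p chk_d chk_h /andP [chk_l chk_s] hnum gz.
have gz0 : generic_on h0 z.
  by move=> g /gz ->; exists 0%BZ, 1%BZ; split=> //; case: h0 {chk_l} => [[[d a] b] c].
have chk_a : anchor_check ts by case/and5P: chk_h.
apply: (generic_line_vanishing chk_p chk_d chk_l gz0) => f.
rewrite mem_cat => /orP [hf p|]; first by move=> pf _; apply: anchor_zero chk_a hf pf.
case/mapP => w hw -> p pf _.
have w3 : all (fun i => i < 3)%N w by move: w hw {p pf}; apply/allP.
rewrite -(sym_sv p chk_s w3).
apply: (plane_vanishing chk_p chk_d chk_h hnum); last by rewrite fv_actpw.
(* The moved point is generic on H: if g' vanishes where the line meets h' = 0, then (v0.h') g' -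
   (v0.g') h' vanishes at z, so it is zero and g' is proportional to h'. *)
move=> g; rewrite fv_actpw /p fv_shift /root_on_line !fv_zpt => e.
set h' := actw w h in e *; set g' := actw w g in e *.
have hV : ~~ (fdot v0 h' =? 0)%BZ.
  have /and5P [_ /allP hv _ _ _] := chk_l; apply: hv.
  by rewrite !mem_cat (map_f (fun w => actw w h) hw) !orbT.
exists (fdot v0 g'), (fdot v0 h'); split; first by apply/Z.eqb_spec.
apply: (@actw_inj w); rewrite !actw_scale -/g' -/h'.
have V0 : zi (fdot v0 h') != 0 :> k by rewrite zi_neq0.
have : fv z (fsub (fscale (fdot v0 h') g') (fscale (fdot v0 g') h')) = 0.
  rewrite fv_sub !fv_scale -[RHS](mulr0 (zi (fdot v0 h'))) -e.
  by field.
move/gz; case: (g') (h') => [[[d a] b] c] [[[d' a'] b'] c'] /= [e1 e2 e3 e4].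
by congr (_, _, _, _); apply/Z.sub_move_0_r.
Qed.

End Symmetry.

End Planes.

(** * Vanishing at numerical points *)

Section NumericCheck.
Local Open Scope Z_scope.

(* A nonzero integer p is encoded as the form [(0, 0, 0, p)], so that products of powers of
   integers can be handled as products of forms. *)
Definition int_form (p : Z) : form := (0, 0, 0, p).

Fixpoint trial_division (fuel : nat) (p x : Z) : seq Z :=
  match fuel with
  | 0%N => [:: x]
  | S fuel' => if x =? 1 then [::] else
      if x mod p =? 0 then p :: trial_division fuel' p (x / p)
      else trial_division fuel' (p + 1) x
  end.
(** The test of the product stands in for a proof about [trial_division]. An incomplete
    factorization would be harmless: it can only enlarge the common denominators. *)
Definition factor (x : Z) : seq (form * Z) :=
  let ps := trial_division 1000 2 x in
  if ~~ (x =? 0) && (foldr Z.mul 1 ps =? x) then zcollect [seq (int_form p, 1) | p <- ps]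
  else [:: (int_form x, 1)].
Definition factor_table (n : nat) := [seq factor (Z.of_nat i) | i <- iota 0 n].
Definition factored (tab : seq (seq (form * Z))) (x e : Z) : seq (form * Z) :=
  let y := Z.abs x in
  let l := nth [:: (int_form y, 1)] tab (Z.to_nat y) in
  (if x <? 0 then [:: (int_form (-1), e)] else [::]) ++ [seq (fe.1, fe.2 * e) | fe <- l].

Definition vanishes_at (r : form) (t : term) : bool :=
  has (fun fe => [&& ~~ isD fe.1, 0 <? fe.2 & fdot r fe.1 =? 0]) t.2.
Definition constant_part tab (r : form) (t : term) : seq (form * Z) :=
  zcollect (factored tab (Qnum t.1) 1 ++ factored tab (Zpos (Qden t.1)) (-1) ++
    flatten [seq factored tab (fdot r fe.1) fe.2 | fe <- t.2 & ~~ isD fe.1]).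
Definition Dpart (r : form) (t : term) : seq (Z * Z) :=
  [seq (fdot r fe.1, fe.2) | fe <- t.2 & isD fe.1].

(* Polynomials in D: coefficients in increasing degree. *)
Fixpoint poly_mul (m : Z) (p : seq Z) (carry : Z) : seq Z :=
  match p with
  | [::] => [:: carry]
  | x :: p' => (m * x + carry) :: poly_mul m p' x
  end.
Fixpoint poly_add (p q : seq Z) : seq Z :=
  match p, q with
  | [::], _ => q
  | _, [::] => p
  | x :: p', y :: q' => (x + y) :: poly_add p' q'
  end.
Definition expand_term (x : seq (form * Z) * seq (Z * Z)) : seq Z :=
  foldl (fun p me => iter (Z.to_nat me.2) (fun q => poly_mul me.1 q 0) p)
    [:: foldl (fun acc fe => acc * coord fe.1 2 ^ fe.2) 1 x.1] x.2.

Definition nonzero_ints (s : seq (form * Z)) : bool :=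
  all (fun fe => feq fe.1 (int_form (coord fe.1 2)) && ~~ (coord fe.1 2 =? 0)) s.

(** At r every remaining term is a rational number times a product of factors D + m. [d] is a
    factored common denominator; after multiplication by it the sum is a polynomial in D with
    integer coefficients, which must be zero. This settles all values of D at once. *)
Definition num_check tab (ts : seq term) (r : form) : bool :=
  let us := [seq t <- ts | ~~ vanishes_at r t] in
  let ss := [seq (constant_part tab r t, Dpart r t) | t <- us] in
  let d := collect Z.max (fun e => e <=? 0)
    (flatten [seq [seq (fe.1, - fe.2) | fe <- x.1 & fe.2 <? 0] | x <- ss]) in
  let ss' := [seq (zcollect (x.1 ++ d), x.2) | x <- ss] in
  [&& ~~ isD r, all (fun t : term => all (fun fe => let: (a, _, _, _) := fe.1 in
        (a =? 0) || (a =? 1) && (0 <=? fe.2)) t.2) us,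
      all (fun t : term => all (fun fe => isD fe.1 || ~~ (fdot r fe.1 =? 0)) t.2) us,
      all (fun t : term => ~~ (Qnum t.1 =? 0)) us,
      nonzero_ints d,
      all (fun x => all (fun fe => 0 <=? fe.2) x.1) ss' &
      all (fun x => x =? 0) (foldr (fun x p => poly_add (expand_term x) p) [::] ss')].

End NumericCheck.

Section NumericCheckCorrect.
Variable k : fieldType.
Hypothesis ch0 : char0 k.
Local Notation one_pt := ((0, 0, 0, 1) : pt k).

Lemma fv_one f : fv one_pt f = zi (coord f 2).
Proof. by case: f => [[[d a] b] c] /=; rewrite !mulr0 !add0r mulr1. Qed.

Lemma zi_pow x e : (0 <=? e)%BZ -> zi (x ^ e)%BZ = zi x ^ int_of_Z e :> k.
Proof.
move=> /[dup] e0 /int_of_nonneg ->; rewrite -(Z2Nat.id e); last by lia.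
rewrite Nat2Z.id; elim: (Z.to_nat e) => [|m IH] //.
rewrite Nat2Z.inj_succ Z.pow_succ_r; last by lia.
by rewrite ziM IH -!exprnP exprS.
Qed.

Lemma factorP x : lv one_pt (factor x) = zi x.
Proof.
rewrite /factor; set ps := trial_division _ _ _; case: andP => [[x0 /Z.eqb_spec e]|_]; last first.
  by rewrite lv_cons lv_nil mulr1 fv_one.
have ex : \prod_(p <- ps) zi p = zi x :> k.
  rewrite -e; elim: (ps) => [|p ps' IH] /=; first by rewrite big_nil zi1.
  by rewrite big_cons ziM IH.
rewrite lv_collect; first by rewrite /lv big_map -ex; apply: eq_bigr => p _; rewrite fv_one.
move=> fe /mapP [p hp ->]; rewrite fv_one /=; apply/eqP => p0.
have : zi x != 0 :> k by rewrite (zi_neq0 ch0).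
by rewrite -ex (big_rem p) //= p0 mul0r eqxx.
Qed.

Lemma nonvan_factored n x e : ~~ (x =? 0)%BZ -> nonvan one_pt (factored (factor_table n) x e).
Proof.
move=> x0 fe; rewrite /factored mem_cat; set y := Z.abs x.
have y0 : (y =? 0)%BZ = false by rewrite /y; lia.
have nf m : (m =? 0)%BZ = false -> nonvan one_pt (factor m).
  move=> m0 fe'; rewrite /factor m0; move: (trial_division _ _ _) => ps.
  case: (Z.eqb_spec (foldr Z.mul 1%BZ ps) m) => [em|_]; last first.
    by rewrite inE => /eqP ->; rewrite fv_one (zi_neq0 ch0) //= m0.
  move/mem_collect => /mapP [u /mapP [p hp ->]] ->; rewrite fv_one (zi_neq0 ch0) /=.
  apply/negP => /Z.eqb_spec p0; move: m0; rewrite -em.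
  suff -> : foldr Z.mul 1%BZ ps = 0%BZ by [].
  by elim: (ps) hp => //= q qs IH; rewrite inE -p0 => /orP [/eqP <-|/IH -> ]; lia.
case/orP => [|/mapP [u hu ->]].
  by case: ifP => // _; rewrite inE => /eqP ->; rewrite fv_one (zi_neq0 ch0).
suff : nonvan one_pt (nth [:: (int_form y, 1%BZ)] (factor_table n) (Z.to_nat y)).
  by move=> /(_ u hu).
case: (ltnP (Z.to_nat y) n) => hn.
  rewrite (nth_map 0%N) ?size_iota // nth_iota // add0n Z2Nat.id; last by rewrite /y; lia.
  exact: nf.
rewrite nth_default ?size_map ?size_iota // => w; rewrite inE => /eqP ->.
by rewrite fv_one (zi_neq0 ch0) //= y0.
Qed.

Lemma factoredP n x e : lv one_pt (factored (factor_table n) x e) = zi x ^ int_of_Z e.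
Proof.
rewrite /factored; set y := Z.abs x; set l := nth _ _ _.
have el : lv one_pt l = zi y.
  rewrite /l /factor_table; case: (ltnP (Z.to_nat y) n) => hn.
    rewrite (nth_map 0%N) ?size_iota // nth_iota // add0n Z2Nat.id; last by rewrite /y; lia.
    exact: factorP.
  rewrite nth_default ?size_map ?size_iota //.
  by rewrite lv_cons lv_nil mulr1 fv_one.
have -> : forall s, lv one_pt ((if (x <? 0)%BZ then [:: (int_form (-1), e)] else [::]) ++ s) =
    (if (x <? 0)%BZ then (-1) ^ int_of_Z e else 1) * lv one_pt s.
  by move=> s; case: ifP => _; rewrite ?mul1r // lv_cons fv_one.
have -> : lv one_pt [seq (fe.1, (fe.2 * e)%BZ) | fe <- l] = zi y ^ int_of_Z e.
  rewrite -el /lv big_map (big_morph (fun u => u ^ int_of_Z e) (id1 := 1) (op1 := *%R)).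
  - by apply: eq_bigr => fe _ /=; rewrite exprz_exp -rmorphM.
  - by move=> u w; rewrite expfzMl.
  - by rewrite exp1rz.
rewrite /y; case: (Z.ltb_spec x 0) => h; last by rewrite mul1r Z.abs_eq.
by rewrite -expfzMl Z.abs_neq ?ziN ?mulN1r ?opprK //; lia.
Qed.

Definition peval (D : k) (p : seq Z) : k := foldr (fun x y => zi x + D * y) 0 p.

Lemma peval_mul D m p c : peval D (poly_mul m p c) = zi c + (D + zi m) * peval D p.
Proof.
elim: p c => [|x p IH] c /=; first by rewrite !mulr0.
by rewrite IH ziD ziM; ring.
Qed.

Lemma peval_add D p q : peval D (poly_add p q) = peval D p + peval D q.
Proof.
elim: p q => [|x p IH] [|y q] /=; rewrite ?addr0 ?add0r //.
by rewrite IH ziD; ring.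
Qed.

Lemma peval_zero D p : all (fun x => x =? 0)%BZ p -> peval D p = 0.
Proof.
by elim: p => [|x p IH] //= /andP [/Z.eqb_spec -> /IH ->]; rewrite zi0 mulr0 addr0.
Qed.

Lemma peval_expand D x : all (fun fe => 0 <=? fe.2)%BZ x.1 -> all (fun me => 0 <=? me.2)%BZ x.2 ->
  peval D (expand_term x) = lv one_pt x.1 * \prod_(me <- x.2) (D + zi me.1) ^ int_of_Z me.2.
Proof.
move=> h1 h2; rewrite /expand_term; set c := foldl _ _ x.1.
have ec : zi c = lv one_pt x.1.
  suff h a : zi (foldl (fun acc fe => acc * coord fe.1 2 ^ fe.2)%BZ a x.1) = zi a * lv one_pt x.1.
    by rewrite /c h zi1 mul1r.
  elim: (x.1) h1 a => [|fe s IH] /=; first by move=> _ a; rewrite lv_nil mulr1.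
  by case/andP => e0 /IH h a; rewrite h lv_cons ziM zi_pow // fv_one mulrA.
have : peval D [:: c] = lv one_pt x.1 by rewrite /= mulr0 addr0.
move: [:: c] (lv _ _) => p0 a; elim: (x.2) h2 p0 a => [|[m e] s IH] /=.
  by move=> _ p0 a ->; rewrite big_nil mulr1.
case/andP => e0 /IH h p0 a ep0; rewrite big_cons mulrA; apply: h.
rewrite (int_of_nonneg e0) /= -ep0; elim: (Z.to_nat e) => [|j IHj] /=; first by rewrite mulr1.
by rewrite peval_mul zi0 add0r IHj -!exprnP exprS mulrCA.
Qed.

Lemma nonzero_intsP s : nonzero_ints s -> nonvan one_pt s.
Proof.
by move=> /allP h fe /h /andP [_ h0]; rewrite fv_one (zi_neq0 ch0).
Qed.

Lemma num_checkP n (ts : seq term) r : num_check (factor_table n) ts r ->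
  forall D : k, sv (D, zi (coord r 0), zi (coord r 1), zi (coord r 2)) ts = 0.
Proof.
rewrite /num_check; set us := [seq t <- ts | _].
set ss := [seq (constant_part _ r t, _) | t <- us].
set d := collect _ _ _; set ss' := [seq (zcollect _, _) | x <- ss].
case/and4P => rD /allP hD /allP hf /and4P [/allP hq nd /allP pos zero] D.
set z := (_, _, _, _).
have fz f : fv z f = let: (a, _, _, _) := f in zi a * D + zi (fdot r f).
  case: r f {us ss d ss' hD hf hq nd pos zero} @z rD => [[[dr ar] br] cr] [[[df af] bf] cf] /=.
  move=> /negPn /Z.eqb_spec ->.
  by rewrite !ziD !ziM zi0 mul0r add0r; ring.
have -> : sv z ts = sv z us.
  rewrite /us /sv (bigID (vanishes_at r)) /= big_filter; apply/eqP.
  rewrite eq_sym -subr_eq0 opprD addrCA subrr addr0 oppr_eq0; apply/eqP.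
  apply: big1 => t /hasP [fe hfe /and3P [fD pos0 /Z.eqb_spec z0]].
  have f0 : fv z fe.1 = 0.
    by rewrite fz z0; case: (fe.1) fD => [[[a b] c] e] /negPn /Z.eqb_spec ->; rewrite zi0 mul0r addr0.
  rewrite /tv /lv (big_rem fe) // f0 exp0rz.
  case: (int_of_Z fe.2 =P 0) => [e|_]; last by rewrite mulr0z /= mul0r mulr0.
  by move: pos0; rewrite -[fe.2]int_of_ZK e.
have nraw t : t \in us -> nonvan one_pt
    (factored (factor_table n) (Qnum t.1) 1 ++ factored (factor_table n) (Zpos (Qden t.1)) (-1) ++
      flatten [seq factored (factor_table n) (fdot r fe.1) fe.2 | fe <- t.2 & ~~ isD fe.1]).
  move=> ht fe; rewrite mem_cat => /orP [h|].
    by apply: nonvan_factored h; apply: hq.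
  rewrite mem_cat => /orP [h|/flattenP [_ /mapP [fe' hfe' ->] h]].
    exact: nonvan_factored h.
  apply: nonvan_factored h; move: hfe'; rewrite mem_filter => /andP [fD hfe'].
  by have := allP (hf t ht) fe' hfe'; rewrite (negPf fD).
have nzd : lv one_pt d != 0.
  rewrite /lv prodf_seq_neq0; apply/allP => fe hfe /=.
  by rewrite expfz_neq0 //; apply: nonzero_intsP hfe.
apply: (mulIf nzd); rewrite mul0r -[RHS](peval_zero D zero) /sv big_distrl /=.
have et t : t \in us -> tv z t * lv one_pt d =
    peval D (expand_term (zcollect (constant_part (factor_table n) r t ++ d), Dpart r t)).
  move=> ht.
  have hss : (constant_part (factor_table n) r t, Dpart r t) \in ss by apply: (map_f (fun t => (_, _))).
  have hss' : (zcollect (constant_part (factor_table n) r t ++ d), Dpart r t) \in ss'.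
    exact: (map_f (fun x => (zcollect (x.1 ++ d), x.2)) hss).
  rewrite peval_expand /=; first last.
  - apply/allP => me /mapP [fe]; rewrite mem_filter => /andP [fD hfe] -> /=.
    have := allP (hD t ht) fe hfe; case: (fe.1) fD => [[[a b] c] e] /=.
    by move/negPf => -> /andP [].
  - exact: (pos _ hss').
  rewrite lv_collect; last first.
    move=> fe; rewrite mem_cat => /orP [h|]; last exact: nonzero_intsP.
    exact: (collect_nonvan (nraw t ht)).
  rewrite lv_cat [RHS]mulrAC; congr (_ * _).
  rewrite /constant_part lv_collect; last exact: nraw.
  have cD : \prod_(fe <- t.2 | isD fe.1) fv z fe.1 ^ int_of_Z fe.2 =
      \prod_(me <- Dpart r t) (D + zi me.1) ^ int_of_Z me.2.
    rewrite /Dpart big_map big_filter; rewrite [LHS]big_seq_cond [RHS]big_seq_cond; apply: eq_bigr => fe.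
    case/andP => hfe fD; have := allP (hD t ht) fe hfe; rewrite fz.
    case: (fe.1) fD => [[[a b] c] e] /= /negPf -> /andP [/Z.eqb_spec -> _].
    by rewrite zi1 mul1r.
  have cZ : \prod_(fe <- t.2 | ~~ isD fe.1) fv z fe.1 ^ int_of_Z fe.2 =
      lv one_pt (flatten [seq factored (factor_table n) (fdot r fe.1) fe.2 | fe <- t.2 & ~~ isD fe.1]).
    rewrite -big_filter; elim: [seq fe <- t.2 | _] (filter_all (fun fe => ~~ isD fe.1) t.2).
      by rewrite big_nil lv_nil.
    move=> fe s IH /andP [fD /IH e]; rewrite big_cons e fz /= lv_cat factoredP.
    case: (fe.1) fD => [[[a b] c] e'] /= /negPn /Z.eqb_spec ->.
    by rewrite zi0 mul0r add0r.
  rewrite /tv {1}/lv (bigID (fun fe => isD fe.1)) /= cD cZ lv_cat factoredP lv_cat factoredP qv.unlock.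
  have -> : zi (Zpos (Qden t.1)) ^ int_of_Z (-1)%BZ = (zi (Zpos (Qden t.1)))^-1 :> k by [].
  rewrite -[zi (Qnum t.1) ^ _]/(zi (Qnum t.1)).
  move: (_^-1) (zi _) (lv _ _) (\prod_(_ <- _) _) => *; ring.
have -> : \sum_(t <- us) tv z t * lv one_pt d = \sum_(x <- ss') peval D (expand_term x).
  by rewrite /ss' /ss !big_map; apply: eq_big_seq => t; apply: et.
elim: (ss') => [|x s IH] /=; first by rewrite big_nil.
by rewrite big_cons peval_add IH.
Qed.
End NumericCheckCorrect.

(** * Enumeration of solid partitions *)

Section Boxes.

(* The l-th layer of the entry at (i, j, k), all indices starting at 0. *)
Definition cell : Type := (box * nat)%type.
Definition ceq (x y : cell) : bool :=
  let: (i, j, k, l) := x in let: (i', j', k', l') := y in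
  [&& eqn i i', eqn j j', eqn k k' & eqn l l'].
Definition cmem (x : cell) (s : seq cell) : bool := has (ceq x) s.

Definition preds (x : cell) : seq cell :=
  let: (i, j, k, l) := x in
  [seq (i', j, k, l) | i' <- (if i is i'.+1 then [:: i'] else [::])] ++
  [seq (i, j', k, l) | j' <- (if j is j'.+1 then [:: j'] else [::])] ++
  [seq (i, j, k', l) | k' <- (if k is k'.+1 then [:: k'] else [::])] ++
  [seq (i, j, k, l') | l' <- (if l is l'.+1 then [:: l'] else [::])].
Definition succs (x : cell) : seq cell :=
  let: (i, j, k, l) := x in
  [:: (i.+1, j, k, l); (i, j.+1, k, l); (i, j, k.+1, l); (i, j, k, l.+1)].

Definition addable (s : seq cell) (x : cell) : bool :=
  ~~ cmem x s && all (fun y => cmem y s) (preds x).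
Definition candidates (s : seq cell) : seq cell :=
  foldr (fun x r => if cmem x r then r else x :: r) [::]
    ((0, 0, 0, 0)%N :: flatten [seq succs x | x <- s]).
Definition grow (s : seq cell) := [seq x :: s | x <- candidates s & addable s x].
Definition contained (s t : seq cell) := all (fun x => cmem x t) s.
(** One inclusion suffices to recognize equal diagrams: the lists compared have no repetition and
    the same length. *)
Fixpoint dedup (s : seq (seq cell)) :=
  if s is x :: s' then let r := dedup s' in if has (contained x) r then r else x :: r
  else [::].
Fixpoint parts (n : nat) : seq (seq cell) :=
  if n is m.+1 then dedup (flatten [seq grow s | s <- parts m]) else [:: [::]].

Lemma ceqE x y : ceq x y = (x == y).
Proof.
case: x y => [[[i j] k] l] [[[i' j'] k'] l']; rewrite -!pair_eqE /= /pair_eq /=.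
by rewrite -!pair_eqE /= /pair_eq /= -!pair_eqE /= -!eqnE -!andbA.
Qed.

Lemma cmemE x s : cmem x s = (x \in s).
Proof. by elim: s => //= y s IH; rewrite ceqE inE IH. Qed.

Definition closed (s : seq cell) := forall x y, x \in s -> y \in preds x -> y \in s.
Definition diagram n (s : seq cell) := [/\ uniq s, closed s & size s = n].
Definition height (x : cell) : nat := let: (i, j, k, l) := x in (i + j + k + l)%N.

Lemma height_preds x y : y \in preds x -> (height y < height x)%N.
Proof.
case: x => [[[i j] k] l]; rewrite !mem_cat => /or4P [] /mapP [m hm ->] /=; move: hm.
- by case: i => // i; rewrite inE => /eqP ->; lia.
- by case: j => // j; rewrite inE => /eqP ->; lia.
- by case: k => // k; rewrite inE => /eqP ->; lia.
- by case: l => // l; rewrite inE => /eqP ->; lia.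
Qed.

Lemma preds_succs x : x = (0, 0, 0, 0)%N \/ exists2 y, y \in preds x & x \in succs y.
Proof.
case: x => [[[[|i] j] k] l]; last first.
  by right; exists (i, j, k, l); rewrite !inE eqxx.
case: j => [|j]; last first.
  by right; exists (0%N, j, k, l); rewrite !inE eqxx ?orbT.
case: k => [|k]; last first.
  by right; exists (0%N, 0%N, k, l); rewrite !inE eqxx ?orbT.
case: l => [|l]; first by left.
by right; exists (0%N, 0%N, 0%N, l); rewrite !inE eqxx ?orbT.
Qed.

Lemma addableE s x : addable s x = (x \notin s) && all (mem s) (preds x).
Proof. by rewrite /addable cmemE; congr andb; apply: eq_all => y; rewrite cmemE. Qed.

Lemma mem_candidates s x : (x \in candidates s) =
  (x == (0, 0, 0, 0)%N) || has (fun y => x \in succs y) s.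
Proof.
rewrite /candidates; transitivity (x \in (0, 0, 0, 0)%N :: flatten [seq succs y | y <- s]).
  elim: (_ :: _) => //= y r IH; rewrite cmemE inE -IH; case: ifP => //.
  by case: eqP => [->|//] ->.
rewrite inE; congr orb; apply/flattenP/hasP => [[_ /mapP [y hy ->] h]|[y hy h]].
  by exists y.
by exists (succs y) => //; apply: map_f.
Qed.

Lemma diagram_cons n s x : diagram n s -> addable s x -> diagram n.+1 (x :: s).
Proof.
case=> us cs ss; rewrite addableE => /andP [xs /allP px]; split=> /=; rewrite ?xs ?ss //.
move=> y z; rewrite !inE => /orP [/eqP -> /px /= ->|ys zy]; first by rewrite orbT.
by rewrite (cs _ _ ys zy) orbT.
Qed.

Lemma containedE s t : contained s t = all (mem t) s.
Proof. by apply: eq_all => x; rewrite cmemE. Qed.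

Lemma mem_dedup (r : seq (seq cell)) x : x \in dedup r -> x \in r.
Proof.
elim: r => //= y r IH; case: ifP => _; rewrite !inE; first by move/IH ->; rewrite orbT.
by case/orP => [->|/IH ->] //; rewrite orbT.
Qed.

Lemma dedup_complete n (r : seq (seq cell)) s : (forall t, t \in r -> diagram n t) ->
  s \in r -> exists2 t, t \in dedup r & t =i s.
Proof.
elim: r => //= u r IH hr; rewrite inE.
have IH' : s \in r -> exists2 t, t \in dedup r & t =i s.
  by apply: IH => t ht; apply: hr; rewrite inE ht orbT.
case: ifP => [/hasP [t ht ct]|_] /orP [/eqP ->|/IH' [t' ht' e]].
- move: ct; rewrite containedE => /allP ut; exists t => //.
  have [uu _ su] := hr u (mem_head _ _).
  have [_ _ st] := hr t (mem_behead (s := u :: r) (mem_dedup ht)).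
  by have [|_] := uniq_min_size uu ut; [rewrite st su|move=> e x; rewrite e].
- by exists t'.
- by exists u; rewrite ?mem_head.
- by exists t' => //; rewrite inE ht' orbT.
Qed.

Lemma parts_diagram n s : s \in parts n -> diagram n s.
Proof.
elim: n s => [|n IH] s /=; first by rewrite inE => /eqP ->.
move/mem_dedup/flattenP => [_ /mapP [t ht ->] /mapP [x]].
by rewrite mem_filter => /andP [hx _] ->; apply: diagram_cons (IH _ ht) hx.
Qed.

Lemma dedup_pairwise r : pairwise (fun x y => ~~ contained x y) (dedup r).
Proof.
elim: r => //= x r IH; case: hasP => //= h; rewrite IH andbT; apply/allP => y hy.
by apply/negP => c; apply: h; exists y.
Qed.

(** A cell of maximal height precedes no other cell, so its removal leaves a smaller diagram, from
    which [grow] recovers the original one. *)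
Lemma parts_complete n s : diagram n s -> exists2 t, t \in parts n & t =i s.
Proof.
elim: n s => [|n IH] s [us cs ss]; first by exists [::] => //; case: s ss {us cs}.
have [x xs hx] : exists2 x, x \in s & forall y, y \in s -> (height y <= height x)%N.
  have [x0 x0s] : exists x, x \in s by case: (s) ss => // x ? _; exists x; rewrite mem_head.
  pose m := \max_(y <- s) height y.
  have hm y : y \in s -> (height y <= m)%N by move=> hy; apply: leq_bigmax_seq.
  suff [x xs e] : exists2 x, x \in s & height x = m by exists x; rewrite // e.
  have : has (fun x => height x == m) s.
    apply: contraT => /hasPn h; have : (m < m)%N; last by rewrite ltnn.
    have m0 : (0 < m)%N by have := h _ x0s; have := hm _ x0s; lia.
    rewrite -[X in (X < _)%N]/(\max_(y <- s) height y) -(prednK m0) ltnS.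
    by apply/bigmax_leqP_seq => y ys _; have := h _ ys; have := hm _ ys; lia.
  by case/hasP => x xs /eqP e; exists x.
have [|t ht et] := IH (rem x s).
  split; [exact: rem_uniq| |by rewrite size_rem // ss].
  move=> y z; rewrite !mem_rem_uniq // !inE => /andP [yx ys] zy.
  rewrite (cs _ _ ys zy) andbT; apply: contraTneq (height_preds zy) => ->.
  by rewrite -leqNgt hx.
have ext : x :: t =i s.
  move=> y; rewrite inE et mem_rem_uniq // inE.
  by case: eqVneq => [->|_]; rewrite ?xs.
have ax : addable t x.
  rewrite addableE et mem_rem_uniq // inE eqxx /=; apply/allP => y hy /=.
  rewrite et mem_rem_uniq // inE (cs _ _ xs hy) andbT.
  by apply: contraTneq (height_preds hy) => ->; rewrite ltnn.
have [||u hu eu] := @dedup_complete n.+1 (flatten [seq grow u | u <- parts n]) (x :: t).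
- move=> u /flattenP [_ /mapP [v hv ->] /mapP [y]].
  by rewrite mem_filter => /andP [hy _] ->; apply: diagram_cons (parts_diagram hv) hy.
- apply/flattenP; exists (grow t); first exact: map_f.
  apply: map_f; rewrite mem_filter ax mem_candidates.
  case: (preds_succs x) => [->|[y hy xy]]; first by rewrite eqxx.
  apply/orP; right; apply/hasP; exists y => //.
  by move: ax; rewrite addableE => /andP [_ /allP /(_ y hy)].
by exists u => // y; rewrite eu ext.
Qed.

Definition cells (p : array) : seq cell := [seq (b, l) | b <- finsupp p, l <- iota 0 (p b)].

Lemma mem_cells p x : (x \in cells p) = (x.2 < p x.1)%N.
Proof.
case: x => b l; apply/allpairsPdep/idP => [[b' [l' [hb hl [-> ->]]]]|/= h].
  by move: hl; rewrite mem_iota.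
exists b, l; rewrite mem_iota; split=> //; rewrite mem_finsupp; lia.
Qed.

Lemma cells_uniq p : uniq (cells p).
Proof.
apply: allpairs_uniq_dep; first exact: fset_uniq.
  by move=> b _; apply: iota_uniq.
by move=> [b l] [b' l'] _ _ /= [-> ->].
Qed.

Lemma size_cells p : size (cells p) = sp_size p.
Proof.
rewrite size_allpairs_dep /sp_size sumnE big_map; apply: eq_bigr => b _.
exact: size_iota.
Qed.

Definition array_of (s : seq cell) : array :=
  [fsfun b in [fset x.1 | x in s]%fset => count (fun x => x.1 == b) s | 0%N].

Lemma array_ofE s b : array_of s b = count (fun x => x.1 == b) s.
Proof.
rewrite fsfunE; case: ifP => // /negP h; apply/esym/eqP; rewrite -leqn0 leqNgt -has_count.
apply/negP => /hasP [x xs /eqP e]; apply: h; apply/imfsetP; exists x => //.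
Qed.

Lemma mem_preds_layer b l : (b, l) \in preds (b, l.+1).
Proof. by case: b => [[i j] k]; rewrite !mem_cat /= !inE eqxx !orbT. Qed.

(** By closedness the layers present above a box form an initial segment of the integers, so their
    number determines them. *)
Lemma mem_array_of n s x : diagram n s -> (x.2 < array_of s x.1)%N = (x \in s).
Proof.
case: x => b l [us cs _] /=; rewrite array_ofE.
pose r := [seq x.2 | x <- s & x.1 == b].
have mr m : (m \in r) = ((b, m) \in s).
  apply/mapP/idP => [[x]|h]; last by exists (b, m); rewrite // mem_filter eqxx.
  by rewrite mem_filter => /andP [/eqP <- xs] ->; rewrite -surjective_pairing.
have ur : uniq r.
  rewrite map_inj_in_uniq ?filter_uniq // => -[? ?] [? ?].
  by rewrite !mem_filter /= => /andP [/eqP -> _] /andP [/eqP -> _] ->.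
have cr m m' : (m' <= m)%N -> m \in r -> m' \in r.
  move/subnK => <-; elim: (m - m')%N => // e IH; rewrite addSn mr => h; apply: IH.
  by rewrite mr; apply: cs h (mem_preds_layer _ _).
have -> : count (fun x => x.1 == b) s = size r by rewrite size_map size_filter.
rewrite -mr; apply/idP/idP => [h|h].
  apply: contraLR h => h; rewrite -leqNgt -(size_iota 0 l); apply: uniq_leq_size => // m hm.
  by rewrite mem_iota /= add0n ltnNge; apply: contra h => /cr; apply.
rewrite -(size_iota 0 l.+1); apply: uniq_leq_size; first exact: iota_uniq.
by move=> m; rewrite mem_iota add0n ltnS /= => hm; apply: cr h.
Qed.

Lemma perm_cells n s : diagram n s -> perm_eq (cells (array_of s)) s.
Proof.
move=> h; have [us _ _] := h; apply: uniq_perm => //; first exact: cells_uniq.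
by move=> x; rewrite mem_cells (mem_array_of _ h).
Qed.

Lemma solid_array_of n s : diagram n s -> is_solid_partition (array_of s).
Proof.
move=> h i j k; have [_ cs _] := h.
have le b b' : (forall l, (b, l) \in preds (b', l)) -> (array_of s b' <= array_of s b)%N.
  move=> hb; rewrite leqNgt; apply/negP; set m := array_of s b => hm.
  have := cs _ _ _ (hb m); rewrite -!(mem_array_of _ h) /= -/m hm ltnn.
  by move/(_ isT).
by split; apply: le => l; rewrite !mem_cat /= !inE eqxx ?orbT.
Qed.

Lemma closed_cells p : is_solid_partition p -> closed (cells p).
Proof.
move=> sp [[[i j] k] l] y; rewrite mem_cells /= => h hy; rewrite mem_cells; move: hy.
rewrite !mem_cat => /or4P [] /mapP [m hm ->] /=; move: hm h.
- by case: i => // i; rewrite inE => /eqP -> h; apply: leq_trans h _; case: (sp i j k).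
- by case: j => // j; rewrite inE => /eqP -> h; apply: leq_trans h _; case: (sp i j k).
- by case: k => // k; rewrite inE => /eqP -> h; apply: leq_trans h _; case: (sp i j k).
- by case: l => // l; rewrite inE => /eqP -> h; apply: leq_trans h.
Qed.

Lemma array_of_eqi n s t : diagram n s -> diagram n t -> array_of s = array_of t -> s =i t.
Proof.
by move=> ds dt e x; rewrite -(mem_array_of _ ds) e (mem_array_of _ dt).
Qed.

Lemma solid_partitionsE n : perm_eq (solid_partitions n) [seq array_of s | s <- parts n].
Proof.
apply: uniq_perm; first exact: solid_partitions_uniq.
  case: n => [//|n]; rewrite uniq_pairwise pairwise_map.
  apply: (sub_in_pairwise (P := mem (parts n.+1)) _ _ (dedup_pairwise _)); last exact/allP.
  move=> s t hs ht; apply: contra => /eqP /= e; rewrite containedE; apply/allP => x.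
  have ds := @parts_diagram n.+1 s hs; have dt := @parts_diagram n.+1 t ht.
  by rewrite (array_of_eqi ds dt e).
move=> p; apply/mem_solid_partitions/mapP => [[sp sz]|[s hs ->]]; last first.
  have ds := parts_diagram hs; split; first exact: solid_array_of ds.
  by rewrite -size_cells (perm_size (perm_cells ds)); case: ds.
have dp : diagram n (cells p).
  by split; [exact: cells_uniq|exact: closed_cells|rewrite size_cells].
have [t ht et] := parts_complete dp; exists t => //.
apply/fsfunP => b; have dt := parts_diagram ht.
have eb l : (l < p b)%N = (l < array_of t b)%N.
  by have := mem_array_of (b, l) dt; rewrite et mem_cells.
by move: (eb (p b)) (eb (array_of t b)); rewrite !ltnn; case: (ltngtP (p b) (array_of t b)).
Qed.

End Boxes.

(** * The terms of the partition series *)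

Section PartitionTerms.
Local Open Scope Z_scope.

(* Exponents modulo (1, 1, 1, 1), so that the last coordinate is normalized to zero. *)
Definition cell_form (d : Z) (x : cell) : form :=
  let: (i, j, k, l) := x in
  let l := Z.of_nat l in (d, Z.of_nat i - l, Z.of_nat j - l, Z.of_nat k - l).
(* The monomials of (1 - 1/t_1) (1 - 1/t_2) (1 - 1/t_3), inverted. *)
Definition half_shifts : seq (form * Z) :=
  [:: ((0, 0, 0, 0), 1); ((0, 1, 0, 0), -1); ((0, 0, 1, 0), -1); ((0, 0, 0, 1), -1);
      ((0, 1, 1, 0), 1); ((0, 1, 0, 1), 1); ((0, 0, 1, 1), 1); ((0, 1, 1, 1), -1)].
(* The factors of e_T(-v). *)
Definition half (s : seq cell) : seq (form * Z) :=
  let cs := [seq cell_form 0 x | x <- s] in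
  let ds := zcollect [seq (fsub y x, 1) | x <- cs, y <- cs] in
  zcollect ([seq (x, -1) | x <- cs] ++
            [seq (fsub p.1 h.1, p.2 * h.2) | p <- ds, h <- half_shifts]).
Definition twisted (x : cell) : bool :=
  let: (i, j, k, l) := x in [&& eqn i j, eqn j k & (i < l)%N].
Definition negative (s : seq cell) : bool :=
  foldr (fun x b => xorb b (twisted x)) (odd (size s)) s.
Definition term_of (s : seq cell) : term :=
  let: (c, l) := tnorm (inject_Z (if negative s then -1 else 1), half s) in
  (c, sort (@kle Z) [seq (cell_form 1 x, 1) | x <- s] ++ zcollect l).
Definition terms (n : nat) : seq term := [seq term_of s | s <- parts n].

(* Coefficients of q^n in M(-q)^a, as polynomials in a without constant term. *)
Definition macmahon_powers (n : nat) : seq Q :=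
  match n with
  | 1%N => [:: (-1#1)]
  | 2%N => [:: (5#2); (1#2)]
  | 3%N => [:: (-10#3); (-5#2); (-1#6)]
  | 4%N => [:: (21#4); (155#24); (5#4); (1#24)]
  | 5%N => [:: (-26#5); (-163#12); (-115#24); (-5#12); (-1#120)]
  | 6%N => [:: (25#3); (8597#360); (217#16); (305#144); (5#48); (1#720)]
  | _ => [::]
  end.
(* Minus c a^j, where a is the exponent of M(-q). *)
Definition exponent_power (j : nat) (c : Q) : term :=
  let e := Z.of_nat j in
  ((if odd j then c else qmul (-1#1) c),
   [:: ((1,0,0,0), e); ((0,0,0,1), -e); ((0,0,1,0), -e); ((0,0,1,1), e); ((0,1,0,0), -e);
       ((0,1,0,1), e); ((0,1,1,0), e); ((0,1,1,1), -e)]).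
Definition rhs_terms (n : nat) : seq term :=
  let ks := macmahon_powers n in [seq exponent_power jc.1 jc.2 | jc <- zip (iota 1 (size ks)) ks].

Definition plane_form : form := (0, 12, -35, -30).
(* The first 4 n - 2 points and the three planes lambda_a + lambda_b = 0 give 4 n + 1 zeros. *)
Definition plane_points : seq form :=
  [:: (0,5,-6,9); (0,15,6,-1); (0,5,-12,16); (0,10,-6,11); (0,15,12,-8); (0,5,18,-19); (0,20,6,1);
      (0,5,24,-26); (0,15,-12,20); (0,20,18,-13); (0,5,-24,30); (0,15,-6,13); (0,10,18,-17);
      (0,5,30,-33); (0,10,-18,25); (0,20,-6,15); (0,15,24,-22); (0,5,36,-40); (0,35,24,-14);
      (0,5,-30,37); (0,25,-6,17); (0,10,42,-45); (0,15,-24,34); (0,45,6,11)].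
(** A direction inside H, as 12 * 105 - 35 * 1026 + 30 * 1155 = 0. Apart from this, this direction
    and the two forms below only have to pass [line_check]. *)
Definition plane_direction : form := (0, 105, 1026, -1155).
Definition other_plane : form := (0, 1009, 20011, -301).
Definition direction : form := (0, 10007, -1013, 107).

(** The trivial weight cancels in v. It will follow that c_0 = 0, so that none of the weights
    concerned is zero. *)
Definition zero_free (s : seq cell) : bool :=
  all (fun fe => ~~ feq fe.1 (0, 0, 0, 0)) (half s).

Definition vanishing_check (n : nat) : bool :=
  let ps := parts n in let ts := [seq term_of s | s <- ps] ++ rhs_terms n in
  let rs := take (4 * n - 2) plane_points in let tab := factor_table 512 in
  [&& all zero_free ps, all (pole_check ts) (poles ts), den_check n ts,
      plane_check n ts plane_form plane_direction rs,
      orbit_check n ts plane_form other_plane direction & all (num_check tab ts) rs].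
End PartitionTerms.

(** * Square roots of the equivariant weights *)

Section FreeSums.
Implicit Types (s t : seq (int * weight)) (u v : weight).

(** For G additive in the coefficient, repeated entries of the list may be counted separately.
    Laurent polynomials can thus be handled as plain lists, without ever collecting equal
    exponents. *)
Lemma big_dom (M : Type) (idx : M) (op : Monoid.com_law idx) (G : weight -> int -> M) s :
  (forall u, G u 0 = idx) -> (forall u a b, G u (a + b) = op (G u a) (G u b)) ->
  \big[op/idx]_(u <- dom [freeg s]) G u (coeff u [freeg s]) = \big[op/idx]_(x <- s) G x.2 x.1.
Proof.
move=> G0 GD; set U := undup [seq x.2 | x <- s].
transitivity (\big[op/idx]_(u <- U) G u (coeff u [freeg s])).
  rewrite [RHS](bigID (fun u => u \in dom [freeg s])) /=.
  rewrite [X in op _ X]big1 ?Monoid.mulm1; last by move=> u /coeff_outdom ->.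
  rewrite -[RHS]big_filter; apply: perm_big; apply: uniq_perm; first exact: uniq_dom.
    by rewrite filter_uniq ?undup_uniq.
  move=> u; rewrite mem_filter mem_undup; case: (boolP (u \in dom _)) => //= hu.
  by apply/esym; apply: contraTT hu => h; rewrite mem_dom coeff_Freeg precoeff_outdom ?eqxx.
have eG u : G u (coeff u [freeg s]) = \big[op/idx]_(x <- s | x.2 == u) G u x.1.
  rewrite coeff_Freeg /precoeff; elim: (s) => [|x r IH]; first by rewrite !big_nil.
  by rewrite !big_cons; case: ifP => _; rewrite ?GD IH.
under eq_bigr do rewrite eG.
rewrite (exchange_big_dep predT) //=.
rewrite big_seq [RHS]big_seq; apply: eq_bigr => x xs.
rewrite (eq_bigr (fun _ => G x.2 x.1)) => [|u /eqP -> //].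
rewrite -big_filter (perm_big [:: x.2]) ?big_seq1 //.
apply: uniq_perm; rewrite ?filter_uniq ?undup_uniq // => u.
by rewrite mem_filter inE eq_sym mem_undup andb_idr // => /eqP ->; apply: map_f.
Qed.

Lemma freeg_sum s : \sum_(x <- s) << x.1 *g x.2 >> = [freeg s] :> laurent.
Proof.
elim: s => [|[a u] s IH]; first by rewrite big_nil freeg_nil.
by rewrite big_cons IH -[(a, u) :: s]cat1s freeg_cat.
Qed.

Lemma dom_map (h : weight -> weight) s :
  \sum_(u <- dom ([freeg s] : laurent)) << coeff u ([freeg s] : laurent) *g h u >> =
  [freeg [seq (x.1, h x.2) | x <- s]] :> laurent.
Proof.
rewrite (big_dom (G := fun u a => << a *g h u >> : laurent)).
- by rewrite -freeg_sum big_map.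
- by move=> u; apply: freegU0.
- by move=> u a b; rewrite -freegUD.
Qed.

Lemma lbar_freeg s : lbar [freeg s] = [freeg [seq (x.1, - x.2) | x <- s]].
Proof. exact: dom_map. Qed.

Lemma cy_specialize_freeg s :
  cy_specialize [freeg s] = [freeg [seq (x.1, wclass x.2) | x <- s]].
Proof. exact: dom_map. Qed.

Definition smul s t := [seq (x.1 * y.1, x.2 + y.2) | x <- s, y <- t].

Lemma lmul_freeg s t : lmul [freeg s] [freeg t] = [freeg (smul s t)].
Proof.
have inner a u : \sum_(v <- dom ([freeg t] : laurent))
    << a * coeff v ([freeg t] : laurent) *g u + v >> =
    \sum_(y <- t) << a * y.1 *g u + y.2 >> :> laurent.
  rewrite (big_dom (G := fun v b => << a * b *g u + v >> : laurent)) //.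
  - by move=> v; rewrite mulr0 freegU0.
  - by move=> v b c; rewrite mulrDr -freegUD.
rewrite /lmul; under eq_bigr do rewrite inner.
rewrite (big_dom (G := fun u a => \sum_(y <- t) << a * y.1 *g u + y.2 >> : laurent)).
- by rewrite -freeg_sum big_allpairs_dep.
- by move=> u; apply: big1 => y _; rewrite mul0r freegU0.
- by move=> u a b; rewrite -big_split; apply: eq_bigr => y _; rewrite mulrDl -freegUD.
Qed.

Lemma oppr_freeg s : - ([freeg s] : laurent) = [freeg [seq (- x.1, x.2) | x <- s]].
Proof.
rewrite -!freeg_sum big_map -sumrN; apply: eq_bigr => x _; exact: freegUN.
Qed.

Lemma lmono_freeg u : lmono u = [freeg [:: (1, u)]].
Proof. by []. Qed.

Definition cell_weight (x : cell) : weight := box_weight x.1 x.2.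
Definition zlist (s : seq cell) := [seq (1 : int, cell_weight x) | x <- s].

Lemma Zpart_freeg p : Zpart p = [freeg zlist (cells p)].
Proof.
rewrite -freeg_sum big_map /cells big_allpairs_dep /Zpart; apply: eq_bigr => b _.
by rewrite -[in RHS](subn0 (p b)) -/(index_iota 0 (p b)) big_mkord.
Qed.

Lemma one_minus_t_freeg a : one_minus_t a = [freeg [:: (1, 0); (-1, delta_mx 0 a)]].
Proof. by rewrite /one_minus_t !lmono_freeg oppr_freeg -freeg_cat. Qed.

Definition tfactor (a : 'I_4) : seq (int * weight) := [:: (1, 0); (-1, delta_mx 0 a)].
Definition ord4 (i : nat) : 'I_4 := inord i.
Definition corner : seq (int * weight) :=
  smul (tfactor (ord4 0)) (smul (tfactor (ord4 1))
    (smul (tfactor (ord4 2)) (smul (tfactor (ord4 3)) [:: (1, 0)]))).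

Definition vlist (s : seq cell) : seq (int * weight) :=
  let z := zlist s in
  z ++ smul [seq (x.1, - x.2) | x <- z] [:: (1, - all_ones)] ++
  [seq (- x.1, x.2) | x <- smul (smul (smul z [seq (x.1, - x.2) | x <- z]) corner)
                                [:: (1, - all_ones)]].

Lemma Vpart_freeg p : Vpart p = [freeg (vlist (cells p))].
Proof.
rewrite /Vpart /vlist; set z := zlist _.
have -> : \big[lmul/lmono 0]_(a < 4) one_minus_t a = [freeg corner].
  rewrite !big_ord_recl big_ord0 !one_minus_t_freeg lmono_freeg !lmul_freeg; congr [freeg _].
  by rewrite /corner /tfactor; do !congr smul; do !congr cons; congr pair; congr delta_mx;
    apply/val_inj; rewrite /= inordK.
rewrite Zpart_freeg -/z lbar_freeg !lmono_freeg !lmul_freeg oppr_freeg.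
by rewrite -freeg_cat -freeg_cat catA.
Qed.

End FreeSums.

Section WeightForms.

Definition fadd (f g : form) : form :=
  let: (d, a, b, c) := f in let: (d', a', b', c') := g in
  (d + d', a + a', b + b', c + c')%BZ.
Definition fopp (f : form) : form :=
  let: (d, a, b, c) := f in (- d, - a, - b, - c)%BZ.

(** Eliminating lambda_4 = - (lambda_1 + lambda_2 + lambda_3) leaves u_i - u_4 as the coefficient of
    lambda_i. *)
Definition wcoord (u : weight) (i : nat) : Z := Z_of_int (u 0 (ord4 i) - u 0 (ord4 3)).
Definition wform (u : weight) : form := (0%BZ, wcoord u 0, wcoord u 1, wcoord u 2).

Lemma wformD u v : wform (u + v) = fadd (wform u) (wform v).
Proof.
have h i : wcoord (u + v) i = (wcoord u i + wcoord v i)%BZ.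
  by rewrite /wcoord !mxE opprD addrACA rmorphD.
by rewrite /wform !h.
Qed.

Lemma wformN u : wform (- u) = fopp (wform u).
Proof.
have h i : wcoord (- u) i = (- wcoord u i)%BZ.
  by rewrite /wcoord !mxE -opprD rmorphN.
by rewrite /wform !h.
Qed.

Lemma wform0 : wform 0 = (0, 0, 0, 0)%BZ.
Proof. by rewrite /wform /wcoord !mxE subrr. Qed.

Lemma wform_ones : wform all_ones = (0, 0, 0, 0)%BZ.
Proof. by rewrite /wform /wcoord !mxE subrr. Qed.

Lemma wform_class u : wform (wclass u) = wform u.
Proof.
have h i : wcoord (wclass u) i = wcoord u i.
  by rewrite /wcoord !mxE; congr Z_of_int; rewrite opprB addrA subrK.
by rewrite /wform !h.
Qed.

Lemma wform_delta i : (i < 4)%N -> wform (delta_mx 0 (ord4 i)) =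
  nth (0, 0, 0, 0)%BZ [:: (0, 1, 0, 0); (0, 0, 1, 0); (0, 0, 0, 1); (0, -1, -1, -1)]%BZ i.
Proof.
rewrite /wform /wcoord !mxE /= /ord4 -!(inj_eq val_inj) /=.
by case: i => [|[|[|[|i]]]] //; rewrite !inordK.
Qed.

Lemma wform_cell x : wform (cell_weight x) = cell_form 0 x.
Proof.
case: x => [[[i j] k] l]; rewrite /wform /wcoord !mxE /= !inordK //=.
by rewrite !rmorphB /= /Z_of_int; congr (_, _, _, _); lia.
Qed.

Definition wforms (s : seq (int * weight)) : seq (form * Z) :=
  [seq (wform x.2, Z_of_int x.1) | x <- s].
Definition fmul (s t : seq (form * Z)) : seq (form * Z) :=
  [seq (fadd x.1 y.1, (x.2 * y.2)%BZ) | x <- s, y <- t].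

Lemma wforms_smul s t : wforms (smul s t) = fmul (wforms s) (wforms t).
Proof.
rewrite /wforms /smul /fmul map_allpairs allpairs_mapl allpairs_mapr.
by apply: eq_allpairs => x y; rewrite wformD rmorphM.
Qed.

Definition corner_forms : seq (form * Z) :=
  let t f := [:: ((0, 0, 0, 0), 1); (f, -1)]%BZ in
  fmul (t (0, 1, 0, 0)%BZ) (fmul (t (0, 0, 1, 0)%BZ) (fmul (t (0, 0, 0, 1)%BZ)
    (fmul (t (0, -1, -1, -1)%BZ) [:: ((0, 0, 0, 0), 1)]%BZ))).

Lemma wforms_corner : wforms corner = corner_forms.
Proof.
by rewrite /corner !wforms_smul /wforms /tfactor /= !wform_delta // !wform0.
Qed.

End WeightForms.

(** * The splitting of the vertex V into v and its conjugate *)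

Section HalfVertex.
Variable k : fieldType.
Implicit Types (V : form -> k) (s t : seq cell).

Lemma fprod_cat V (s t : seq (form * Z)) : fprod V (s ++ t) = fprod V s * fprod V t.
Proof. exact: big_cat. Qed.

Definition ones (s : seq form) : seq (form * Z) := [seq (f, 1%BZ) | f <- s].
Lemma fprod_ones V (s : seq form) : fprod V (ones s) = \prod_(f <- s) V f.
Proof. by rewrite /fprod big_map; apply: eq_bigr => f _; rewrite expr1z. Qed.

Lemma fprod_half V s : (forall f, V f != 0) -> let cs := [seq cell_form 0 x | x <- s] in
  fprod V (half s) = \prod_(x <- cs) (V x)^-1 *
    \prod_(x <- cs) \prod_(y <- cs) \prod_(h <- half_shifts)
      V (fsub (fsub y x) h.1) ^ int_of_Z h.2.
Proof.
move=> V0 cs; rewrite /half -/cs fprod_collect // fprod_cat; congr (_ * _).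
  by rewrite /fprod big_map.
pose V' f := \prod_(h <- half_shifts) V (fsub f h.1) ^ int_of_Z h.2.
set ds := zcollect _; transitivity (fprod V' ds).
  rewrite /fprod big_allpairs_dep; apply: eq_bigr => p _ /=; rewrite /V'.
  rewrite (big_morph (fun u => u ^ int_of_Z p.2) (id1 := 1) (op1 := *%R)).
  - by apply: eq_bigr => h _; rewrite exprz_exp mulrC -rmorphM.
  - by move=> u w; rewrite expfzMl.
  - by rewrite exp1rz.
rewrite fprod_collect => [|fe _]; last first.
  by rewrite prodf_seq_neq0; apply/allP => h _; rewrite expfz_neq0.
by rewrite /fprod big_allpairs_dep; apply: eq_bigr => x _; apply: eq_bigr => y _; rewrite expr1z.
Qed.

Lemma fadd0 f : fadd f (0, 0, 0, 0)%BZ = f.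
Proof. by case: f => [[[d a] b] c] /=; rewrite !Z.add_0_r. Qed.

Lemma fprod_fmul V (s t : seq (form * Z)) : fprod V (fmul s t) =
  \prod_(x <- s) \prod_(y <- t) V (fadd x.1 y.1) ^ int_of_Z (x.2 * y.2).
Proof. by rewrite /fprod big_allpairs_dep. Qed.

Lemma fprod_fmul1 V (s : seq (form * Z)) : fprod V (fmul s [:: ((0, 0, 0, 0), 1)]%BZ) = fprod V s.
Proof.
by rewrite fprod_fmul; apply: eq_bigr => x _; rewrite big_seq1 fadd0 Z.mul_1_r.
Qed.

(** Put A = (1 - t_1) (1 - t_2) (1 - t_3), whose monomials are [half_shifts]. Since t_4 is the
    inverse of t_1 t_2 t_3, bar A = - t_4 A, so A (1 - t_4) = A + bar A. The lemma is the
    multiplicative form of this identity. *)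
Lemma corner_split (x y : form) : isD x = false -> isD y = false -> forall V,
  \prod_(c <- corner_forms) V (fadd (fadd x (fopp y)) c.1) ^ int_of_Z c.2 =
  (\prod_(h <- half_shifts) V (fsub (fsub x y) h.1) ^ int_of_Z h.2) *
  (\prod_(h <- half_shifts) V (fopp (fsub (fsub y x) h.1)) ^ int_of_Z h.2).
Proof.
move=> xD yD V.
rewrite (perm_big ([seq (fopp h.1, h.2) | h <- half_shifts] ++ half_shifts)); last by vm_compute.
rewrite big_cat big_map /=; congr (_ * _); apply: eq_bigr => -[h e] _ /=.
  case: x y h xD yD => [[[d a] b] c] [[[d' a'] b'] c'] [[[d2 a2] b2] c2] /= _ _.
  by congr (V (_, _, _, _) ^ _); lia.
case: x y h xD yD => [[[d a] b] c] [[[d' a'] b'] c'] [[[d2 a2] b2] c2] /= _ _.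
by congr (V (_, _, _, _) ^ _); lia.
Qed.

(* V = v + bar v up to the relation t_1 t_2 t_3 t_4 = 1. *)
Lemma vlist_half V s t : (forall f, V f != 0) -> perm_eq t s ->
  fprod V (wforms (vlist t)) * fprod V (half s) * fprod (fun f => V (fopp f)) (half s) = 1.
Proof.
move=> V0 pts; rewrite !fprod_half //.
set cs := [seq cell_form 0 x | x <- s]; set ct := [seq cell_form 0 x | x <- t].
have pc : perm_eq ct cs by apply: perm_map.
have csD f : f \in cs -> isD f = false by case/mapP => [[[[i j] l] m]] _ ->.
have ez : wforms (zlist t) = ones ct.
  by rewrite /wforms /zlist /ones -!map_comp; apply: eq_map => x /=; rewrite wform_cell.
have ezN : wforms [seq (x.1, - x.2) | x <- zlist t] = ones [seq fopp f | f <- ct].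
  rewrite /wforms /zlist /ones -!map_comp; apply: eq_map => x /=.
  by rewrite wformN wform_cell.
have e1 : wforms [:: (1, - all_ones)] = [:: ((0, 0, 0, 0), 1)]%BZ.
  by rewrite /wforms /= wformN wform_ones.
have eV : fprod V (wforms (vlist t)) = \prod_(x <- cs) V x * \prod_(x <- cs) V (fopp x) *
    (\prod_(x <- cs) \prod_(y <- cs) \prod_(c <- corner_forms)
      V (fadd (fadd x (fopp y)) c.1) ^ int_of_Z c.2)^-1.
  rewrite /vlist /wforms !map_cat -!/(wforms _) !fprod_cat mulrA.
  rewrite wforms_smul ezN e1 fprod_fmul1 ez !fprod_ones big_map; congr (_ * _ * _).
  - exact: perm_big.
  - exact: perm_big.
  rewrite /wforms -map_comp.
  have -> : [seq ((fun x : int * weight => (wform x.2, Z_of_int x.1)) \o (fun x => (- x.1, x.2))) x |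
      x <- smul (smul (smul (zlist t) [seq (x.1, - x.2) | x <- zlist t]) corner) [:: (1, - all_ones)]] =
      [seq (fe.1, (- fe.2)%BZ) | fe <- wforms (smul (smul (smul (zlist t)
        [seq (x.1, - x.2) | x <- zlist t]) corner) [:: (1, - all_ones)])].
    by rewrite /wforms -!map_comp; apply: eq_map => x /=; rewrite rmorphN.
  rewrite 3!wforms_smul wforms_corner ez ezN e1 /fprod big_map.
  rewrite -prodfV -[RHS](perm_big _ pc).
  transitivity ((fprod V (fmul (fmul (fmul (ones ct) (ones [seq fopp f | f <- ct])) corner_forms)
     [:: ((0, 0, 0, 0), 1)]%BZ))^-1).
    by rewrite /fprod -prodfV; apply: eq_bigr => fe _; rewrite rmorphN invr_expz.
  rewrite fprod_fmul1 fprod_fmul big_allpairs_dep big_map -prodfV; apply: eq_bigr => x _.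
  rewrite big_map big_map; congr (_^-1); rewrite (perm_big _ pc); apply: eq_bigr => y _.
  by apply: eq_bigr => c _; rewrite !Z.mul_1_l.
rewrite eV !prodfV.
have -> : \prod_(x <- cs) \prod_(y <- cs) \prod_(c <- corner_forms)
      V (fadd (fadd x (fopp y)) c.1) ^ int_of_Z c.2 =
    (\prod_(x <- cs) \prod_(y <- cs) \prod_(h <- half_shifts)
      V (fsub (fsub y x) h.1) ^ int_of_Z h.2) *
    (\prod_(x <- cs) \prod_(y <- cs) \prod_(h <- half_shifts)
      V (fopp (fsub (fsub y x) h.1)) ^ int_of_Z h.2).
  rewrite [X in _ = X * _]exchange_big -big_split big_seq [RHS]big_seq.
  apply: eq_bigr => x /csD xD; rewrite -big_split big_seq [RHS]big_seq.
  by apply: eq_bigr => y /csD yD; apply: corner_split.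
have nz (I : eqType) (r : seq I) (F : I -> k) : (forall i, F i != 0) -> \prod_(i <- r) F i != 0.
  by move=> h; rewrite prodf_seq_neq0; apply/allP => i _; apply: h.
have a0 : \prod_(x <- cs) V x != 0 by apply: nz.
have b0 : \prod_(x <- cs) V (fopp x) != 0 by apply: nz.
have c0 : \prod_(x <- cs) \prod_(y <- cs) \prod_(h <- half_shifts)
      V (fsub (fsub y x) h.1) ^ int_of_Z h.2 != 0.
  by do 3!(apply: (nz _) => ?); rewrite expfz_neq0.
have d0 : \prod_(x <- cs) \prod_(y <- cs) \prod_(h <- half_shifts)
      V (fopp (fsub (fsub y x) h.1)) ^ int_of_Z h.2 != 0.
  by do 3!(apply: (nz _) => ?); rewrite expfz_neq0.
move: (\prod_(x <- cs) V x) (\prod_(x <- cs) V (fopp x))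
  (\prod_(x <- cs) \prod_(y <- cs) \prod_(h <- half_shifts) V (fsub (fsub y x) h.1) ^ int_of_Z h.2)
  (\prod_(x <- cs) \prod_(y <- cs) \prod_(h <- half_shifts)
      V (fopp (fsub (fsub y x) h.1)) ^ int_of_Z h.2) a0 b0 c0 d0 => a b c d a0 b0 c0 d0.
by field; rewrite a0 b0 c0 d0.
Qed.

Lemma fprod_wforms V (s : seq (int * weight)) :
  fprod V (wforms s) = \prod_(x <- s) V (wform x.2) ^ x.1.
Proof. by rewrite /fprod big_map; apply: eq_bigr => x _; rewrite Z_of_intK. Qed.

(** A pair of boxes contributes eight odd exponents, hence no sign, and a single box contributes
    one. Therefore e_T(- bar v) = (-1)^|pi| e_T(- v), the source of the sign in the definition of
    the weights. *)
Lemma fprod_sign s : fprod (fun _ => -1 : k) (half s) = (-1) ^+ size s.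
Proof.
rewrite fprod_half; last by move=> f; rewrite oppr_eq0 oner_neq0.
have -> : \prod_(h <- half_shifts) (-1 : k) ^ int_of_Z h.2 = 1.
  have p : (-1 : k) ^ int_of_Z 1 = -1 by [].
  have m : (-1 : k) ^ int_of_Z (-1) = -1 by rewrite -[RHS]invrN1.
  by rewrite !big_cons big_nil !(p, m) !mulN1r !opprK.
rewrite [X in _ * X]big1 ?mulr1 => [|x _]; last by rewrite big1.
by rewrite invrN1 big_const_seq count_predT size_map iter_mulr_1.
Qed.

End HalfVertex.

Section Weights.

Lemma char0_num (R : numDomainType) : char0 R.
Proof. by move=> x /eqP; rewrite /zi intr_eq0 => /eqP e; rewrite -(int_of_ZK x) e. Qed.

Lemma char0_embedding (A : pzRingType) (E : pzRingType) (io : embedding A E) : char0 A -> char0 E.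
Proof.
by move=> hA x; rewrite -(zi_rmorph io) -(rmorph0 io) => /(@emb_inj _ _ io) /hA.
Qed.

Definition frac_embedding (R : idomainType) : embedding R {fraction R} :=
  Embedding (emb := @tofrac R) (@tofrac_inj R).
Lemma mpolyC_injective n (R : nzRingType) : injective (@mpolyC n R).
Proof. by move=> x y /eqP; rewrite mpolyC_eq => /eqP. Qed.
Definition mpolyC_embedding n (R : nzRingType) : embedding R {mpoly R[n]} :=
  Embedding (emb := @mpolyC n R) (@mpolyC_injective n R).

Lemma char0_mpoly n (R : nzRingType) : char0 R -> char0 {mpoly R[n]}.
Proof. exact: char0_embedding (mpolyC_embedding n R). Qed.
Lemma char0_frac (R : idomainType) : char0 R -> char0 {fraction R}.
Proof. exact: char0_embedding (frac_embedding R). Qed.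

Lemma char0_K : char0 K.
Proof. by apply/char0_frac/char0_mpoly/char0_num. Qed.
Lemma char0_Kd : char0 Kd.
Proof. by apply/char0_frac/char0_mpoly/char0_K. Qed.

Definition lpt : pt K := (0, lam (ord4 0), lam (ord4 1), lam (ord4 2)).

Lemma lamE i (h : (i < 3)%N) : lam (ord4 i) = tofrac ('X_(Ordinal h) : {mpoly rat[3]}).
Proof.
rewrite /lam /ord4; case: insubP => [u _ e|]; last by rewrite inordK ?h // ltnW.
by congr (tofrac 'X_ _); apply: val_inj; rewrite e /= inordK // ltnW.
Qed.

Lemma lam3 : lam (ord4 3) = - (lam (ord4 0) + lam (ord4 1) + lam (ord4 2)).
Proof.
rewrite {1}/lam /ord4; case: insubP => [u|_]; first by rewrite inordK.
rewrite !big_ord_recr big_ord0 /= add0r !lamE; congr (- (_ + _ + _));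
  by congr (tofrac 'X_ _); apply: val_inj.
Qed.

Lemma big_ord4 (R : nmodType) (F : 'I_4 -> R) :
  \sum_(a < 4) F a = F (ord4 0) + F (ord4 1) + F (ord4 2) + F (ord4 3).
Proof.
rewrite !big_ord_recr big_ord0 /= add0r; congr (F _ + F _ + F _ + F _);
  by apply/val_inj; rewrite /= inordK.
Qed.

Lemma wtE u : wt u = fv lpt (wform u).
Proof.
rewrite /wt big_ord4 lam3 /= /wcoord /zi !Z_of_intK mul0r add0r !rmorphB /=.
by ring.
Qed.

Lemma lpt_generic f : isD f = false -> fv lpt f = 0 -> f = (0, 0, 0, 0)%BZ.
Proof.
case: f => [[[d a] b] c] /= /negbFE /Z.eqb_spec -> /eqP.
rewrite mul0r add0r !lamE -!(zi_rmorph (@tofrac _)) -!tofracM -!tofracD tofrac_eq0 => /eqP e.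
have h (v : 'I_3 -> rat) : zi a * v (inord 0) + zi b * v (inord 1) + zi c * v (inord 2) = 0.
  have := congr1 (meval v) e; rewrite !mevalD !mevalM !mevalXU !zi_rmorph meval0 => <-.
  by congr (_ * v _ + _ * v _ + _ * v _); apply/val_inj; rewrite /= inordK.
have h' j := h (fun i => (i == inord j)%:R).
have n01 : (inord 0 : 'I_3) == inord 1 = false by rewrite -val_eqE /= !inordK.
have n02 : (inord 0 : 'I_3) == inord 2 = false by rewrite -val_eqE /= !inordK.
have n12 : (inord 1 : 'I_3) == inord 2 = false by rewrite -val_eqE /= !inordK.
have e0 := h' 0%N; have e1 := h' 1%N; have e2 := h' 2%N.
rewrite ?eqxx ?[inord 1 == inord 0]eq_sym ?[inord 2 == _]eq_sym ?n01 ?n02 ?n12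
  ?mulr0 ?mulr1 ?add0r ?addr0 in e0 e1 e2.
by rewrite (char0_num e0) (char0_num e1) (char0_num e2).
Qed.

Lemma isD_half s fe : fe \in half s -> isD fe.1 = false.
Proof.
move/mem_collect; rewrite /unzip1 map_cat mem_cat => /orP [].
  by case/mapP => _ /mapP [x /mapP [[[[i j] l] m] _ ->] ->] ->.
case/mapP => _ /allpairsP [[p h]] /= [hp hh ->] -> /=.
have : isD p.1 = false.
  move/mem_collect: hp; case/mapP => _ /allpairsP [[x y]] /= [hx hy ->] -> /=.
  by case/mapP: hx => [[[[i j] l] m] _ ->]; case/mapP: hy => [[[[i' j'] l'] m'] _ ->].
move: hh; case: p {hp} => [[[[d a] b] c] e] /=; rewrite !inE.
by do 7!(case/orP => [/eqP -> /=|]; first by rewrite Z.sub_0_r); move/eqP => -> /=; rewrite Z.sub_0_r.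
Qed.

Lemma nonvan_half (k : fieldType) (z : pt k) s : zero_free s ->
  (forall f, isD f = false -> fv z f = 0 -> f = (0, 0, 0, 0)%BZ) -> nonvan z (half s).
Proof.
move=> /allP zf gz fe hfe; apply/eqP => /(gz _ (isD_half hfe)) e.
by have := zf fe hfe; rewrite e.
Qed.

Definition half_weight (k : fieldType) (z : pt k) (s : seq cell) : k :=
  (if negative s then -1 else 1) * lv z (half s).

(** e_T(- V) = e_T(- v) e_T(- bar v) = (-1)^|pi| e_T(- v)^2. As [vlist_half] demands a function
    without zeros, the trivial weight has to be treated apart, by way of two auxiliary functions. *)
Lemma half_weight_sqr s t p : zero_free s -> perm_eq t s -> Vpart p = [freeg (vlist t)] ->
  half_weight lpt s ^+ 2 = (-1) ^+ size s * eT_opp (Vpart p).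
Proof.
move=> zf pts ->; have nv := nonvan_half zf lpt_generic.
set L := vlist t.
have big_half (V V' : form -> K) : (forall f, fv lpt f != 0 -> V f = V' f) ->
    fprod V (half s) = fprod V' (half s).
  move=> h; rewrite /fprod big_seq [RHS]big_seq; apply: eq_bigr => fe hfe.
  by rewrite h // nv.
have fvN f : fv lpt (fopp f) = - fv lpt f.
  by case: f => [[[d a] b] c] /=; rewrite !ziN; ring.
(* [V2] counts the trivial weight: its product over the list of V is 2^c_0, whereas it is 1 on the
   factors in [half s]. So 2^c_0 = 1 and c_0 = 0. *)
have [V2 V2E] : exists V2 : form -> K, forall f, V2 f = if fv lpt f == 0 then zi 2 else 1.
  by eexists => f; reflexivity.
have V2_neq0 f : V2 f != 0.
  rewrite V2E; case: ifP => _; last exact: oner_neq0.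
  by rewrite (zi_neq0 char0_K).
have two : fprod V2 (wforms L) = 1.
  have := vlist_half V2_neq0 pts; rewrite -/L.
  have h1 : fprod V2 (half s) = 1.
    rewrite (big_half _ (fun _ => 1)); first by rewrite /fprod big1 // => fe _; rewrite exp1rz.
    by move=> f /negPf f0; rewrite V2E f0.
  have -> : fprod (fun f => V2 (fopp f)) (half s) = fprod V2 (half s).
    by apply: big_half => f _; rewrite V2E fvN oppr_eq0.
  by rewrite h1 !mulr1.
have wform_eq0 u : (wclass u == 0) = (fv lpt (wform u) == 0).
  apply/eqP/eqP => [e|/(lpt_generic (f := wform u) (erefl false))];
    first by rewrite -wform_class e wform0 /= !mul0r !addr0.
  rewrite -[wform u]wform_class => -[e0 e1 e2]; apply/rowP => a; rewrite [RHS]mxE.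
  have last0 : wclass u 0 (ord4 3) = 0.
    by rewrite !mxE; apply/eqP; rewrite subr_eq0; apply/eqP; congr (u 0 _); apply/val_inj;
      rewrite /= inordK.
  move: e0 e1 e2; rewrite /wcoord last0 !subr0.
  rewrite -[0%BZ]/(Z_of_int 0) => /(can_inj Z_of_intK) e0 /(can_inj Z_of_intK) e1 /(can_inj Z_of_intK) e2.
  have : a \in [:: ord4 0; ord4 1; ord4 2; ord4 3].
    by case: a => [[|[|[|[|i]]]] hi] //; rewrite !inE -!val_eqE /= !inordK.
  by rewrite !inE => /or4P [] /eqP ->.
have coeff0 : coeff 0 (cy_specialize [freeg L]) = 0.
  rewrite cy_specialize_freeg coeff_Freeg /precoeff big_map /=.
  set c := \sum_(_ <- _ | _) _.
  have t0 : zi 2 != 0 :> K by rewrite (zi_neq0 char0_K).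
  have e : (zi 2 : K) ^ c = 1.
    rewrite -two fprod_wforms /c; elim: (L) => [|x r IH]; first by rewrite !big_nil.
    rewrite !big_cons V2E wform_eq0; case: ifP => _; last by rewrite exp1rz mul1r IH.
    by rewrite expfzDr ?IH.
  have pow n : (zi 2 : K) ^+ n = 1 -> n = 0%N.
    move=> e2; have h : zi (2 ^ Z.of_nat n - 1)%BZ = 0 :> K.
      rewrite ziB zi_pow; last by lia.
      by rewrite -[Z.of_nat n]/(Z_of_int (Posz n)) Z_of_intK -exprnP e2 subrr.
    case: n {e2} h => // n /char0_K h; have := Z.pow_gt_1 2 (Z.of_nat n.+1).
    by lia.
  case: (c) e => n; first by move/pow => ->.
  by rewrite NegzE -exprnN => /eqP; rewrite invr_eq1 => /eqP /pow.
have wt_neq0 w : w \in dom (cy_specialize [freeg L]) -> wt w != 0.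
  rewrite mem_dom => hw; rewrite wtE -wform_eq0.
  suff -> : wclass w = w by apply: contraNneq hw => ->; rewrite coeff0.
  move: hw; rewrite cy_specialize_freeg coeff_Freeg; apply: contraNeq => ne.
  apply/eqP/precoeff_outdom; apply/negP; rewrite /predom -map_comp => /mapP [x _ /= e].
  case/eqP: ne; rewrite e /wclass; apply/matrixP => i j; rewrite !mxE.
  by rewrite subrr subr0.
(* Evaluation, made nonzero. The value 1 given to the zero form leaves e_T unchanged because c_0 =
   0. *)
have [V VE] : exists V : form -> K, forall f, V f = if fv lpt f == 0 then 1 else fv lpt f.
  by eexists => f; reflexivity.
have V_neq0 f : V f != 0 by rewrite VE; case: ifP => [_|/negbT //]; apply: oner_neq0.
have eT : eT_opp [freeg L] = (fprod V (wforms L))^-1.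
  rewrite /eT_opp big_seq (eq_bigr (fun w => V (wform w) ^ (- coeff w (cy_specialize [freeg L])))).
    rewrite -big_seq cy_specialize_freeg (big_dom (G := fun u a => V (wform u) ^ (- a))).
    - rewrite big_map fprod_wforms -prodfV; apply: eq_bigr => x _ /=.
      by rewrite wform_class invr_expz.
    - by move=> u; rewrite oppr0 expr0z.
    - by move=> u a b; rewrite opprD expfzDr.
  by move=> w hw; rewrite VE -wtE (negPf (wt_neq0 w hw)).
have eh : fprod V (half s) = lv lpt (half s).
  by apply: big_half => f /negPf f0; rewrite VE f0.
have ehN : fprod (fun f => V (fopp f)) (half s) = (-1) ^+ size s * lv lpt (half s).
  rewrite (big_half _ (fun f => -1 * fv lpt f)); last first.
    by move=> f f0; rewrite VE fvN oppr_eq0 (negPf f0) mulN1r.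
  rewrite -(fprod_sign K s) /fprod /lv -big_split; apply: eq_bigr => fe _.
  by rewrite /= expfzMl.
have := vlist_half V_neq0 pts; rewrite -/L eh ehN eT => e.
have L0 : fprod V (wforms L) != 0.
  by apply/eqP => e0; move/eqP: e; rewrite e0 !mul0r eq_sym oner_eq0.
apply: (mulfI L0); rewrite [RHS]mulrCA mulfV // mulr1 /half_weight exprMn.
have -> : (if negative s then -1 else 1 : K) ^+ 2 = 1.
  by case: ifP; rewrite ?sqrrN ?expr1n.
rewrite mul1r -[RHS]mulr1 -[X in _ = _ * X]e; set h := lv _ _; set x := fprod _ _.
have := sqrr_sign K (size s); rewrite expr2; move: ((-1) ^+ size s) => a ea.
by rewrite -[LHS]mul1r -ea; ring.
Qed.

End Weights.

(** * The partition series *)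

Section PartitionSeries.

Definition toKd_rmorphism : {rmorphism K -> Kd} := (@tofrac {mpoly K[4]} \o @mpolyC 4 K)%FUN.

Lemma toKdE x : toKd x = toKd_rmorphism x.
Proof. by []. Qed.

Definition dpt : pt Kd :=
  (\sum_(a < 4) dvar a * toKd (lam a),
   toKd (lam (ord4 0)), toKd (lam (ord4 1)), toKd (lam (ord4 2))).

Lemma toKd_fv f : isD f = false -> toKd (fv lpt f) = fv dpt f.
Proof.
case: f => [[[d a] b] c] /= /negbFE /Z.eqb_spec ->.
by rewrite !zi0 !mul0r !add0r !toKdE !rmorphD !rmorphM !zi_rmorph.
Qed.

Lemma dpt_generic f : fv dpt f = 0 -> f = (0, 0, 0, 0)%BZ.
Proof.
case: f => [[[d a] b] c].
have -> : fv dpt (d, a, b, c) = tofrac ((zi d *: \sum_(i < 4) ('X_i * (lam i)%:MP_[4])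
    + (fv lpt (0%BZ, a, b, c))%:MP_[4]) : {mpoly K[4]}).
  rewrite tofracD -[tofrac (_%:MP_[4])]/(toKd _) toKd_fv // -mul_mpolyC tofracM rmorph_sum /=.
  rewrite -[tofrac (_%:MP_[4])]/(toKd _) (toKdE (zi d)) zi_rmorph zi0 mul0r add0r !addrA.
  congr (_ * _ + _ + _ + _); apply: eq_bigr => i _.
  by rewrite tofracM.
move/eqP; rewrite tofrac_eq0 => /eqP e.
have ev (v : 'I_4 -> K) : zi d * \sum_(i < 4) v i * lam i + fv lpt (0%BZ, a, b, c) = 0.
  have := congr1 (meval v) e; rewrite mevalD mevalZ mevalC meval0 rmorph_sum => e1.
  rewrite -[RHS]e1; congr (_ * _ + _); apply: eq_bigr => i _.
  by rewrite /= mevalM mevalXU mevalC.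
have e0 : fv lpt (0%BZ, a, b, c) = 0.
  by rewrite -[RHS](ev (fun=> 0)) big1 ?mulr0 ?add0r // => i _; rewrite mul0r.
have [-> -> ->] := lpt_generic (f := (0%BZ, a, b, c)) (erefl false) e0.
have := ev (fun i => (i == ord4 0)%:R); rewrite e0 addr0 (bigD1 (ord4 0)) //= eqxx mul1r.
rewrite big1 ?addr0 => [|i /negPf ->]; last by rewrite mul0r.
move/eqP; rewrite mulf_eq0 => /orP [/eqP /char0_K -> //|].
have : fv lpt (0, 1, 0, 0)%BZ != 0 by apply/eqP => /(lpt_generic (f := (0, 1, 0, 0)%BZ) (erefl false)).
by rewrite /= !zi0 !mul0r zi1 add0r !addr0 mul1r => /negPf ->.
Qed.

Lemma half_weight_dpt s : toKd (half_weight lpt s) = half_weight dpt s.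
Proof.
rewrite /half_weight toKdE rmorphM; congr (_ * _).
  by case: ifP => _; rewrite ?rmorphN rmorph1.
rewrite /lv rmorph_prod big_seq [RHS]big_seq; apply: eq_bigr => fe /isD_half hD.
by rewrite fmorphXz -toKd_fv.
Qed.

Lemma nonvan_dpt s : zero_free s -> nonvan dpt (half s).
Proof. by move=> zf; apply: nonvan_half zf _ => f _; apply: dpt_generic. Qed.

Lemma tv_term_of s : zero_free s ->
  tv dpt (term_of s) = (\prod_(x <- s) fv dpt (cell_form 1 x)) * half_weight dpt s.
Proof.
move=> zf; rewrite /term_of; set t : term := (_, half s).
have := tnorm_v char0_Kd dpt t; case et: (tnorm t) => [c l].
rewrite /tv /= lv_cat.
have nl : nonvan dpt l.
  have -> : l = (tnorm t).2 by rewrite et.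
  rewrite /tnorm /= => fe /mapP [x /mapP [y hy ->] ->]; have := nonvan_dpt zf hy.
  by rewrite (fv_norm dpt y.1); case: (fnorm y.1) => a f /=; apply: contraNneq => ->; rewrite mulr0.
rewrite lv_collect // mulrCA => ->; congr (_ * _).
  rewrite /lv (perm_big [seq (cell_form 1 x, 1%BZ) | x <- s]) ?perm_sort //= big_map.
  by apply: eq_bigr => x _; rewrite expr1z.
rewrite /half_weight; congr (_ * _); case: ifP => _.
  by rewrite qv.unlock /= -[zi (-1)%BZ]/(- 1) -[zi 1%BZ]/1 divr1.
by rewrite qv.unlock /= -[zi 1%BZ]/1 divr1.
Qed.

Lemma fv_cell_shift (k : fieldType) (z : pt k) x :
  fv z (cell_form 1 x) = z.1.1.1 + fv z (cell_form 0 x).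
Proof.
case: x z => [[[i j] l] m] [[[D a] b] c] /=.
by rewrite zi0 zi1 mul0r mul1r add0r !addrA.
Qed.

Lemma fv_cell_form x : fv dpt (cell_form 1 x) =
  \sum_(a < 4) (dvar a + (box_weight x.1 x.2 0 a)%:~R) * toKd (lam a).
Proof.
rewrite (eq_bigr (fun a => dvar a * toKd (lam a) + (box_weight x.1 x.2 0 a)%:~R * toKd (lam a))).
  rewrite fv_cell_shift [RHS]big_split; congr (_ + _);
    rewrite -wform_cell -toKd_fv // -wtE /wt toKdE rmorph_sum.
  by apply: eq_bigr => a _; rewrite rmorphM rmorph_int.
by move=> a _; rewrite mulrDl.
Qed.

Lemma Lpart_cells p : Lpart p = \prod_(x <- cells p) fv dpt (cell_form 1 x).
Proof.
rewrite /cells big_allpairs_dep; apply: eq_bigr => b _.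
rewrite -[iota 0 _]/(iota 0 (p b)) -[in RHS](subn0 (p b)) -/(index_iota 0 (p b)) big_mkord.
by apply: eq_bigr => l _; rewrite fv_cell_form.
Qed.

(** The list of cells in exactly the order produced by [parts], so that weights attached to arrays
    agree with the computed [terms]. *)
Definition representative (p : array) : seq cell :=
  let ps := parts (sp_size p) in nth [::] ps (index p [seq array_of s | s <- ps]).

Lemma representativeE n s : s \in parts n -> representative (array_of s) = s.
Proof.
move=> hs; have u : uniq [seq array_of s | s <- parts n].
  by rewrite -(perm_uniq (solid_partitionsE n)) solid_partitions_uniq.
have sz : sp_size (array_of s) = n.
  have : array_of s \in solid_partitions n.
    by rewrite (perm_mem (solid_partitionsE n)) map_f.
  by case/mem_solid_partitions.
rewrite /representative sz; set ps := parts n.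
rewrite -[in X in index X _](nth_index [::] hs) -(nth_map [::] (array_of [::])) ?index_mem //.
by rewrite index_uniq ?size_map ?index_mem // nth_index.
Qed.

Lemma representative_solid p : is_solid_partition p ->
  exists2 s, s \in parts (sp_size p) & p = array_of s.
Proof.
move=> hp; have : p \in solid_partitions (sp_size p) by apply/mem_solid_partitions.
by rewrite (perm_mem (solid_partitionsE _)) => /mapP.
Qed.

Definition weight_of (p : array) : K := half_weight lpt (representative p).

Lemma partition_seriesE n (w : array -> K) : partition_series w n =
  \sum_(s <- parts n) (\prod_(x <- s) fv dpt (cell_form 1 x)) * toKd (w (array_of s)).
Proof.
rewrite /partition_series (perm_big _ (solid_partitionsE n)) big_map big_seq [RHS]big_seq.
apply: eq_bigr => s /parts_diagram /perm_cells ps.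
by rewrite Lpart_cells (perm_big _ ps).
Qed.

Lemma weight_of_sqr p : is_solid_partition p -> all zero_free (parts (sp_size p)) ->
  is_weight_of p (weight_of p).
Proof.
move=> hp /allP zf; have [s hs ep] := representative_solid hp.
rewrite /is_weight_of /weight_of ep (representativeE hs) -ep.
have pc : perm_eq (cells p) s by rewrite ep; apply: perm_cells (parts_diagram hs).
rewrite (half_weight_sqr (zf s hs) pc (Vpart_freeg p)).
by have [_ _ ->] := parts_diagram hs.
Qed.

Lemma partition_series_weight n : all zero_free (parts n) ->
  partition_series weight_of n = sv dpt (terms n).
Proof.
move=> /allP zf; rewrite partition_seriesE /sv /terms big_map big_seq [RHS]big_seq.
apply: eq_bigr => s hs; rewrite tv_term_of ?zf //.
by rewrite /weight_of (representativeE hs) half_weight_dpt.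
Qed.

End PartitionSeries.

(** * Powers of the MacMahon function *)

Section RationalSeries.

(* Power series with rational coefficients, truncated after q^6. *)
Definition q0 : Q := Qmake 0 1.
Definition q1 : Q := Qmake 1 1.
Definition trunc (F : nat -> Q) : seq Q := [seq F n | n <- iota 0 7].
Definition qcoef (s : seq Q) (n : nat) : Q := nth q0 s n.
Definition qsum (F : nat -> Q) (n : nat) : Q := foldr (fun i => qadd (F i)) q0 (iota 0 n).
Definition qconv (s t : seq Q) : seq Q :=
  trunc (fun n => qsum (fun i => qmul (qcoef s i) (qcoef t (n - i))) n.+1).
Definition qone : seq Q := trunc (fun n => if n is 0%N then q1 else q0).
Fixpoint qpowers (s p : seq Q) (m : nat) : seq (seq Q) :=
  if m is m'.+1 then p :: qpowers s (qconv s p) m' else [::].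
Definition qcomp (a : nat -> Q) (s : seq Q) : seq Q :=
  let ps := qpowers s qone 7 in
  trunc (fun n => qsum (fun m => qmul (a m) (qcoef (nth [::] ps m) n)) n.+1).
Definition qinvn (n : nat) : Q := Qinv (inject_Z (Z.of_nat n)).
Definition qXn (m : nat) : seq Q := trunc (fun n => if n == m then q1 else q0).
Definition qgeom_pow (m : nat) : seq Q :=
  iter m (qconv (qcomp (fun _ => q1) (qXn m))) qone.
Definition qmacmahon : seq Q :=
  trunc (fun n => qcoef (foldr (fun m s => qconv (qgeom_pow m) s) qone (iota 1 n)) n).
Definition qsign (n : nat) : Q := if odd n then (Qmake (-1) 1) else q1.
Definition qlog : seq Q :=
  qcomp (fun m => qmul (qsign m.+1) (qinvn m))
    (trunc (fun n => qadd (qmul (qsign n) (qcoef qmacmahon n)) (qmul (Qmake (-1) 1) (qcoef qone n)))).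
(** The coefficient of a^m q^n in exp (a log M(-q)) is that of q^n in (log M(-q))^m / m!. *)
Definition qpower_coefs : seq (seq Q) :=
  let ps := qpowers qlog qone 7 in
  [seq [seq qmul (qinvn (m`!)) (qcoef (nth [::] ps m) n) | m <- iota 0 n.+1] | n <- iota 0 7].
Definition macmahon_check : bool :=
  qpower_coefs == [seq (if n is 0%N then q1 else q0) :: macmahon_powers n | n <- iota 0 7].
End RationalSeries.

Section RationalSeriesCorrect.
Variable k : fieldType.
Hypothesis ch0 : char0 k.
Implicit Types (f g : fps k) (s t : seq Q).
Local Notation qv := (qv k).

Definition represents s f := forall n, (n < 7)%N -> f n = qv (qcoef s n).

Lemma qv_q0 : qv q0 = 0. Proof. by apply: qv0. Qed.
Lemma qv_q1 : qv q1 = 1. Proof. by rewrite qvz zi1. Qed.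
Lemma qvN1 : qv (Qmake (-1) 1) = -1.
Proof. by rewrite (qvz _ (-1)) -[(-1)%BZ]/(- (1))%BZ ziN zi1. Qed.

Lemma qcoef_trunc F n : (n < 7)%N -> qcoef (trunc F) n = F n.
Proof. by move=> hn; rewrite /qcoef /trunc (nth_map 0%N) ?size_iota // nth_iota. Qed.

Lemma qv_qsum F n : qv (qsum F n) = \sum_(i < n) qv (F i).
Proof.
rewrite /qsum -(big_mkord predT (fun i => qv (F i))) /index_iota subn0.
elim: (iota 0 n) => [|i r IH]; first by rewrite big_nil qv_q0.
by rewrite big_cons /= (qvD ch0) IH.
Qed.

Lemma represents_conv s t f g : represents s f -> represents t g ->
  represents (qconv s t) (fps_mul f g).
Proof.
move=> hf hg n hn; rewrite qcoef_trunc // qv_qsum; apply: eq_bigr => i _.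
by rewrite (qvM ch0) hf ?hg //; have := ltn_ord i; lia.
Qed.

Lemma represents_one : represents qone (@fps_one k).
Proof. by case=> [|n] hn; rewrite qcoef_trunc ?qv_q0 ?qv_q1. Qed.

Lemma represents_powers s f p g m i : represents s f -> represents p g -> (i < m)%N ->
  represents (nth [::] (qpowers s p m) i) (iter i (fps_mul f) g).
Proof.
move=> hf; elim: m i p g => // m IH [|i] p g hp hi //=; rewrite -iterS iterSr.
by apply: IH => //; apply: represents_conv.
Qed.

Lemma represents_comp a' a s f : represents s f -> (forall m, (m < 7)%N -> a m = qv (a' m)) ->
  represents (qcomp a' s) (fps_comp a f).
Proof.
move=> hf ha n hn; rewrite qcoef_trunc // qv_qsum; apply: eq_bigr => i _.
have hi : (i < 7)%N by apply: leq_trans (ltn_ord i) hn.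
rewrite (qvM ch0) ha //; congr (_ * _).
exact: (represents_powers hf represents_one hi).
Qed.

Lemma qv_inv n : qv (qinvn n) = n%:R^-1.
Proof.
rewrite (qvV _) qvz; congr (_^-1).
by rewrite /zi -[Z.of_nat n]/(Z_of_int (Posz n)) Z_of_intK.
Qed.

Lemma qv_sign n : qv (qsign n) = (-1) ^+ n.
Proof. by rewrite /qsign -signr_odd; case: odd; rewrite ?qv_q1 ?qvN1 ?expr1 ?expr0. Qed.

Lemma represents_geom_pow m : represents (qgeom_pow m) (fps_pow (fps_geom (@fps_X k m)) m).
Proof.
have h : represents (qcomp (fun _ => q1) (qXn m)) (fps_geom (@fps_X k m)).
  apply: represents_comp => [n hn|n _]; last by rewrite qv_q1.
  by rewrite qcoef_trunc // /fps_X; case: eqP => _; rewrite ?qv_q0 ?qv_q1.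
suff iter_h i : represents (iter i (qconv (qcomp (fun _ => q1) (qXn m))) qone)
    (fps_pow (fps_geom (@fps_X k m)) i) by apply: iter_h.
elim: i => [|i IH]; first exact: represents_one.
by rewrite /fps_pow !iterS; apply: represents_conv.
Qed.

Lemma represents_macmahon : represents qmacmahon (macmahon k).
Proof.
move=> n hn; rewrite qcoef_trunc // /macmahon /index_iota subSS subn0.
have : represents (foldr (fun m s => qconv (qgeom_pow m) s) qone (iota 1 n))
   (\big[@fps_mul k/@fps_one k]_(m <- iota 1 n) fps_pow (fps_geom (@fps_X k m)) m); last exact.
elim: (iota 1 n) => [|i r IH]; first by rewrite big_nil; apply: represents_one.
by rewrite big_cons; apply: represents_conv IH; apply: represents_geom_pow.
Qed.

Lemma represents_log : represents qlog
  (fps_log1p (fps_sub (fps_neg_arg (macmahon k)) (@fps_one k))).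
Proof.
apply: represents_comp => [n hn|m _]; last by rewrite (qvM ch0) qv_inv qv_sign.
rewrite qcoef_trunc // (qvD ch0) !(qvM ch0) qv_sign qvN1 mulN1r.
by rewrite -represents_macmahon // -represents_one.
Qed.

Lemma fps_pow_scale a f m n : fps_pow (fps_scale a f) m n = a ^+ m * fps_pow f m n.
Proof.
elim: m n => [|m IH] n; first by rewrite expr0 mul1r.
rewrite /fps_pow !iterS -!/(fps_pow _ _) /fps_mul mulr_sumr; apply: eq_bigr => i _.
by rewrite IH /fps_scale exprS; ring.
Qed.

Lemma macmahon_rpow a n : (n < 7)%N ->
  fps_rpow (fps_neg_arg (macmahon k)) a n =
  \sum_(m < n.+1) qv (qcoef (nth [::] qpower_coefs n) m) * a ^+ m.
Proof.
move=> hn; rewrite /fps_rpow /fps_exp /fps_comp; apply: eq_bigr => m _.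
rewrite fps_pow_scale mulrCA mulrC; congr (_ * _).
have hm : (m < 7)%N by apply: leq_trans (ltn_ord m) hn.
rewrite [fps_pow _ _ n](represents_powers represents_log represents_one hm hn) -qv_inv -(qvM ch0).
rewrite /qpower_coefs (nth_map 0%N) ?size_iota // nth_iota //.
by rewrite /qcoef (nth_map 0%N) ?size_iota // nth_iota.
Qed.

End RationalSeriesCorrect.

Section RightHandSide.

(** When the lambda's sum to 0, their third elementary symmetric function is - (lambda_1 + lambda_2)
    (lambda_1 + lambda_3) (lambda_2 + lambda_3). In this factored form the powers of the exponent
    are terms, and they visibly vanish on the planes in [anchors]. *)
Definition neg_exponent (k : fieldType) (z : pt k) : k :=
  let: (D, a, b, c) := z in D * ((a + b) * (a + c) * (b + c)) / (a * b * c * (a + b + c)).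

Lemma tv_exponent_power (k : fieldType) (z : pt k) j c : char0 k ->
  tv z (exponent_power j c) = - (qv k c * (- neg_exponent z) ^+ j).
Proof.
move=> ch0; case: z => [[[D x] y] w]; rewrite /exponent_power /tv /=.
have -> : lv (D, x, y, w)
   [:: ((1, 0, 0, 0), Z.of_nat j); ((0, 0, 0, 1), - Z.of_nat j); ((0, 0, 1, 0), - Z.of_nat j);
       ((0, 0, 1, 1), Z.of_nat j); ((0, 1, 0, 0), - Z.of_nat j); ((0, 1, 0, 1), Z.of_nat j);
       ((0, 1, 1, 0), Z.of_nat j); ((0, 1, 1, 1), - Z.of_nat j)]%BZ = neg_exponent (D, x, y, w) ^+ j.
  have ej : int_of_Z (Z.of_nat j) = j by rewrite -[Z.of_nat j]/(Z_of_int (Posz j)) Z_of_intK.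
  rewrite !lv_cons lv_nil /= !rmorphN !zi0 !zi1 !mul0r !add0r !addr0 !mul1r /= ej.
  rewrite -!exprnP -!exprnN; do 4![rewrite -exprVn]; rewrite mulr1 -!exprMn.
  by congr (_ ^+ _); rewrite !invfM; ring.
rewrite exprNn -signr_odd; case: (odd j).
  by rewrite expr1; ring.
by rewrite expr0 (qvM ch0) qvN1; ring.
Qed.

Lemma sum_zip_iota (R : nmodType) (T : Type) (x0 : T) (F : nat -> T -> R) i (s : seq T) :
  \sum_(jc <- zip (iota i (size s)) s) F jc.1 jc.2 = \sum_(m < size s) F (i + m)%N (nth x0 s m).
Proof.
elim: s i => [|x s IH] i; first by rewrite big_nil big_ord0.
rewrite big_cons big_ord_recl addn0 /= IH; congr (_ + _); apply: eq_bigr => m _.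
by rewrite /= addSnnS.
Qed.

Lemma sv_rhs_terms (k : fieldType) (z : pt k) n : char0 k ->
  sv z (rhs_terms n) = - \sum_(m < size (macmahon_powers n))
    qv k (nth q0 (macmahon_powers n) m) * (- neg_exponent z) ^+ m.+1.
Proof.
move=> ch0; rewrite /sv /rhs_terms big_map.
rewrite (eq_bigr (fun jc => - (qv k jc.2 * (- neg_exponent z) ^+ jc.1))); last first.
  by move=> jc _; rewrite tv_exponent_power.
by rewrite sumrN (sum_zip_iota q0 (fun j c => qv k c * (- neg_exponent z) ^+ j)).
Qed.

Lemma exponentE : exponent = - neg_exponent dpt.
Proof.
have eP : \prod_(a < 4) lam a = - (lam (ord4 0) * lam (ord4 1) * lam (ord4 2) *
    (lam (ord4 0) + lam (ord4 1) + lam (ord4 2))).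
  rewrite !big_ord_recr big_ord0 /= mul1r -mulrN -lam3; congr (lam _ * lam _ * lam _ * lam _);
    by apply/val_inj; rewrite /= inordK.
have eS : \sum_(a < 4) \prod_(b < 4 | b != a) lam b =
    - ((lam (ord4 0) + lam (ord4 1)) * (lam (ord4 0) + lam (ord4 2)) * (lam (ord4 1) + lam (ord4 2))).
  have prod3 a : \prod_(b < 4 | b != a) lam b =
      \prod_(b <- [seq b <- [:: ord4 0; ord4 1; ord4 2; ord4 3] | b != a]) lam b.
    rewrite big_filter; apply: perm_big; apply: uniq_perm; first exact: index_enum_uniq.
      by rewrite /= !inE -!val_eqE /= !inordK.
    by move=> b; rewrite mem_index_enum !inE -!val_eqE /= !inordK //; case: b => [[|[|[|[|]]]]].
  rewrite big_ord4 !prod3 /= -!val_eqE /= !inordK //= !big_cons !big_nil lam3; ring.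
rewrite /exponent eP eS opprK !toKdE rmorphN !rmorphM !rmorphD /=.
by rewrite invrN mulrN; congr (- _); rewrite /neg_exponent /dpt /= !toKdE.
Qed.

Lemma vanishing_checkP n : vanishing_check n ->
  all zero_free (parts n) /\ sv dpt (terms n ++ rhs_terms n) = 0.
Proof.
rewrite /vanishing_check -/(terms n); case/and5P => zf hp hd hpl /andP [ho /allP hn]; split=> //.
apply: (orbit_vanishing char0_Kd hp hd hpl ho); last exact: dpt_generic.
by move=> r D /hn h; apply: (num_checkP char0_Kd h D).
Qed.

Lemma macmahon_coefs n : macmahon_check -> (n < 7)%N ->
  fps_rpow (fps_neg_arg (macmahon Kd)) exponent n =
  (n == 0%N)%:R + \sum_(m < n) qv Kd (nth q0 (macmahon_powers n) m) * exponent ^+ m.+1.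
Proof.
move=> /eqP chk hn.
have e : nth [::] qpower_coefs n = (if n is 0%N then q1 else q0) :: macmahon_powers n.
  by rewrite chk (nth_map 0%N) ?size_iota ?nth_iota.
rewrite (macmahon_rpow char0_Kd exponent hn).
rewrite e big_ord_recl expr0 mulr1; congr (_ + _).
by rewrite /qcoef; case: n {e hn} => [|n]; [apply: qv_q1|apply: qv_q0].
Qed.

Lemma partition_series_macmahon n : macmahon_check -> (0 < n < 7)%N -> vanishing_check n ->
  partition_series weight_of n = fps_rpow (fps_neg_arg (macmahon Kd)) exponent n.
Proof.
move=> mc /andP [n0 n7] /vanishing_checkP [zf e].
have n0' : (n == 0%N) = false by rewrite -[RHS](ltn_eqF n0) eq_sym.
rewrite (partition_series_weight zf) (macmahon_coefs mc n7) n0' add0r.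
have e' : sv dpt (terms n) = - sv dpt (rhs_terms n).
  by apply/eqP; rewrite -addr_eq0 /sv -big_cat -/(sv _ _) e.
rewrite e' (sv_rhs_terms _ _ char0_Kd) opprK exponentE.
have -> : size (macmahon_powers n) = n.
  by move: n0 n7; clear; do 7?[case: n => [|n] //].
by [].
Qed.

Lemma partition_series0 : macmahon_check ->
  partition_series weight_of 0 = fps_rpow (fps_neg_arg (macmahon Kd)) exponent 0.
Proof.
move=> mc; rewrite (@partition_series_weight 0 (erefl true)) (@macmahon_coefs 0 mc (erefl true)).
rewrite big_ord0 addr0 /sv /terms [parts 0]/= [map _ _]/= big_seq1.
have -> : term_of [::] = (q1, [::]) by vm_compute.
by rewrite /tv lv_nil mulr1 (qv_q1 Kd).
Qed.

End RightHandSide.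

(** * Linear independence of the terms *)

Section IndependenceCheck.
Local Open Scope Z_scope.

Definition mod127 (x : Z) : Z := x mod 127.
(* 3 generates the multiplicative group of F_127. *)
Definition exp_table : seq Z := Eval vm_compute in
  (fix powers n x := if n is n'.+1 then x :: powers n' (mod127 (3 * x)) else [::]) 126%N 1.
Definition log_table : seq Z := Eval vm_compute in
  [seq Z.of_nat (index (Z.of_nat i) exp_table) | i <- iota 0 127].
Definition plog (x : Z) : Z := nth 0 log_table (Z.to_nat x).
Definition pexp (x : Z) : Z := nth 0 exp_table (Z.to_nat x).
Definition pinv (x : Z) : Z := pexp ((126 - plog x) mod 126).

(* The point of the plane [f = 0] with lambda = (1, x, y). *)
Definition point_on (f : form) (xy : Z * Z) : form :=
  let: (_, a, b, c) := f in (- (a + b * xy.1 + c * xy.2), 1, xy.1, xy.2).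

Fixpoint dense (fs : seq form) (l : seq (form * Z)) : seq Z :=
  match fs, l with
  | f :: fs', (g, e) :: l' => if feq f g then e :: dense fs' l' else 0 :: dense fs' l
  | _, _ => [::]
  end.
Definition sparse (fs : seq form) (es : seq Z) : seq (form * Z) :=
  [seq fe <- zip fs es | ~~ (fe.2 =? 0)].
Fixpoint sparse_dot (s t : seq Z) (acc : Z) : Z :=
  match s, t with
  | x :: s', y :: t' => if x =? 0 then sparse_dot s' t' acc else sparse_dot s' t' (acc + x * y)
  | _, _ => acc
  end.

Fixpoint add_scaled (r : seq Z) (x : Z) (p : seq Z) : seq Z :=
  match r, p with
  | a :: r', b :: p' => (a + x * b) :: add_scaled r' x p'
  | [::], _ => [seq x * b | b <- p]
  | _, [::] => r
  end.
(* A pivot row p stands for the equation b_i + sum_j p_j b_(i+1+j) = 0. *)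
Fixpoint reduce (pivots : seq (seq Z)) (row : seq Z) : seq Z :=
  match pivots, row with
  | p :: pivots', x :: r =>
      let x := mod127 x in
      reduce pivots' (if x =? 0 then r else add_scaled r (127 - x) p)
  | _, _ => row
  end.
(** A row is kept only if it gives a pivot in the next column. Others are discarded, and for this
    reason [block_check] admits eight points more than there are unknowns. *)
Definition add_row (pivots : seq (seq Z)) (row : seq Z) : seq (seq Z) :=
  if reduce pivots row is x :: r then
    let x := mod127 x in let i := pinv x in
    if mod127 (i * x) =? 1 then rcons pivots [seq mod127 (i * y) | y <- r] else pivots
  else pivots.
Definition full_rank (n : nat) (rows : seq (seq Z)) : bool :=
  size (foldl add_row [::] rows) == n.

Definition has_factor (f : form) (t : term) : bool := has (fun fe => feq f fe.1 && (0 <? fe.2)) t.2.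
Definition no_Dpole (t : term) : bool :=
  all (fun fe => (0 <=? fe.2) || ~~ isD fe.1 && ~~ feq fe.1 (0, 0, 0, 0)) t.2.
Definition unit127 (x : Z) : bool := ~~ (mod127 x =? 0).
(** Discrete logarithms turn a product of powers of nonzero values into a dot product modulo 126.
    Points at which some form vanishes are skipped. *)
Definition row_at (fs : seq form) (es : seq (Z * seq Z)) (r : form) : option (seq Z) :=
  let vs := [seq mod127 (fdot r f) | f <- fs] in
  if has (Z.eqb 0) vs then None else
  let logs := [seq plog v | v <- vs] in
  Some [seq pexp (sparse_dot e.2 logs e.1 mod 126) | e <- es].
Definition block_check (pts : seq (Z * Z)) (f : form) (ts : seq term) : bool :=
  let g := [seq t <- ts | ~~ has_factor f t] in
  let fs := formsof g in
  let es := [seq (plog (mod127 (Qnum t.1)) - plog (Zpos (Qden t.1) mod 127), dense fs t.2) | t <- g] in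
  [&& all no_Dpole ts,
      all (fun t : term => unit127 (Qnum t.1) && unit127 (Zpos (Qden t.1))) g,
      all (fun te => keyeq (sparse fs te.2.2) te.1.2) (zip g es)
    & full_rank (size g)
        (pmap (fun xy => row_at fs es (point_on f xy)) (take (size g + 8) pts))].
(** A triangular scheme: the terms without the factor f are settled on the plane f = 0 and dropped
    before the terms with this factor are examined on the next plane. *)
Fixpoint independence_check (bs : seq (form * seq (Z * Z))) (ts : seq term) : bool :=
  if bs is (f, pts) :: bs' then
    block_check pts f ts && independence_check bs' [seq t <- ts | has_factor f t]
  else nilp ts.

(* Four forms attached to boxes, and one which is not, for the remaining terms; the points (x, y) are
   such that no form occurring in the terms vanishes. *)
Definition blocks : seq (form * seq (Z * Z)) :=
  [:: ((1, -1, -1, -1), [:: 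
        (103,90); (61,101); (19,81); (23,113); (23,39); (55,23); (35,10); (106,79); (47,106);
        (72,102); (92,25); (33,120); (61,46); (39,6); (53,6); (44,109); (28,18); (16,50);
        (107,70); (45,25); (36,67); (102,72); (113,66); (86,6); (37,61); (38,106); (88,104);
        (24,113); (44,68); (101,112); (77,58); (99,89); (25,82); (46,53); (13,46); (50,15);
        (119,80); (39,7); (107,52); (97,116); (97,106); (77,18); (60,89); (39,61); (118,41);
        (103,10); (94,56); (92,119); (81,19); (88,66); (10,72); (66,78); (39,104); (6,77);
        (99,46); (81,119)]);
      ((1, 0, 0, 1), [:: 
        (103,90); (96,85); (122,33); (16,49); (62,113); (19,81); (25,122); (51,40); (106,79);
        (10,41); (62,92); (55,48); (106,122); (61,15); (45,67); (119,20); (102,54); (15,23);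
        (21,9); (110,55); (39,20); (81,111); (90,95); (62,53); (82,121); (13,64); (113,66);
        (86,6); (93,39); (62,72); (37,61); (66,84); (88,104); (122,108); (44,68); (109,48);
        (90,12); (101,121); (76,68); (55,40); (101,112); (25,82); (55,61); (46,50); (111,54)]);
      ((1, 0, 1, 0), [:: 
        (122,109); (61,101); (117,22); (16,49); (71,15); (22,99); (19,81); (25,122); (51,40);
        (121,20); (106,79); (10,41); (47,106); (61,46); (61,15); (49,112); (39,6); (57,123);
        (119,20); (41,89); (55,20); (83,6); (28,18); (102,54); (15,23); (21,9); (60,120);
        (81,111); (16,50); (82,121); (45,25); (113,66); (86,6); (92,87); (64,35)]);
      ((1, 1, 0, 0), [:: 
        (122,109); (5,109); (122,33); (117,22); (62,113); (75,33); (119,113); (19,81); (113,2);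
        (28,101); (29,124); (23,113); (82,28); (25,122); (51,40); (55,23); (121,20); (106,79);
        (77,2); (92,45); (62,92); (24,9); (72,102); (55,48); (109,3); (92,25)]);
      ((1, 7, 3, 5), [:: 
        (103,90); (122,109); (61,101); (122,33); (33,50); (75,33); (29,54); (22,99); (19,81);
        (23,113); (82,28); (25,122); (51,40); (121,20); (10,41); (24,9); (53,4); (92,25)])].

End IndependenceCheck.

(** * Gaussian elimination and discrete logarithms modulo 127 *)

Section Elimination.
Variable F : fieldType.
Hypothesis F127 : zi 127 = 0 :> F.
Implicit Types (r p row : seq Z) (b : seq F).

Fixpoint dot r b : F :=
  match r, b with x :: r', v :: b' => zi x * v + dot r' b' | _, _ => 0 end.

Lemma dot_scale x p b : dot [seq (x * y)%BZ | y <- p] b = zi x * dot p b.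
Proof.
elim: p b => [|y p IH] [|v b] /=; rewrite ?mulr0 //.
by rewrite IH ziM; ring.
Qed.

Lemma dot_add_scaled r x p b : dot (add_scaled r x p) b = dot r b + zi x * dot p b.
Proof.
elim: r p b => [|a r IH] p b;
  first by rewrite -[add_scaled _ _ _]/[seq (x * y)%BZ | y <- p] dot_scale add0r.
case: p b => [|y p] [|v b] /=; rewrite ?mulr0 ?addr0 //.
by rewrite IH ziD ziM; ring.
Qed.

Lemma zi_mod127 x : zi (mod127 x) = zi x :> F.
Proof.
rewrite /mod127 [in RHS](Z.div_mod x 127) //.
by rewrite ziD ziM F127 mul0r add0r.
Qed.

Lemma dot_mod x p b : dot [seq mod127 (x * y) | y <- p] b = zi x * dot p b.
Proof.
elim: p b => [|y p IH] [|v b] /=; rewrite ?mulr0 //.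
by rewrite IH zi_mod127 ziM; ring.
Qed.

Fixpoint pivots_hold (ps : seq (seq Z)) b : Prop :=
  match ps, b with
  | p :: ps', v :: b' => v + dot p b' = 0 /\ pivots_hold ps' b'
  | _, _ => True
  end.

Lemma reduceP ps row b : pivots_hold ps b -> dot (reduce ps row) (drop (size ps) b) = dot row b.
Proof.
elim: ps row b => [|p ps IH] row b /=; first by rewrite drop0.
case: row => [|x r]; first by case: b.
case: b => [|v b] /=; first by move=> _; case: (reduce _ _).
case=> e hp; rewrite IH //; case: (Z.eqb_spec (mod127 x) 0) => [x0|_].
  by rewrite -(zi_mod127 x) x0 zi0 mul0r add0r.
rewrite dot_add_scaled ziB F127 zi_mod127.
have -> : v = - dot p b by apply/eqP; rewrite -addr_eq0 e.
ring.
Qed.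

Lemma pivots_rcons ps p b : pivots_hold ps b ->
  (if drop (size ps) b is v :: b' then v + dot p b' = 0 else True) -> pivots_hold (rcons ps p) b.
Proof.
elim: ps b => [|q ps IH] b /=; first by rewrite drop0; case: b.
by case: b => // v b /= [e hp] h; split=> //; apply: IH.
Qed.

Lemma add_rowP ps row b : pivots_hold ps b -> dot row b = 0 -> pivots_hold (add_row ps row) b.
Proof.
move=> hp hr; rewrite /add_row; have := reduceP row hp; rewrite hr.
case: (reduce ps row) => // x r; case: Z.eqb_spec => // e h; apply: pivots_rcons => //.
case: (drop _ b) h => // v b' /= h.
rewrite dot_mod -[v]mul1r -zi1 -e zi_mod127 ziM zi_mod127.
by rewrite -mulrA -mulrDr h mulr0.
Qed.

Lemma pivots_zero ps b : size ps = size b -> pivots_hold ps b -> all (fun v => v == 0) b.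
Proof.
elim: ps b => [|p ps IH] [|v b] //= [sz] [e hp]; have hb := IH b sz hp; rewrite hb andbT.
suff z : dot p b = 0 by rewrite -e z addr0.
elim: p b {sz hp e} hb => [|x p IHp] [|w b] //= /andP [/eqP -> hb].
by rewrite mulr0 add0r IHp.
Qed.

Lemma full_rankP n rows b : full_rank n rows -> size b = n ->
  (forall row, row \in rows -> dot row b = 0) -> all (fun v => v == 0) b.
Proof.
move=> /eqP hn sb h; apply: (@pivots_zero (foldl add_row [::] rows)); first by rewrite hn.
have : pivots_hold [::] b by [].
elim: rows h [::] {hn} => //= row rows IH h ps hp; apply: IH.
  by move=> r hr; apply: h; rewrite inE hr orbT.
by apply: add_rowP hp _; apply: h; rewrite inE eqxx.
Qed.

Lemma plog_pow i : i \in iota 1 126 -> (mod127 (3 ^ plog (Z.of_nat i)) =? Z.of_nat i)%BZ.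
Proof. by move: i; apply/allP; vm_compute. Qed.
Lemma pexp_pow i : i \in iota 0 126 -> (pexp (Z.of_nat i) =? mod127 (3 ^ Z.of_nat i))%BZ.
Proof. by move: i; apply/allP; vm_compute. Qed.
Lemma log_table_ge0 x : x \in log_table -> (0 <=? x)%BZ.
Proof. by move: x; apply/allP; vm_compute. Qed.

Lemma zi3_neq0 : zi 3 != 0 :> F.
Proof.
(* 85 is the inverse of 3 modulo 127. *)
apply/eqP => e; have := oner_neq0 F; rewrite -zi1 -[1%BZ]/(mod127 (3 * 85)) zi_mod127 ziM e.
by rewrite mul0r eqxx.
Qed.

Lemma zi3_126 : zi 3 ^+ 126 = 1 :> F.
Proof.
rewrite -[_ ^+ _]/(zi 3 ^ int_of_Z 126) -zi_pow // -zi_mod127.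
by rewrite (_ : mod127 (3 ^ 126) = 1%BZ) //; vm_compute.
Qed.

Lemma plog_ge0 x : (0 <=? plog x)%BZ.
Proof.
rewrite /plog; case: (ltnP (Z.to_nat x) (size log_table)) => hx; last by rewrite nth_default.
exact: log_table_ge0 (mem_nth _ hx).
Qed.

Lemma mod127_range x : (0 <= mod127 x < 127)%BZ.
Proof. exact: Z.mod_pos_bound. Qed.

Lemma zi_plog x : ~~ (mod127 x =? 0)%BZ -> zi x = zi 3 ^ int_of_Z (plog (mod127 x)) :> F.
Proof.
move=> x0; have [h1 h2] := mod127_range x.
have hi : Z.to_nat (mod127 x) \in iota 1 126 by rewrite mem_iota; lia.
have := plog_pow hi; rewrite (Z2Nat.id _ h1) => /Z.eqb_spec e.
by rewrite -(zi_pow _ _ (plog_ge0 _)) -[RHS]zi_mod127 e zi_mod127.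
Qed.

Lemma zi_neq0_127 x : ~~ (mod127 x =? 0)%BZ -> zi x != 0 :> F.
Proof. by move/zi_plog ->; rewrite expfz_neq0 // zi3_neq0. Qed.

Lemma zi_pexp x : zi (pexp (x mod 126)) = zi 3 ^ int_of_Z x :> F.
Proof.
have [h1 h2] : (0 <= x mod 126 < 126)%BZ by apply: Z.mod_pos_bound.
have hi : Z.to_nat (x mod 126) \in iota 0 126 by rewrite mem_iota; lia.
have := pexp_pow hi; rewrite (Z2Nat.id _ h1) => /Z.eqb_spec ->.
rewrite zi_mod127 zi_pow; last by lia.
rewrite [in RHS](Z.div_mod x 126) // rmorphD rmorphM expfzDr ?zi3_neq0 //.
rewrite /= -exprz_exp -[_ ^ Posz 126]/(zi 3 ^+ 126).
by rewrite zi3_126 exp1rz mul1r.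
Qed.

Lemma sparse_dotP (es vs : seq Z) acc : all (fun v => ~~ (mod127 v =? 0)%BZ) vs -> forall fs (w : pt F),
  [seq fv w f | f <- fs] = [seq zi v | v <- vs] ->
  zi 3 ^ int_of_Z (sparse_dot es [seq plog (mod127 v) | v <- vs] acc) =
  zi 3 ^ int_of_Z acc * lv w (sparse fs es).
Proof.
move=> hv fs w; elim: fs vs hv es acc => [|f fs IH] [|v vs] //= hv [|e es] acc;
  rewrite /sparse /= ?lv_nil ?mulr1 //.
case/andP: hv => v0 hv [ev /(IH _ hv) {}IH]; case: (Z.eqb_spec e 0) => [e0|_] /=; first exact: IH.
rewrite IH lv_cons /= ev (zi_plog v0) rmorphD rmorphM expfzDr ?zi3_neq0 //.
by rewrite exprz_exp [_ * int_of_Z e]mulrC mulrA.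
Qed.

End Elimination.

Section Independence.
Local Notation F := 'F_127.

Lemma F127_char : zi 127 = 0 :> F.
Proof. by rewrite -[zi _]/(127%:R) pchar_Fp_0. Qed.

Lemma map_intr_inj : injective (@map_mpoly 3 int rat intr).
Proof.
move=> p q e; apply/mpolyP => m; have := congr1 (mcoeff m) e.
by rewrite !mcoeff_map_mpoly => /intr_inj.
Qed.

Definition int_embedding : embedding {mpoly int[3]} K :=
  Embedding (emb := (@tofrac _ \o map_mpoly (intr : int -> rat))%FUN)
    (inj_comp (@tofrac_inj _) map_intr_inj).

Lemma spec_frac (A : idomainType) (B : fieldType) (phi : {rmorphism A -> B}) p :
  spec (frac_embedding A) phi (tofrac p) (phi p).
Proof. exact: (spec_io (frac_embedding A)). Qed.

(* The value of D on the plane [f = 0], when f = D + a lambda_1 + b lambda_2 + c lambda_3. *)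
Definition D_on (k : fieldType) (f : form) (z : pt k) : k :=
  - (zi (coord f 0) * z.1.1.2 + zi (coord f 1) * z.1.2 + zi (coord f 2) * z.2).
Definition on_plane (k : fieldType) (f : form) (z : pt k) : pt k := (D_on f z, z.1.1.2, z.1.2, z.2).

Definition isD1 (f : form) : bool := let: (d, _, _, _) := f in (d =? 1)%BZ.

Lemma fv_on_plane (k : fieldType) f (z : pt k) : isD1 f -> fv (on_plane f z) f = 0.
Proof.
case: f z => [[[d a] b] c] [[[D x] y] w] /= /Z.eqb_spec ->.
by rewrite /D_on /= zi1; ring.
Qed.

Lemma fv_lambda (k : fieldType) (z w : pt k) f : isD f = false ->
  z.1.1.2 = w.1.1.2 -> z.1.2 = w.1.2 -> z.2 = w.2 -> fv z f = fv w f.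
Proof.
case: f z w => [[[d a] b] c] [[[D x] y] u] [[[D' x'] y'] u'] /= /negbFE /Z.eqb_spec ->.
by move=> -> -> ->; rewrite zi0 !mul0r.
Qed.

Lemma exists_D_spec f : exists phi : {rmorphism {mpoly K[4]} -> K},
  spec_pt (frac_embedding {mpoly K[4]}) phi dpt (on_plane f lpt).
Proof.
have l0 : lam (ord4 0) != 0.
  have : fv lpt (0, 1, 0, 0)%BZ != 0.
    by apply/eqP => /(lpt_generic (f := (0, 1, 0, 0)%BZ) (erefl false)).
  by rewrite /= !zi0 !mul0r zi1 add0r !addr0 mul1r.
(* d_1 alone carries the prescribed value of D, the other d_a being 0; hence the division by
   lambda_1. *)
pose v (i : 'I_4) := if i == ord4 0 then D_on f lpt / lam (ord4 0) else 0.
exists (meval v); have spec_const x : spec (frac_embedding {mpoly K[4]}) (meval v) (toKd x) x.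
  have ex : (meval v : {rmorphism {mpoly K[4]} -> K}) x%:MP_[4] = x := mevalC v x.
  by rewrite -[X in spec _ _ _ X]ex; apply: spec_frac.
split=> //; rewrite /dpt /=; try exact: spec_const.
have -> : \sum_(a < 4) dvar a * toKd (lam a) =
    tofrac (\sum_(a < 4) 'X_a * (lam a)%:MP_[4] : {mpoly K[4]}).
  by rewrite rmorph_sum; apply: eq_bigr => a _; rewrite rmorphM.
have -> : D_on f lpt = meval v (\sum_(a < 4) 'X_a * (lam a)%:MP_[4]); last exact: spec_frac.
rewrite rmorph_sum /= (bigD1 (ord4 0)) //= big1 => [|a /negPf a0]; last first.
  by rewrite mevalM mevalXU mevalC /v a0 mul0r.
by rewrite mevalM mevalXU mevalC /v eqxx addr0 divfK.
Qed.

Definition pt127 (r : form) : pt F := zpt F r.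

Lemma exists_mod_spec f xy : exists phi : {rmorphism {mpoly int[3]} -> F},
  spec_pt int_embedding phi (on_plane f lpt) (pt127 (point_on f xy)).
Proof.
pose v (i : 'I_3) : F := nth 0 [:: 1; zi xy.1; zi xy.2] i.
pose phi : {rmorphism {mpoly int[3]} -> F} := mmap (intr : int -> F) v.
have spec_lam i (h : (i < 3)%N) :
    spec int_embedding phi (lam (ord4 i)) (nth 0 [:: 1; zi xy.1; zi xy.2] i).
  have := spec_io int_embedding phi 'X_(Ordinal h).
  by rewrite /= /phi /= map_mpolyX mmapX mmap1U lamE.
exists phi; have s0 := spec_lam 0%N (erefl true); have s1 := spec_lam 1%N (erefl true).
have s2 := spec_lam 2%N (erefl true).
case: f => [[[d a] b] c]; rewrite /on_plane /pt127 /=; split=> //=.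
have ea : zi a = zi a * 1 :> F by rewrite mulr1.
rewrite /D_on /= ziN !ziD !ziM ea.
by apply/specN/specD; [apply: specD|]; apply: specM => //; apply: spec_zi.
Qed.

Definition msum (k : fieldType) (z : pt k) (bt : seq (bool * term)) : k :=
  \sum_(x <- bt) (x.1 : nat)%:R * tv z x.2.

Lemma spec_nat (A : idomainType) (E B : fieldType) (io : embedding A E) (phi : {rmorphism A -> B}) n :
  spec io phi n%:R n%:R.
Proof. by have := spec_io io phi n%:R; rewrite !rmorph_nat. Qed.

Lemma spec_msum (A : idomainType) (E B : fieldType) (io : embedding A E) (phi : {rmorphism A -> B})
    z w (bt : seq (bool * term)) :
  (forall t, t \in unzip2 bt -> spec io phi (tv z t) (tv w t)) -> spec io phi (msum z bt) (msum w bt).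
Proof.
move=> h; apply: spec_sum => x hx; apply: specM; first exact: spec_nat.
by apply: h; apply: map_f.
Qed.

Lemma has_factor_zero (k : fieldType) (z : pt k) f t : isD1 f -> fv z f = 0 -> has_factor f t ->
  tv z t = 0.
Proof.
move=> fD f0 /hasP [fe hfe /andP [/feqP ef pos]].
rewrite /tv /lv (big_rem fe) //= -ef f0 exp0rz.
case: (int_of_Z fe.2 =P 0) => [e|_]; last by rewrite mulr0z /= mul0r mulr0.
by move: pos; rewrite -[fe.2]int_of_ZK e.
Qed.

Lemma zip_map2 (S T : Type) (h : S -> T) (s : seq S) : zip s (map h s) = [seq (x, h x) | x <- s].
Proof. by elim: s => //= x s ->. Qed.

Lemma dot_map (T : Type) (G : T -> Z) (B : T -> F) (s : seq T) :
  dot [seq G x | x <- s] [seq B x | x <- s] = \sum_(x <- s) zi (G x) * B x.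
Proof. by elim: s => [|x s IH]; rewrite ?big_nil // big_cons /= IH. Qed.

Lemma row_value (f : form) (xy : Z * Z) (fs : seq form) (t : term) :
  has (Z.eqb 0) [seq mod127 (fdot (point_on f xy) g) | g <- fs] = false ->
  unit127 (Qnum t.1) -> unit127 (Zpos (Qden t.1)) -> keyeq (sparse fs (dense fs t.2)) t.2 ->
  zi (pexp (sparse_dot (dense fs t.2) [seq plog v | v <- [seq mod127 (fdot (point_on f xy) g) | g <- fs]]
     (plog (mod127 (Qnum t.1)) - plog (Zpos (Qden t.1) mod 127)) mod 126)) =
  tv (pt127 (point_on f xy)) t.
Proof.
move=> /negbT /hasPn nz hnum hden /keyeqP ek; set r := point_on f xy.
rewrite (zi_pexp F127_char).
have -> : [seq plog v | v <- [seq mod127 (fdot r g) | g <- fs]] =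
    [seq plog (mod127 v) | v <- [seq fdot r g | g <- fs]] by rewrite -!map_comp.
rewrite (@sparse_dotP F F127_char _ _ _ _ fs (pt127 r)); last first.
- by rewrite -map_comp; apply: eq_map => g /=; rewrite fv_zpt.
- apply/allP => _ /mapP [g hg ->]; rewrite Z.eqb_sym; apply: nz.
  exact: (map_f (fun g => mod127 (fdot r g))).
rewrite ek /tv qv.unlock rmorphB expfzDr ?(zi3_neq0 F127_char) // -(zi_plog F127_char hnum).
rewrite -[(Z.pos (Qden t.1) mod 127)%BZ]/(mod127 (Zpos (Qden t.1))) -invr_expz.
by rewrite -(zi_plog F127_char hden).
Qed.

(** Two specializations in succession. First D takes its value on f = 0, which is legitimate because
    [no_Dpole] keeps D out of the denominators, and which kills the terms with factor f. Then lambda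
    becomes (1, x, y) over F_127, and each point yields one linear equation between the
    coefficients. *)
Lemma block_checkP pts f (bt : seq (bool * term)) : isD1 f -> block_check pts f (unzip2 bt) ->
  msum dpt bt = 0 ->
  (forall x, x \in bt -> ~~ has_factor f x.2 -> x.1 = false).
Proof.
move=> fD /and4P [/allP noD /allP units /allP keys rank] e0.
have e1 : msum (on_plane f lpt) bt = 0.
  have [phi sp] := exists_D_spec f.
  apply: (@spec_uniq _ _ _ (frac_embedding {mpoly K[4]}) phi (msum dpt bt)); last first.
    by rewrite e0; apply: spec0.
  apply: spec_msum => t ht; apply: spec_tv sp _ _; first by rewrite (zi_neq0 char0_K).
  move=> fe hfe neg; have := allP (noD t ht) fe hfe; case/orP => [nn|/andP [/negbTE lD nf]];
    first by case: fe.2 nn neg.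
  rewrite (fv_lambda (w := lpt) lD) //; apply/eqP => /(lpt_generic lD) z0.
  by move: nf; rewrite z0.
pose bg := [seq x <- bt | ~~ has_factor f x.2].
have eg : unzip2 bg = [seq t <- unzip2 bt | ~~ has_factor f t] by rewrite /bg /unzip2 filter_map.
have e2 : msum (on_plane f lpt) bg = 0.
  rewrite -e1 /msum [RHS](bigID (fun x => has_factor f x.2)) /= [X in _ = X + _]big1 ?add0r.
    by rewrite big_filter.
  by move=> x hx; rewrite (has_factor_zero fD _ hx) ?mulr0 //; apply: fv_on_plane.
move: units keys rank; rewrite -eg; set fs := formsof _; set es := map _ _ => units keys rank.
have hb : all (fun v : F => v == 0) [seq (x.1 : nat)%:R | x : bool * term <- bg].
  apply: (full_rankP F127_char rank); first by rewrite !size_map.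
  move=> row; rewrite mem_pmap => /mapP [xy _]; rewrite /row_at.
  case: ifP => // nz [->]; set r := point_on f xy in nz *.
  have [phi sp] := exists_mod_spec f xy.
  have fnz g : g \in fs -> ~~ (mod127 (fdot r g) =? 0)%BZ.
    move=> hg; rewrite Z.eqb_sym; move/negbT/hasPn: nz; apply.
    exact: (map_f (fun g => mod127 (fdot r g))).
  have e3 : msum (pt127 r) bg = 0.
    apply: (@spec_uniq _ _ _ int_embedding phi (msum (on_plane f lpt) bg)); last first.
      by rewrite e2; apply: spec0.
    apply: spec_msum => t ht; apply: spec_tv sp _ _.
      by apply: (zi_neq0_127 F127_char); case/andP: (units t ht).
    move=> fe hfe _; rewrite fv_zpt; apply: (zi_neq0_127 F127_char); apply: fnz.
    exact: mem_formsof ht hfe.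
  set logs := [seq plog v | v <- _]; rewrite /es /unzip2 -!map_comp dot_map -[RHS]e3 /msum;
    apply: eq_big_seq => x hx /=.
  have hx2 : x.2 \in unzip2 bg by apply: map_f.
  rewrite mulrC; congr (_ * _); case/andP: (units _ hx2) => hnum hden.
  apply: row_value => //; move: keys; rewrite /es zip_map2 => keys.
  exact: (keys _ (map_f (fun t : term => (t, (_, dense fs t.2))) hx2)).
(* A coefficient is 0 or 1, so if it is zero modulo 127 it is zero. *)
move=> x hx nf; have hxg : x \in bg by rewrite mem_filter nf.
have := allP hb _ (map_f (fun x : bool * term => (x.1 : nat)%:R) hxg).
by case: x.1 => //; rewrite oner_eq0.
Qed.

End Independence.

Lemma vanishing_check_small n : n \in iota 1 5 -> vanishing_check n.
Proof. by move: n; apply/allP; vm_compute. Qed.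

Lemma vanishing_check6 : vanishing_check 6.
Proof. by vm_compute. Qed.

Lemma independence_checks n : n \in iota 0 7 -> independence_check blocks (terms n).
Proof. by move: n; apply/allP; vm_compute. Qed.

Lemma macmahon_checked : macmahon_check.
Proof. by vm_compute. Qed.

Lemma vanishing_checks n : (0 < n < 7)%N -> vanishing_check n.
Proof.
case/andP => n0 n7; case: (ltnP n 6) => h; first by apply: vanishing_check_small; rewrite mem_iota n0.
by have -> : n = 6; [lia|exact: vanishing_check6].
Qed.

Lemma parts_zero_free n : (n < 7)%N -> all zero_free (parts n).
Proof.
case: n => [|n] hn; first by [].
by case: (vanishing_checkP (vanishing_checks (n := n.+1) hn)).
Qed.

Lemma independence_checkP bs (bt : seq (bool * term)) : all (fun b => isD1 b.1) bs ->
  independence_check bs (unzip2 bt) -> msum dpt bt = 0 -> forall x, x \in bt -> x.1 = false.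
Proof.
elim: bs bt => [|[f pts] bs IH] bt /=; first by case: bt.
case/andP => fD bD /andP [hb hbs] e0 x hx; have hf := block_checkP fD hb e0.
case: (boolP (has_factor f x.2)) => [hasf|]; last exact: hf.
apply: (IH [seq x <- bt | has_factor f x.2]) => //; last by rewrite mem_filter hasf.
  by move: hbs; rewrite /unzip2 filter_map.
rewrite -e0 /msum [RHS](bigID (fun x => has_factor f x.2)) /= big_filter.
rewrite [X in _ = _ + X]big1_seq ?addr0 // => y /andP [nf hy].
by rewrite (hf y hy nf) mul0r.
Qed.

Lemma sign_unique n (w : array -> K) : (n < 7)%N ->
  (forall s, s \in parts n -> w (array_of s) ^+ 2 = weight_of (array_of s) ^+ 2) ->
  partition_series w n = partition_series weight_of n ->
  forall s, s \in parts n -> w (array_of s) = weight_of (array_of s).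
Proof.
move=> hn hsq hser s hs; have /allP zf := parts_zero_free hn.
(* [b] marks the partitions whose signs disagree. The difference of the two series is -2 times the
   sum of the marked terms. *)
pose b s := w (array_of s) != weight_of (array_of s).
have term_val t : t \in parts n -> tv dpt (term_of t) =
    (\prod_(x <- t) fv dpt (cell_form 1 x)) * toKd (weight_of (array_of t)).
  by move=> ht; rewrite tv_term_of ?zf // /weight_of (representativeE ht) half_weight_dpt.
have diff t : t \in parts n ->
    toKd (w (array_of t)) - toKd (weight_of (array_of t)) =
    - (zi 2 * ((b t : nat)%:R * toKd (weight_of (array_of t)))).
  move=> ht; rewrite /b; case: eqP => [->|ne] /=; first by rewrite subrr mul0r mulr0 oppr0.
  have : (w (array_of t) == weight_of (array_of t)) || (w (array_of t) == - weight_of (array_of t)).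
    by rewrite -eqf_sqr hsq.
  case/orP => /eqP // ->; rewrite !toKdE rmorphN mul1r.
  by rewrite (_ : zi 2 = 1 + 1) //; ring.
have e0 : msum dpt [seq (b t, term_of t) | t <- parts n] = 0.
  have two0 : zi 2 != 0 :> Kd by rewrite (zi_neq0 char0_Kd).
  apply: (mulfI two0); rewrite mulr0; apply: oppr_inj; rewrite oppr0.
  rewrite -(subrr (partition_series w n)) [X in _ = _ - X]hser !partition_seriesE -sumrB.
  rewrite /msum big_map mulr_sumr -sumrN; apply: eq_big_seq => t ht /=.
  rewrite -mulrBr (diff t ht) term_val //; ring.
have : b s = false.
  apply: (independence_checkP (bs := blocks) _ _ e0 (x := (b s, term_of s))) => //.
    rewrite /unzip2 -map_comp; apply: independence_checks.
    by rewrite mem_iota.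
  exact: (map_f (fun t => (b t, term_of t)) hs).
by move/negbFE/eqP.
Qed.

Theorem theorem1p9 :
  exists w : array -> K,
    [/\ sign_choice w,
        fps_eq_mod 7 (partition_series w)
          (fps_rpow (fps_neg_arg (macmahon Kd)) exponent)
      & forall w' : array -> K,
          sign_choice w' ->
          fps_eq_mod 7 (partition_series w')
            (fps_rpow (fps_neg_arg (macmahon Kd)) exponent) ->
          forall pi : array, is_solid_partition pi -> (sp_size pi <= 6)%N ->
            w' pi = w pi].
Proof.
have hser : fps_eq_mod 7 (partition_series weight_of)
    (fps_rpow (fps_neg_arg (macmahon Kd)) exponent).
  move=> n n7; case: (posnP n) => [->|n0]; first exact: partition_series0 macmahon_checked.
  have hn : (0 < n < 7)%N by rewrite n0.
  exact: partition_series_macmahon macmahon_checked hn (vanishing_checks hn).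
have hsgn : sign_choice weight_of.
  by move=> p hp p6; apply: weight_of_sqr hp (parts_zero_free _).
exists weight_of; split=> // w' hw' hser' p hp p6.
have [s hs ep] := representative_solid hp.
rewrite ep; apply: (sign_unique _ _ _ hs) => //; last by rewrite hser // hser'.
move=> t ht; have : array_of t \in solid_partitions (sp_size p).
  by rewrite (perm_mem (solid_partitionsE _)) map_f.
case/mem_solid_partitions => ht1 ht2.
have h6 : (sp_size (array_of t) <= 6)%N by rewrite ht2.
by rewrite (hw' _ ht1 h6) (hsgn _ ht1 h6).
Qed.
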